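(* Let $\ell\ge 1$ be an integer and let $\mathcal L$ be a self-adjoint, positive definite operator in $L_2(0,1)$ generated by the differential expression $$\mathcal L y\equiv(-1)^{\ell}y^{(2\ell)}+\left(\mathcal P_{\ell-1}y^{(\ell-1)}\right)^{(\ell-1)}+\dots+\mathcal P_0y,\qquad \mathcal P_i\in L_1(0,1),\ i=0,\dots,\ell-1,$$ with suitable boundary conditions. Let $\mu$ be a degenerate self-similar probability measure on $[0,1]$ with parameters $n$, $(\alpha_k)$, $(e_k)$, $(d_k)$, $(\beta_k)$, where $m$ is the unique index with $d_m\neq0$ and $a_m=\alpha_{m+1}-\alpha_m$. Let $\mathcal N_{\mathcal L_\mu}(\lambda)$ be the number (with multiplicity) of eigenvalues greater than $\lambda$ of the boundary value problem $\lambda\mathcal L y=\mu y$ (with the given boundary conditions). Then $$\mathcal N_{\mathcal L_\mu}(\lambda)\sim (n-1)\,\frac{\ln(\frac1\lambda)}{\ln(q)},\qquad \lambda\to+0,\qquad\text{where } q=\frac1{|d_m|\cdot a_m^{2\ell-1}}>1.$$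
   Context: Degenerate self-similar probability measure. Let $n\ge2$, $0=\alpha_1<\alpha_2<\dots<\alpha_{n+1}=1$, $a_k=\alpha_{k+1}-\alpha_k$; let $e_k\in\{0,1\}$ and $d_k,\beta_k\in\mathbb R$, $k=1,\dots,n$. Put $S_k(t)=a_kt+\alpha_k$ if $e_k=0$ and $S_k(t)=\alpha_{k+1}-a_kt$ if $e_k=1$, so $S_k$ maps $[0,1]$ onto $[\alpha_k,\alpha_{k+1}]$. The similarity operator is $$\mathcal S[f](t)=\sum_{k=1}^n\left(d_k f(S_k^{-1}(t))+\beta_k\right)\chi_{]\alpha_k,\alpha_{k+1}[}(t).$$ Assume exactly one $d_k$ is nonzero, say $d_m$, and $|d_m|<1$. Then $\mathcal S$ is a contraction in $L_\infty]0,1[$ and has a unique fixed point $f=\mathcal S(f)$, which has a piecewise constant representative of bounded variation. Assume that $f$ has jumps at all points $\alpha_k$, $k=2,\dots,n$. Define $f$ at discontinuity points to be left-continuous (with the one-sided limits as the values at the endpoints $0$ and $1$, and $f(1+0)=f(1)$), and define the discrete signed measure $\mu$ by $\mu([a,b])=f(b+0)-f(a)$, $0\le a\le b\le1$. It is assumed that $\mu$ is a probability measure (nonnegative, total mass one). Eigenvalue problem. Let $Q_{\mathcal L}$ be the quadratic form of $\mathcal L$, with form domain $\mathcal D(Q_{\mathcal L})$, $\stackrel{o}{W}{}_2^{\ell}(0,1)\subset\mathcal D(Q_{\mathcal L})\subset W_2^\ell(0,1)$, where $W_2^\ell(0,1)$ is the Sobolev space of functions with $y^{(\ell-1)}$ absolutely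 continuous on $[0,1]$ and $y^{(\ell)}\in L_2(0,1)$, and $\stackrel{o}{W}{}_2^{\ell}(0,1)$ is its subspace of functions with $y^{(i)}(0)=y^{(i)}(1)=0$, $0\le i\le\ell-1$. The eigenvalues of $\lambda\mathcal Ly=\mu y$ are those of the compact self-adjoint operator defined by the form $\int_0^1|y|^2\,\mu(dt)$ in the Hilbert space $\mathcal D(Q_{\mathcal L})$ with scalar product $Q_{\mathcal L}$ (equivalently, the eigenvalues of the integral equation $\lambda y(t)=\int_0^1G(s,t)y(s)\,\mu(ds)$, where $G$ is the Green function of $\mathcal L$). For $\lambda>0$, $$\mathcal N_{\mathcal L_\mu}(\lambda)=\sup\dim\Big\{\mathfrak H\subset\mathcal D(Q_{\mathcal L}):\ \lambda Q_{\mathcal L}(y,y)<\int_0^1|y(t)|^2\,\mu(dt)\ \text{ for all } 0\ne y\in\mathfrak H\Big\}.$$ The notation $g\sim h$ means $g/h\to1$. *)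

(* Defs.v *)
From HB Require Import structures.
From mathcomp Require Import all_boot all_order all_algebra.
From mathcomp Require Import complex.
From mathcomp Require Import all_classical all_reals all_analysis.

Set Implicit Arguments.
Unset Strict Implicit.
Unset Printing Implicit Defensive.

Import Order.TTheory GRing.Theory Num.Theory.
Import numFieldNormedType.Exports.

Local Open Scope classical_set_scope.
Local Open Scope ring_scope.
Local Open Scope complex_scope.

Notation leb R := (@lebesgue_measure R).

(** ** Self-similar measures

   Indices start at 0: [alpha k], [alpha k.+1] (k < n) are the endpoints of the
   k-th interval, and only the values of [alpha] at 0, ..., n and of [e], [d],
   [beta] at 0, ..., n - 1 matter. *)

Definition subdivision (R : realType) (n : nat) (alpha : nat -> R) : Prop :=
  [/\ alpha 0%N = 0, alpha n = 1 &
      forall k, (k < n)%N -> alpha k < alpha k.+1].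

Definition simmap (R : realType) (alpha : nat -> R) (e : nat -> bool)
    (k : nat) (t : R) : R :=
  let a := alpha k.+1 - alpha k in
  if e k then alpha k.+1 - a * t else a * t + alpha k.

Definition simmap_inv (R : realType) (alpha : nat -> R) (e : nat -> bool)
    (k : nat) (t : R) : R :=
  let a := alpha k.+1 - alpha k in
  if e k then (alpha k.+1 - t) / a else (t - alpha k) / a.

Lemma simmapK (R : realType) (alpha : nat -> R) e k :
  alpha k < alpha k.+1 -> cancel (simmap alpha e k) (simmap_inv alpha e k).
Proof.
rewrite -subr_gt0 /simmap /simmap_inv => /lt0r_neq0 a0 t.
case: (e k); last by rewrite addrK mulrAC divff ?mul1r.
by rewrite opprB addrC subrK mulrAC divff ?mul1r.
Qed.

Lemma simmap_invK (R : realType) (alpha : nat -> R) e k :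
  alpha k < alpha k.+1 -> cancel (simmap_inv alpha e k) (simmap alpha e k).
Proof.
rewrite -subr_gt0 /simmap /simmap_inv => /lt0r_neq0 a0 t.
case: (e k); rewrite mulrCA divff ?mulr1 //; last by rewrite subrK.
by rewrite opprB addrC subrK.
Qed.

Definition simop (R : realType) (n : nat) (alpha : nat -> R) (e : nat -> bool)
    (d beta : nat -> R) (f : R -> R) (t : R) : R :=
  \sum_(k < n) (d k * f (simmap_inv alpha e k t) + beta k)
               * \1_(`]alpha k, alpha k.+1[%classic) t.

(* The left-continuous representative of bounded variation of the fixed point
   in L_oo(0,1) of the similarity operator, extended by f(0) = f(0+). *)
Definition normalized_fixed_point (R : realType) (n : nat) (alpha : nat -> R)
    (e : nat -> bool) (d beta : nat -> R) (f : R -> R) : Prop :=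
  [/\ bounded_variation 0 1 f,
      {ae leb R, forall t : R, t \in `]0, 1[ -> f t = simop n alpha e d beta f t},
      forall t : R, 0 < t <= 1 -> f x @[x --> t^'-] --> f t &
      f x @[x --> (0 : R)^'+] --> f 0].

(* f(b+0) for b in [0,1], with the convention f(1+0) = f(1). *)
Definition right_value (R : realType) (f : R -> R) (b : R) : R :=
  if b < 1 then lim (f x @[x --> b^'+]) else f 1.

(* The measure is carried by [0,1]: its total mass is 1 and so is that of [0,1].
   It is determined by its values on intervals. *)
Definition has_primitive (R : realType)
    (mu : probability (measurableTypeR R) R) (f : R -> R) : Prop :=
  mu `[0, 1]%classic = 1%E /\
  forall a b : R, 0 <= a -> a <= b -> b <= 1 ->
    mu `[a, b]%classic = (right_value f b - f a)%:E.

Definition degenerate_selfsimilar (R : realType) (n : nat) (alpha : nat -> R)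
    (e : nat -> bool) (d beta : nat -> R) (m : nat)
    (mu : probability (measurableTypeR R) R) : Prop :=
  [/\ subdivision n alpha,
      [/\ (m < n)%N, d m != 0, `|d m| < 1 &
          forall k, (k < n)%N -> k != m -> d k = 0] &
      exists f : R -> R,
        [/\ normalized_fixed_point n alpha e d beta f,
            forall k, (0 < k < n)%N ->
              right_value f (alpha k) != f (alpha k) &
            has_primitive mu f]].

(** ** Complex functions on [0,1]

   Functions are total on R; only their restriction to [0,1] is meaningful. *)

Section ComplexFunctions.
Context {R : realType}.
Local Notation C := R[i].
Local Notation I01 := (`[0 : R, 1 : R]%classic : set (measurableTypeR R)).

Definition cintegral d (T : measurableType d)
    (mu : {measure set T -> \bar R}) (D : set T) (f : T -> C) : C :=
  (\int[mu]_(t in D) complex.Re (f t))%R +i*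
  (\int[mu]_(t in D) complex.Im (f t))%R.

Definition sqmod (z : C) : R := complex.Re z ^+ 2 + complex.Im z ^+ 2.

Definition in_L2 (u : R -> C) : Prop :=
  [/\ measurable_fun I01 (fun t => complex.Re (u t)),
      measurable_fun I01 (fun t => complex.Im (u t)) &
      (leb R).-integrable I01 (fun t => (sqmod (u t))%:E)].

Definition L2sqnorm (u : R -> C) : R :=
  (\int[leb R]_(t in I01) sqmod (u t))%R.

Definition L2dot (u v : R -> C) : C :=
  cintegral (leb R) I01 (fun t => u t * (v t)^*%C).

Definition ae_eq01 (u v : R -> C) : Prop :=
  {ae leb R, forall t : R, t \in `[0, 1] -> u t = v t}.

Definition abs_continuous01 (F : R -> R) : Prop :=
  forall eps : R, 0 < eps -> exists2 delta : R, 0 < delta &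
    forall (N : nat) (a b : nat -> R),
      (forall j, (j < N)%N -> 0 <= a j /\ a j <= b j /\ b j <= 1) ->
      (forall i j, (i < N)%N -> (j < N)%N -> i <> j ->
        b i <= a j \/ b j <= a i) ->
      \sum_(j < N) (b j - a j) < delta ->
      \sum_(j < N) `|F (b j) - F (a j)| < eps.

(* F is absolutely continuous on [0,1] and F' = G almost everywhere. *)
Definition ac_derivative (F G : R -> C) : Prop :=
  [/\ abs_continuous01 (fun t => complex.Re (F t)),
      abs_continuous01 (fun t => complex.Im (F t)) &
      {ae leb R, forall t : R, t \in `]0, 1[ ->
        is_derive t (1 : R) (fun s => complex.Re (F s)) (complex.Re (G t)) /\
        is_derive t (1 : R) (fun s => complex.Im (F s)) (complex.Im (G t))}].

(* Y 0, ..., Y l are y, y', ..., y^(l). *)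
Definition sobolev_chain (l : nat) (y : R -> C) (Y : nat -> R -> C) : Prop :=
  [/\ forall t : R, t \in `[0, 1] -> Y 0%N t = y t,
      forall i, (i < l)%N -> ac_derivative (Y i) (Y i.+1) &
      in_L2 (Y l)].

Definition sobolev (l : nat) (y : R -> C) : Prop :=
  exists Y, sobolev_chain l y Y.

Definition sobolev0 (l : nat) (y : R -> C) : Prop :=
  exists2 Y, sobolev_chain l y Y &
    forall i, (i < l)%N -> Y i 0 = 0 /\ Y i 1 = 0.

(** ** The differential operator

   Since the P_i are only summable, the expression
     (-1)^l y^(2l) + (P_{l-1} y^(l-1))^(l-1) + ... + P_0 y
   is read through quasi-derivatives: Y 0, ..., Y l are y, y', ..., y^(l), and
     W 0 = (-1)^l y^(l),
     W k.+1 = (W k)' + P_{l-1-k} y^(l-1-k)   (k < l),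
   with W 0, ..., W (l-1) absolutely continuous; the value is W l. *)

Definition quasi_derivatives (l : nat) (P : nat -> R -> R)
    (Y W : nat -> R -> C) : Prop :=
  [/\ forall i, (i < l)%N -> ac_derivative (Y i) (Y i.+1),
      forall t : R, t \in `[0, 1] -> W 0%N t = (-1) ^+ l * Y l t &
      forall k, (k < l)%N -> ac_derivative (W k)
        (fun t => W k.+1 t - (P (l - k.+1)%N t)%:C * Y (l - k.+1)%N t)].

Definition boundary_values (l : nat) (Y W : nat -> R -> C)
    : 'rV[C]_((l + l) + (l + l)) :=
  row_mx (row_mx (\row_(i < l) Y i 0) (\row_(i < l) Y i 1))
         (row_mx (\row_(i < l) W i 0) (\row_(i < l) W i 1)).

(* The graph of the operator: y is in the domain and L y = w.  The columns of B
   are the r homogeneous boundary conditions. *)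
Definition diff_operator (l : nat) (P : nat -> R -> R) (r : nat)
    (B : 'M[C]_((l + l) + (l + l), r)) (y w : R -> C) : Prop :=
  [/\ in_L2 y, in_L2 w &
      exists Y W : nat -> R -> C,
        [/\ quasi_derivatives l P Y W,
            forall t : R, t \in `[0, 1] -> Y 0%N t = y t,
            ae_eq01 (W l) w &
            boundary_values l Y W *m B = 0]].

(** ** Operators in L_2(0,1), given by their graphs, and their forms *)

Definition densely_defined (L : (R -> C) -> (R -> C) -> Prop) : Prop :=
  forall u, in_L2 u -> forall eps : R, 0 < eps ->
    exists y w, L y w /\ L2sqnorm (u \- y) < eps.

Definition self_adjoint (L : (R -> C) -> (R -> C) -> Prop) : Prop :=
  densely_defined L /\
  forall u v, in_L2 u -> in_L2 v ->
    ((forall y w, L y w -> L2dot w u = L2dot y v) <->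
     (exists2 u', ae_eq01 u' u & L u' v)).

Definition positive_definite (L : (R -> C) -> (R -> C) -> Prop) : Prop :=
  exists2 c : R, 0 < c &
    forall y w, L y w -> c * L2sqnorm y <= complex.Re (L2dot w y).

(* ys is a sequence in the domain of L converging to y in L_2 and Cauchy for
   the form (L y, y); ws is the sequence of the images. *)
Definition form_approx (L : (R -> C) -> (R -> C) -> Prop) (y : R -> C)
    (ys ws : nat -> R -> C) : Prop :=
  [/\ forall k, L (ys k) (ws k),
      L2sqnorm (ys k \- y) @[k --> \oo] --> (0 : R) &
      forall eps : R, 0 < eps -> exists K, forall j k, (K <= j)%N -> (K <= k)%N ->
        complex.Re (L2dot (ws j \- ws k) (ys j \- ys k)) < eps].

(* The domain of the closure of the form (L y, y), as a set of classes. *)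
Definition in_form_closure (L : (R -> C) -> (R -> C) -> Prop) (y : R -> C)
    : Prop :=
  in_L2 y /\ exists ys ws, form_approx L y ys ws.

Definition form_value (L : (R -> C) -> (R -> C) -> Prop) (y z : R -> C) (q : C)
    : Prop :=
  exists ys ws zs vs,
    [/\ form_approx L y ys ws, form_approx L z zs vs,
        complex.Re (L2dot (ws k) (zs k)) @[k --> \oo] --> complex.Re q &
        complex.Im (L2dot (ws k) (zs k)) @[k --> \oo] --> complex.Im q].

Definition qform (L : (R -> C) -> (R -> C) -> Prop) (y z : R -> C) : C :=
  xget 0 [set q | form_value L y z q].

(* Integrating |y|^2 against mu needs the continuous representatives: the form
   domain consists of those, which is no loss under [form_domain_between]. *)
Definition form_domain (l : nat) (L : (R -> C) -> (R -> C) -> Prop)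
    (y : R -> C) : Prop :=
  sobolev l y /\ in_form_closure L y.

Definition form_domain_between (l : nat) (L : (R -> C) -> (R -> C) -> Prop)
    : Prop :=
  (forall y, sobolev0 l y -> in_form_closure L y) /\
  (forall y, in_form_closure L y -> exists2 y', ae_eq01 y' y & sobolev l y').

(** ** Eigenvalues of nu L y = mu y *)

(* A y = nu y, where A is the operator defined by Q(A y, z) = \int y z^* dmu in
   the form domain with scalar product Q. *)
Definition eigenspace_of (l : nat) (L : (R -> C) -> (R -> C) -> Prop)
    (mu : probability (measurableTypeR R) R) (nu : R) (y : R -> C) : Prop :=
  form_domain l L y /\
  forall z, form_domain l L z ->
    nu%:C * qform L y z = cintegral mu I01 (fun t => y t * (z t)^*%C).

Definition independent01 (k : nat) (ys : 'I_k -> R -> C) : Prop :=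
  forall c : 'I_k -> C,
    (forall t : R, t \in `[0, 1] -> \sum_(i < k) c i * ys i t = 0) ->
    forall i, c i = 0.

Definition dim01 (E : (R -> C) -> Prop) : \bar R :=
  ereal_sup [set k%:R%:E | k in
    [set k : nat | exists ys : 'I_k -> R -> C,
       (forall i, E (ys i)) /\ independent01 ys]].

(* The multiplicity of nu is the dimension of its eigenspace (0 when nu is not
   an eigenvalue). *)
Definition eigenvalue_count (l : nat) (L : (R -> C) -> (R -> C) -> Prop)
    (mu : probability (measurableTypeR R) R) (lambda : R) : \bar R :=
  (\esum_(nu in [set nu : R | (lambda < nu)%R])
     dim01 (eigenspace_of l L mu nu))%E.

End ComplexFunctions.

(* Main.v *)
Require Import Defs.
From HB Require Import structures.
From mathcomp Require Import all_boot all_order all_algebra.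
From mathcomp Require Import complex qpoly.
From mathcomp Require Import all_classical all_reals all_analysis.
From mathcomp Require Import measurable_realfun.
From mathcomp Require Import ring lra.

(* Put N = n - 1, a = a_m and delta = |d_m|, so that 1/q = delta a^(2l-1).  The similarity S_m maps the
   atoms of mu at alpha_2, ..., alpha_n to N atoms per generation j, of mass comparable to delta^j
   and a^j-separated, while the generations j >= J carry mass at most delta^J and lie in one interval
   I_J of length a^J.

   At most N J + l eigenvalues exceed C q^(-J): a function y vanishing at the atoms of the first J
   generations and at l nodes of I_J satisfies |y|^2 <= C a^(J(2l-1)) Q(y,y) on I_J by Lagrange
   interpolation, hence int |y|^2 dmu <= C q^(-J) Q(y,y).  At least N J eigenvalues exceed c q^(-J):
   a bump u of width comparable to a^j at an atom of generation j has Q(u,u) <= C a^(-j(2l-1)), and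
   Q(sum_i u_i) <= (sum_i w_i) (sum_i Q(u_i) / w_i) with the weights q^j bounds Q on the span.

   Only two facts about the operator are used.  Since L is symmetric, the boundary term of Green's
   formula is bounded by the boundary values of y, ..., y^(l-1) alone, so that ||y^(l)||^2 <= C (Ly, y).
   The resulting bound sup |y|^2 <= C Q(y,y) makes Cauchy sequences for Q converge uniformly, which
   gives completeness of the form domain and hence eigenvectors, by successive maximisation. *)

Set Implicit Arguments.
Unset Strict Implicit.
Unset Printing Implicit Defensive.

Import Order.TTheory GRing.Theory Num.Theory.
Import numFieldNormedType.Exports.

Local Open Scope classical_set_scope.
Local Open Scope ring_scope.

Local Notation re := complex.Re.
Local Notation im := complex.Im.

(** * Hermitian forms and their eigenvectors *)

Section ComplexNumbers.
Context {R : realType}.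
Implicit Types (a b z : R[i]) (x y : R).

(** The rate q is the growth factor of the quotient energy / mass of a bump from one generation to
    the next: shrinking by [a] multiplies the energy by a^(1-2l), and the mass of the atom is
    multiplied by delta. The constants C and c of the two bounds differ, but this only shifts J by a
    bounded amount, so the count is N ln(1/lambda) / ln q + O(1).

    Bumps of different generations may overlap and need not be orthogonal for Q. With the weights
    q^j the total weight is a geometric sum, comparable with its last term q^J; equal weights would
    cost a further factor N J.

    The boundary conditions are given only by a matrix and the form domain only as a closure, so no
    explicit expression of Q is available on it. Estimates are therefore proved on the operator
    domain, where Green's formula applies to (Ly, z), and then passed to the limit. The count is a
    sum of dimensions of eigenspaces, not a variational quantity, so the lower bound has to produce
    genuine eigenvectors and the upper bound has to assemble them from all eigenspaces. *)

Lemma ReD a b : re (a + b) = re a + re b. Proof. by case: a; case: b. Qed.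
Lemma ImD a b : im (a + b) = im a + im b. Proof. by case: a; case: b. Qed.
Lemma ReN a : re (- a) = - re a. Proof. by case: a. Qed.
Lemma ImN a : im (- a) = - im a. Proof. by case: a. Qed.
Lemma ReB a b : re (a - b) = re a - re b. Proof. by rewrite ReD ReN. Qed.
Lemma ImB a b : im (a - b) = im a - im b. Proof. by rewrite ImD ImN. Qed.
Lemma ReM a b : re (a * b) = re a * re b - im a * im b.
Proof. by case: a; case: b. Qed.
Lemma ImM a b : im (a * b) = re a * im b + im a * re b.
Proof. by case: a => ? ?; case: b. Qed.
Lemma ReJ a : re a^*%C = re a. Proof. by case: a. Qed.
Lemma ImJ a : im a^*%C = - im a. Proof. by case: a. Qed.
Lemma conjcM a b : (a * b)^*%C = a^*%C * b^*%C. Proof. exact: rmorphM. Qed.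
Lemma conjcD a b : (a + b)^*%C = a^*%C + b^*%C. Proof. exact: rmorphD. Qed.
Lemma ReR x : re x%:C%C = x. Proof. by []. Qed.
Lemma ImR x : im x%:C%C = 0. Proof. by []. Qed.
Definition ReImE := (ReD, ImD, ReN, ImN, ReM, ImM, ReJ, ImJ, ReR, ImR).

Lemma eq_ReIm a b : re a = re b -> im a = im b -> a = b.
Proof. by case: a => ? ?; case: b => ? ? /= -> ->. Qed.

Lemma Re_sum (I : Type) (s : seq I) (F : I -> R[i]) :
  re (\sum_(i <- s) F i) = \sum_(i <- s) re (F i).
Proof. by elim/big_rec2: _ => // i x y _ <-; rewrite ReD. Qed.

Lemma Im_sum (I : Type) (s : seq I) (F : I -> R[i]) :
  im (\sum_(i <- s) F i) = \sum_(i <- s) im (F i).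
Proof. by elim/big_rec2: _ => // i x y _ <-; rewrite ImD. Qed.

Lemma sqmod_ge0 z : 0 <= sqmod z. Proof. by rewrite addr_ge0 ?sqr_ge0. Qed.
Lemma sqmod0 : sqmod (0 : R[i]) = 0. Proof. by rewrite /sqmod /= expr0n addr0. Qed.
Lemma sqmod_eq0 z : sqmod z = 0 -> z = 0.
Proof.
move=> /eqP; rewrite paddr_eq0 ?sqr_ge0// !sqrf_eq0 => /andP[/eqP a /eqP b].
exact: eq_ReIm.
Qed.
Lemma sqmodM a b : sqmod (a * b) = sqmod a * sqmod b.
Proof. by rewrite /sqmod !ReImE; ring. Qed.
Lemma sqmodJ z : sqmod z^*%C = sqmod z.
Proof. by rewrite /sqmod !ReImE sqrrN. Qed.
Lemma sqmodN z : sqmod (- z) = sqmod z.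
Proof. by rewrite /sqmod !ReImE !sqrrN. Qed.
Lemma sqmodR x : sqmod x%:C%C = x ^+ 2.
Proof. by rewrite /sqmod /= expr0n addr0. Qed.
Lemma mulcJ z : z * z^*%C = (sqmod z)%:C%C.
Proof. by apply: eq_ReIm; rewrite /sqmod !ReImE; ring. Qed.
Lemma sqmodD a b : sqmod (a + b) <= 2 * sqmod a + 2 * sqmod b.
Proof.
rewrite /sqmod !ReImE -subr_ge0.
rewrite (_ : _ - _ = (re a - re b) ^+ 2 + (im a - im b) ^+ 2); last by ring.
by rewrite addr_ge0 ?sqr_ge0.
Qed.
Lemma Re_sqmod z : re z ^+ 2 <= sqmod z. Proof. by rewrite lerDl sqr_ge0. Qed.
Lemma Im_sqmod z : im z ^+ 2 <= sqmod z. Proof. by rewrite lerDr sqr_ge0. Qed.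

End ComplexNumbers.

(** The left kernel of a [K] by [k] matrix is nonzero because the rank is at most [k < K]. This
    dimension count lies behind every later choice of a combination orthogonal to given vectors or
    vanishing at given points. *)
Lemma homogeneous_solution (F : fieldType) K k (A : 'I_K -> 'I_k -> F) :
  (k < K)%N ->
  exists2 c : 'I_K -> F, (exists i, c i != 0) & forall j, \sum_i c i * A i j = 0.
Proof.
move=> kK; pose M := (\matrix_(i, j) A i j)%R.
have : kermx M != 0.
  rewrite kermx_eq0; apply/negP => /eqP rM.
  by have := rank_leq_col M; rewrite rM leqNgt kK.
move=> /eqP /matrixP ker0.
have [i [j kij]] : exists i j, kermx M i j != 0.
  apply: contrapT => H; apply: ker0 => i j; rewrite [RHS]mxE; apply: contrapT => kij.
  by apply: H; exists i, j; apply/eqP.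
exists (fun j => kermx M i j); first by exists j.
move=> l; have /matrixP/(_ i l) := mulmx_ker M; rewrite !mxE => H.
by apply: etrans _ H; apply: eq_bigr => s _; rewrite [M _ _]mxE.
Qed.

Section HermitianForms.
Context {R : realType} {V : lmodType R[i]}.
Implicit Types (D : V -> Prop) (B : V -> V -> R[i]).

Definition subspace D :=
  D 0 /\ forall (a : R[i]) x y, D x -> D y -> D (a *: x + y).

(** Positivity is only weak: the vectors are functions on the whole line of which only the values on
    [0,1] matter, so a nonzero vector may have length zero. The laws are asked on [D] alone, since
    the forms in use have no meaning elsewhere. *)
Record semi_inner D B : Prop := SemiInner {
  form_lin : forall a x y z, D x -> D y -> D z ->
    B (a *: x + y) z = a * B x z + B y z;
  form_sym : forall x y, D x -> D y -> B y x = (B x y)^*%C;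
  form_pos : forall x, D x -> 0 <= re (B x x) }.

Section Subspace.
Variables (D : V -> Prop) (hD : subspace D).

Lemma subspace0 : D 0. Proof. by case: hD. Qed.
Lemma subspaceZ a x : D x -> D (a *: x).
Proof. by move=> Dx; rewrite -[_ *: _]addr0; apply: hD.2 => //; apply: subspace0. Qed.
Lemma subspaceD x y : D x -> D y -> D (x + y).
Proof. by move=> Dx Dy; rewrite -[x]scale1r; apply: hD.2. Qed.
Lemma subspaceB x y : D x -> D y -> D (x - y).
Proof. by move=> Dx Dy; rewrite addrC -scaleN1r; apply: hD.2. Qed.
Lemma subspace_sum (I : Type) (s : seq I) (F : I -> V) :
  (forall i, D (F i)) -> D (\sum_(i <- s) F i).
Proof.
by move=> DF; apply: big_ind => //; [exact: subspace0|exact: subspaceD].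
Qed.
Lemma subspace_comb k (c : 'I_k -> R[i]) (u : 'I_k -> V) :
  (forall i, D (u i)) -> D (\sum_i c i *: u i).
Proof. by move=> Du; apply: subspace_sum => i; apply: subspaceZ. Qed.

End Subspace.

Section Form.
Variables (D : V -> Prop) (B : V -> V -> R[i]).
Hypotheses (hD : subspace D) (hB : semi_inner D B).
Local Notation q x := (re (B x x)).

Lemma form0l z : D z -> B 0 z = 0.
Proof.
move=> Dz; have := form_lin hB 1 (subspace0 hD) (subspace0 hD) Dz.
by rewrite scale1r addr0 mul1r => /eqP; rewrite -subr_eq subrr eq_sym => /eqP.
Qed.
Lemma formZl a x z : D x -> D z -> B (a *: x) z = a * B x z.
Proof.
move=> Dx Dz; have := form_lin hB a Dx (subspace0 hD) Dz.
by rewrite addr0 form0l// addr0.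
Qed.
Lemma formDl x y z : D x -> D y -> D z -> B (x + y) z = B x z + B y z.
Proof.
by move=> Dx Dy Dz; have := form_lin hB 1 Dx Dy Dz; rewrite scale1r mul1r.
Qed.
Lemma formBl x y z : D x -> D y -> D z -> B (x - y) z = B x z - B y z.
Proof.
move=> Dx Dy Dz; have := form_lin hB (-1) Dy Dx Dz.
by rewrite scaleN1r mulN1r addrC => ->; rewrite addrC.
Qed.
Lemma formZr a x z : D x -> D z -> B z (a *: x) = a^*%C * B z x.
Proof.
move=> Dx Dz; have Dax := subspaceZ hD a Dx.
by rewrite (form_sym hB Dax Dz) formZl// rmorphM/= -(form_sym hB Dx Dz).
Qed.
Lemma formDr x y z : D x -> D y -> D z -> B z (x + y) = B z x + B z y.
Proof.
move=> Dx Dy Dz; have Dxy := subspaceD hD Dx Dy.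
by rewrite (form_sym hB Dxy Dz) formDl// rmorphD/= -!(form_sym hB _ Dz).
Qed.
Lemma formBr x y z : D x -> D y -> D z -> B z (x - y) = B z x - B z y.
Proof.
move=> Dx Dy Dz; have Dxy := subspaceB hD Dx Dy.
by rewrite (form_sym hB Dxy Dz) formBl// rmorphB/= -!(form_sym hB _ Dz).
Qed.
Lemma form_suml (I : Type) (s : seq I) (F : I -> V) z : (forall i, D (F i)) -> D z ->
  B (\sum_(i <- s) F i) z = \sum_(i <- s) B (F i) z.
Proof.
move=> DF Dz; elim: s => [|i s IH]; first by rewrite !big_nil form0l.
by rewrite !big_cons formDl ?IH//; apply: subspace_sum.
Qed.
Lemma form_combl k (c : 'I_k -> R[i]) (u : 'I_k -> V) z :
  (forall i, D (u i)) -> D z ->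
  B (\sum_i c i *: u i) z = \sum_i c i * B (u i) z.
Proof.
move=> Du Dz; rewrite form_suml//; last by move=> i; apply: subspaceZ.
by apply: eq_bigr => i _; rewrite formZl.
Qed.
Lemma form_combr k (c : 'I_k -> R[i]) (u : 'I_k -> V) z :
  (forall i, D (u i)) -> D z ->
  B z (\sum_i c i *: u i) = \sum_i (c i)^*%C * B z (u i).
Proof.
move=> Du Dz; have Ds := subspace_comb hD c Du.
rewrite (form_sym hB Ds Dz) form_combl// rmorph_sum; apply: eq_bigr => i _ /=.
by rewrite rmorphM/= -(form_sym hB).
Qed.
Lemma formxx x : D x -> B x x = (q x)%:C%C.
Proof.
move=> Dx; have := congr1 (@complex.Im R) (form_sym hB Dx Dx); rewrite ImJ => H.
by apply: eq_ReIm => //; rewrite ImR; lra.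
Qed.
Lemma form_re_sym x y : D x -> D y -> re (B y x) = re (B x y).
Proof. by move=> Dx Dy; rewrite (form_sym hB Dx Dy) ReJ. Qed.
Lemma qform0 : q 0 = 0. Proof. by rewrite form0l//; exact: subspace0. Qed.
Lemma qformZ a x : D x -> q (a *: x) = sqmod a * q x.
Proof.
move=> Dx; have Da := subspaceZ hD a Dx; rewrite formZl// formZr// mulrA mulcJ.
by rewrite ReM ImR mul0r subr0.
Qed.
Lemma qformD x y : D x -> D y -> q (x + y) = q x + q y + 2 * re (B x y).
Proof.
move=> Dx Dy; have Dxy := subspaceD hD Dx Dy.
by rewrite formDl// !formDr// !ReD (form_re_sym Dx Dy); ring.
Qed.
Lemma qformB x y : D x -> D y -> q (x - y) = q x + q y - 2 * re (B x y).
Proof.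
move=> Dx Dy; have Dxy := subspaceB hD Dx Dy.
by rewrite formBl// !formBr// !ReB (form_re_sym Dx Dy); ring.
Qed.
Lemma qform_BC x y : D x -> D y -> q (x - y) = q (y - x).
Proof. by move=> Dx Dy; rewrite !qformB// (form_re_sym Dx Dy); ring. Qed.
Lemma qformD2 x y : D x -> D y -> q (x + y) <= 2 * q x + 2 * q y.
Proof.
move=> Dx Dy; have := form_pos hB (subspaceB hD Dx Dy).
by rewrite qformB// qformD//; lra.
Qed.
Lemma qformB2 x y : D x -> D y -> q (x - y) <= 2 * q x + 2 * q y.
Proof.
move=> Dx Dy; have := form_pos hB (subspaceD hD Dx Dy).
by rewrite qformB// qformD//; lra.
Qed.

(** Positivity at [x - (t * B x y) y] is a quadratic inequality in the real [t]. If [q y > 0], take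
    [t = 1 / q y]; if [q y = 0], the inequality is affine in [t] and [t = (q x + 1) / s] contradicts
    it unless [s = 0]. *)
Lemma form_cauchy_schwarz x y : D x -> D y -> sqmod (B x y) <= q x * q y.
Proof.
move=> Dx Dy; set s := sqmod (B x y).
have s0 : 0 <= s by apply: sqmod_ge0.
have key (t : R) : 0 <= q x - 2 * t * s + t ^+ 2 * s * q y.
  have Day := subspaceZ hD (t%:C%C * B x y) Dy.
  have := form_pos hB (subspaceB hD Dx Day).
  rewrite qformB// qformZ// sqmodM sqmodR formZr// conjcM conjc_real -!mulrA.
  rewrite [_^*%C * B x y]mulrC mulcJ !ReImE/= -/s !(mulr0, subr0, oppr0, mul0r).
  by move=> ?; lra.
have qx := form_pos hB Dx; have qy := form_pos hB Dy.
have [sp|] := ltP 0 s; last by move=> sn; apply: le_trans sn _; apply: mulr_ge0.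
have [yp|] := ltP 0 (q y).
  have := key (q y)^-1.
  rewrite (_ : _ + _ = q x - s / q y); last by field; apply: lt0r_neq0.
  by rewrite subr_ge0 ler_pdivrMr.
move=> yn; have y0 : q y = 0 by lra.
have := key ((q x + 1) / s); rewrite y0 mulr0 addr0 -mulrA divfK ?lt0r_neq0//.
by move=> ?; exfalso; lra.
Qed.

Lemma form_re_le x y : D x -> D y ->
  `|re (B x y)| <= Num.sqrt (q x) * Num.sqrt (q y).
Proof.
move=> Dx Dy; rewrite -sqrtrM ?(form_pos hB)// -sqrtr_sqr ler_sqrt; last first.
  by rewrite mulr_ge0// (form_pos hB).
exact: le_trans (Re_sqmod _) (form_cauchy_schwarz Dx Dy).
Qed.

Lemma form_eq0 x y : D x -> D y -> q x = 0 -> B x y = 0.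
Proof.
move=> Dx Dy qx0; apply: sqmod_eq0; apply/eqP; rewrite eq_le sqmod_ge0 andbT.
by apply: le_trans (form_cauchy_schwarz Dx Dy) _; rewrite qx0 mul0r.
Qed.

(** Induction on the list. The cross term is at most 2 sqrt(a) sqrt(W S) by Cauchy-Schwarz and the
    induction hypothesis, and the arithmetic-geometric mean inequality splits this into [v * S] and
    [W * a / v], the mixed terms of the expanded product. *)
Lemma qform_wsum (I : Type) (s : seq I) (w : I -> R) (F : I -> V) :
  (forall i, 0 < w i) -> (forall i, D (F i)) ->
  q (\sum_(i <- s) F i) <= (\sum_(i <- s) w i) * \sum_(i <- s) q (F i) / w i.
Proof.
move=> w0 DF; elim: s => [|i s IH]; first by rewrite !big_nil qform0 mul0r.
rewrite !big_cons; set x := \sum_(j <- s) F j in IH *.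
set W := \sum_(j <- s) w j in IH *; set S := \sum_(j <- s) _ in IH *.
have Dx : D x by apply: subspace_sum.
have S0 : 0 <= S.
  by apply: sumr_ge0 => j _; rewrite divr_ge0 ?(form_pos hB)// ltW.
have W0 : 0 <= W by apply: sumr_ge0 => j _; apply: ltW.
rewrite qformD//; set a := q (F i); have a0 : 0 <= a by apply: (form_pos hB).
have /(le_trans (ler_norm _)) re_le := form_re_le (DF i) Dx.
have wi := w0 i; set v := w i in wi *.
rewrite (_ : (v + W) * _ = a + v * S + W * a / v + W * S); last by field; apply: lt0r_neq0.
have v0 := ltW wi; have vi0 : 0 <= v^-1 by rewrite invr_ge0.
have p0 : 0 <= W * a / v by rewrite divr_ge0 ?mulr_ge0// ltW.
have r0 : 0 <= v * S by rewrite mulr_ge0// ltW.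
suff : 2 * re (B (F i) x) <= v * S + W * a / v by lra.
have : Num.sqrt a * Num.sqrt (q x) <= Num.sqrt (W * a / v) * Num.sqrt (v * S).
  rewrite -!sqrtrM// ler_sqrt ?mulr_ge0//.
  rewrite (_ : _ * (v * S) = a * (W * S)); last by field; apply: lt0r_neq0.
  exact: ler_wpM2l.
have := sqr_ge0 (Num.sqrt (W * a / v) - Num.sqrt (v * S)).
by rewrite sqrrB !sqr_sqrtr//; rewrite -/a in re_le; lra.
Qed.

Definition orthonormal k (e : nat -> V) :=
  forall i j, (i < k)%N -> (j < k)%N -> B (e i) (e j) = (i == j)%:R.

Lemma orthogonal_comb K (u : 'I_K -> V) k (e : nat -> V) : (k < K)%N ->
  (forall i, D (u i)) -> (forall i, (i < k)%N -> D (e i)) ->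
  exists2 c : 'I_K -> R[i], (exists i, c i != 0) &
    forall i, (i < k)%N -> B (\sum_j c j *: u j) (e i) = 0.
Proof.
move=> kK Du De.
have [c c0 hc] := homogeneous_solution (fun i (j : 'I_k) => B (u i) (e j)) kK.
exists c => // i ik; rewrite form_combl//; last exact: De.
exact: (hc (Ordinal ik)).
Qed.

Lemma normalize x : D x -> 0 < q x ->
  exists2 a : R[i], sqmod a = (q x)^-1 & q (a *: x) = 1.
Proof.
move=> Dx qx; have qx' := ltW qx.
exists (Num.sqrt (q x))^-1%:C%C.
  by rewrite sqmodR exprVn sqr_sqrtr.
by rewrite qformZ// sqmodR exprVn sqr_sqrtr// mulVf ?lt0r_neq0.
Qed.

(** In place of the Gram-Schmidt formulas, each stage takes a combination of the [K] vectors
    orthogonal to the [k < K] vectors already built. The last hypothesis, independence modulo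
    vectors of length zero, makes it normalizable. *)
Lemma orthonormalize (E : V -> Prop) K (u : 'I_K -> V) :
  subspace E -> (forall x, E x -> D x) -> (forall i, E (u i)) ->
  (forall c : 'I_K -> R[i], (exists i, c i != 0) -> 0 < q (\sum_i c i *: u i)) ->
  exists2 e : nat -> V, (forall i, (i < K)%N -> E (e i)) & orthonormal K e.
Proof.
move=> hE ED Eu hu.
suff H k : (k <= K)%N ->
    exists2 e : nat -> V, (forall i, (i < k)%N -> E (e i)) & orthonormal k e.
  exact: H.
elim: k => [_|k IH kK]; first by exists (fun=> 0).
have [e Ee oe] := IH (ltnW kK).
have [c c0 hc] := orthogonal_comb kK (fun i => ED _ (Eu i)) (fun i ik => ED _ (Ee i ik)).
set x := \sum_j c j *: u j in hc *.
have Ex : E x by apply: subspace_comb.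
have Dx := ED _ Ex.
have [a _ qa] := normalize Dx (hu _ c0).
exists (fun i => if i == k then a *: x else e i).
  move=> i; rewrite ltnS leq_eqVlt; case: eqP => /= [_ _|_ /Ee//].
  exact: subspaceZ.
move=> i j; rewrite !ltnS leq_eqVlt [(j <= k)%N]leq_eqVlt.
have Dax := subspaceZ hD a Dx.
case: (eqVneq i k) => [->|ik] /=; case: (eqVneq j k) => [->|jk] //=.
- by rewrite formxx// qa.
- by move=> _ jk'; rewrite formZl ?hc ?mulr0 1?eq_sym ?(negbTE jk)//; exact/ED/Ee.
- move=> ik' _; have Dei := ED _ (Ee _ ik').
  by rewrite formZr// (form_sym hB Dx Dei) hc// rmorph0 mulr0 (negbTE ik).
- exact: oe.
Qed.

End Form.
End HermitianForms.

Lemma exists_choice (X Y : Type) (P : X -> Y -> Prop) :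
  (forall x, exists y, P x y) -> exists f, forall x, P x (f x).
Proof. by move=> /choice[f hf]; exists f. Qed.

(** The image of the ultrafilter clusters in a compact interval, and a cluster point of an
    ultrafilter is a limit. Ultrafilters replace the repeated extraction of subsequences. *)
Lemma ultra_cauchy (R : realType) (U : set_system nat) (x : nat -> R) (c : R) :
  UltraFilter U -> (forall k, `|x k| <= c) -> forall eps : R, 0 < eps ->
  exists2 A, U A & forall j k, A j -> A k -> `|x j - x k| < eps.
Proof.
move=> UU xc eps e0.
have : compact `[- c, c]%classic by exact: segment_compact.
move=> /(_ (x @ U)) [|p [_ pU]].
  suff : U (x @^-1` `[- c, c]%classic) by [].
  by apply: filterE => k /=; rewrite in_itv/=; have := xc k; rewrite ler_norml.
pose B := ball p (eps / 2).
have [UB|UB] := in_ultra_setVsetC (x @^-1` B) UU.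
  exists (x @^-1` B) => // j k; rewrite /B /ball/= => pj pk.
  rewrite (_ : x j - x k = (p - x k) - (p - x j)); last by ring.
  by apply: le_lt_trans (ler_normB _ _) _; rewrite [eps]splitr ltrD.
have := pU (~` B) B UB; case.
  by apply: nbhsx_ballx; rewrite divr_gt0.
by move=> y [].
Qed.

(** * Eigenvectors of a compact form by successive maximisation *)

Section Spectral.
Context {R : realType} {V : lmodType R[i]}.
Variables (D : V -> Prop) (Q M : V -> V -> R[i]).
Hypotheses (hD : subspace D) (hQ : semi_inner D Q) (hM : semi_inner D M).
Local Notation q x := (re (Q x x)).
Local Notation m x := (re (M x x)).

Definition complete_for (E : V -> Prop) :=
  forall u : nat -> V, (forall k, E (u k)) ->
    (forall eps : R, 0 < eps -> exists K, forall j k, (K <= j)%N -> (K <= k)%N ->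
       q (u j - u k) < eps) ->
  exists2 y, E y & forall eps : R, 0 < eps -> exists K, forall k, (K <= k)%N ->
       q (y - u k) < eps.

(** Modulo [eps * q], the form [m] is dominated by finitely many bounded additive functionals. This
    expresses compactness of the operator attached to [M] without weak convergence; in the
    application the functionals are evaluations at atoms. *)
Definition relatively_compact :=
  forall eps : R, 0 < eps -> exists (N : nat) (ev : 'I_N -> V -> R[i]) (C : R),
    [/\ forall i x y, D x -> D y -> ev i (x - y) = ev i x - ev i y,
        forall i x, D x -> sqmod (ev i x) <= C * q x &
        forall x, D x -> m x <= \sum_i sqmod (ev i x) + eps * q x].

Hypotheses (Qcomplete : complete_for D) (Mcompact : relatively_compact).

Lemma relatively_compact_bound :
  exists2 C : R, 0 <= C & forall x, D x -> m x <= C * q x.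
Proof.
have [N [ev [C [_ evC MC]]]] := Mcompact ltr01.
exists (`|C| *+ N + 1); first by rewrite addr_ge0// mulrn_wge0.
move=> x Dx; apply: le_trans (MC _ Dx) _; rewrite mulrDl mul1r lerD2r// .
have qx := form_pos hQ Dx.
apply: (@le_trans _ _ (\sum_(i < N) `|C| * q x)).
  apply: ler_sum => i _; apply: le_trans (evC i _ Dx) _.
  by rewrite ler_wpM2r// ler_norm.
by rewrite sumr_const card_ord -mulrnAl.
Qed.

Lemma relatively_compact_ultra (U : set_system nat) (u : nat -> V) :
  UltraFilter U -> (forall k, D (u k)) -> (forall k, q (u k) <= 1) ->
  forall eps : R, 0 < eps ->
  exists2 A, U A & forall j k, A j -> A k -> m (u j - u k) < eps.
Proof.
move=> UU Du qu eps e0.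
(* Since [q (u j - u k) <= 4], the term with this factor is at most [eps / 4]. The choice of [dl]
   below keeps the sum over the [N] functionals at most [eps / 2], each real or imaginary part
   contributing its own [dl ^+ 2]. *)
have e8 : 0 < eps / 16 by lra.
have [N [ev [C [evB evC MC]]]] := Mcompact e8.
pose dl := Num.sqrt (eps / (4 * N.+1%:R)).
have N0 : 0 < N.+1%:R :> R by [].
have dl0 : 0 < dl by rewrite sqrtr_gt0 divr_gt0// mulr_gt0.
have evb i k : sqmod (ev i (u k)) <= `|C|.
  apply: le_trans (evC i _ (Du k)) _; apply: le_trans (ler_norm _) _.
  by rewrite normrM ler_piMr// ger0_norm ?qu// (form_pos hQ).
have sqb (a : R) : a ^+ 2 <= `|C| -> `|a| <= Num.sqrt `|C|.
  by move=> ?; rewrite -sqrtr_sqr ler_sqrt.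
have reb i k : `|re (ev i (u k))| <= Num.sqrt `|C|.
  by apply: sqb; apply: le_trans (Re_sqmod _) (evb i k).
have imb i k : `|im (ev i (u k))| <= Num.sqrt `|C|.
  by apply: sqb; apply: le_trans (Im_sqmod _) (evb i k).
pose P i (A : set nat) := forall j k : nat, A j -> A k ->
  sqmod (ev i (u j) - ev i (u k)) < eps / (2 * N.+1%:R).
have HP i : exists2 A, U A & P i A.
  have [A1 U1 H1] := ultra_cauchy UU (reb i) dl0.
  have [A2 U2 H2] := ultra_cauchy UU (imb i) dl0.
  exists (A1 `&` A2); first exact: filterI.
  move=> j k [j1 j2] [k1 k2]; rewrite /sqmod ReB ImB.
  have h (a : R) : `|a| < dl -> a ^+ 2 < eps / (4 * N.+1%:R).
    move=> ad; rewrite -[ltRHS]sqr_sqrtr; last by rewrite divr_ge0// ltW.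
    by rewrite -real_normK ?num_real// ltr_pXn2r// nnegrE ltW.
  have -> : eps / (2 * N.+1%:R) = eps / (4 * N.+1%:R) + eps / (4 * N.+1%:R).
    by field; rewrite lt0r_neq0.
  by apply: ltrD; apply: h; [exact: H1|exact: H2].
have [A hA] : exists A : 'I_N -> set nat, forall i, U (A i) /\ P i (A i).
  by apply: (exists_choice (P := fun i A => U A /\ P i A)) => i; have [A ? ?] := HP i; exists A.
exists [set k | forall i, A i k].
  by apply: filter_forall => i; exact: (hA i).1.
move=> j k Aj Ak; have Djk := subspaceB hD (Du j) (Du k).
apply: le_lt_trans (MC _ Djk) _.
have q4 : q (u j - u k) <= 4.
  have := qformB2 hD hQ (Du j) (Du k).
  by have := qu j; have := qu k; lra.
have : \sum_i sqmod (ev i (u j - u k)) <= eps / 2 * (N%:R / N.+1%:R).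
  apply: (@le_trans _ _ (\sum_(i < N) eps / (2 * N.+1%:R))).
    apply: ler_sum => i _; rewrite evB//; apply: ltW; apply: (hA i).2.
      exact: Aj.
    exact: Ak.
  rewrite sumr_const card_ord -mulr_natr le_eqVlt; apply/orP; left; apply/eqP.
  by field; rewrite lt0r_neq0.
have : N%:R / N.+1%:R < 1 :> R by rewrite ltr_pdivrMr// mul1r ltr_nat.
have : 0 <= N%:R / N.+1%:R :> R by rewrite divr_ge0.
set z := N%:R / _ => z0 z1.
have : eps / 2 * z <= eps / 2 * 1 by rewrite ler_wpM2l//; lra.
have : eps / 16 * q (u j - u k) <= eps / 16 * 4 by rewrite ler_wpM2l// ltW.
by move=> ? ? ?; lra.
Qed.

Lemma qform_scale_le (B : V -> V -> R[i]) (E : V -> Prop) (s : R) :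
  semi_inner D B -> subspace E -> (forall x, E x -> D x) ->
  (forall x, E x -> q x = 0 -> re (B x x) <= 0) ->
  (forall x, E x -> q x = 1 -> re (B x x) <= s) ->
  forall x, E x -> re (B x x) <= s * q x.
Proof.
move=> hB hE ED B0 B1 x Ex; have Dx := ED _ Ex.
have := form_pos hQ Dx; rewrite le_eqVlt => /predU1P[/esym qx|qx].
  by rewrite qx mulr0 B0.
have [a ha qa] := normalize hD hQ Dx qx.
have := B1 _ (subspaceZ hE a Ex) qa.
by rewrite (qformZ hD hB)// ha mulrC ler_pdivrMr.
Qed.

(* A sequence u maximising m / q on E, with supremum s, satisfies (s q - m) (u_j - u_k) -> 0;
   along an ultrafilter m (u_j - u_k) -> 0 as well, so u has a q-Cauchy subsequence. *)
Lemma max_eigenvector (E : V -> Prop) (x0 : V) (lam : R) :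
  subspace E -> (forall x, E x -> D x) -> complete_for E ->
  E x0 -> 0 < lam -> lam * q x0 < m x0 ->
  exists y s, [/\ E y, q y = 1, lam < s &
    forall z, E z -> M y z = s%:C%C * Q y z].
Proof.
move=> hE ED Ecomp Ex0 lam0 mx0.
have [C C0 mC] := relatively_compact_bound.
have Dx0 := ED _ Ex0.
have qx0 : 0 < q x0.
  rewrite lt_neqAle (form_pos hQ)// andbT; apply/eqP => qx0.
  by have := mC _ Dx0; rewrite -qx0 in mx0 *; rewrite !mulr0 in mx0 *; lra.
pose S := [set m x | x in [set x | E x /\ q x = 1]].
have [a ha qa] := normalize hD hQ Dx0 qx0.
have Sx0 : S (m (a *: x0)) by exists (a *: x0) => //; split=> //; apply: subspaceZ.
have hS : has_sup S.
  split; first by exists (m (a *: x0)).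
  by exists C => _ [x [Ex qx] <-]; rewrite -[C]mulr1 -qx; apply/mC/ED.
pose s := sup S.
have ls : lam < s.
  have h := sup_upper_bound hS Sx0; apply: lt_le_trans h.
  by rewrite (qformZ hD hM)// ha mulrC ltr_pdivlMr.
have s0 : 0 < s := lt_trans lam0 ls.
have ms : forall x, E x -> m x <= s * q x.
  apply: (qform_scale_le hM) => // x Ex qx.
    by have := mC _ (ED _ Ex); rewrite qx mulr0.
  by apply: (sup_upper_bound hS); exists x.
(* As [s] is the supremum, [B] is semi-definite on [E]. A vector with [B y y = 0] then lies in the
   kernel of [B] by Cauchy-Schwarz, which is the eigenvalue equation on [E]. *)
pose B x y := s%:C%C * Q x y - M x y.
have bE x : re (B x x) = s * q x - m x by rewrite /B ReB ReM ReR ImR mul0r subr0.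
have hB : semi_inner E B.
  split.
  - move=> b x y z /ED Dx /ED Dy /ED Dz.
    by rewrite /B (form_lin hQ)// (form_lin hM)//; ring.
  - move=> x y Ex Ey; rewrite /B (form_sym hQ (ED _ Ex) (ED _ Ey)).
    rewrite (form_sym hM (ED _ Ex) (ED _ Ey)).
    by rewrite [RHS]rmorphB/= conjcM conjc_real.
  - by move=> x Ex; rewrite bE subr_ge0 ms.
have [u hu] : exists u : nat -> V, forall k, [/\ E (u k), q (u k) = 1 &
    s - k.+1%:R^-1 < m (u k)].
  apply: (exists_choice (P := fun k x => [/\ E x, q x = 1 & s - k.+1%:R^-1 < m x])) => k.
  have k0 : 0 < k.+1%:R^-1 :> R by rewrite invr_gt0.
  have [_ [x [Ex qx] <-] hx] := sup_adherent k0 hS.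
  by exists x.
have Eu k : E (u k) by case: (hu k).
have qu k : q (u k) = 1 by case: (hu k).
have Du k : D (u k) by apply: ED.
have bu k : re (B (u k) (u k)) < k.+1%:R^-1.
  by case: (hu k) => _ _; rewrite bE qu mulr1 !ltrBlDr addrC.
have [U [UU eU]] := ultraFilterLemma (F := \oo) _.
have inv_small (eps : R) : 0 < eps -> U [set k | k.+1%:R^-1 < eps].
  move=> e0; apply: eU; exists (Num.truncn eps^-1).+1 => // k /= hk.
  rewrite invf_plt ?posrE//.
  by apply: lt_le_trans (truncnS_gt _) _; rewrite ler_nat ltnW.
(* The seminorm is recovered from [s * q = B + m]: on differences, [B] is small because the sequence
   is maximising, and [m] is small by relative compactness. *)
have cau (eps : R) : 0 < eps ->
    exists2 A, U A & forall j k, A j -> A k -> q (u j - u k) < eps.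
  move=> e0; have e1 : 0 < s * eps / 8 by rewrite divr_gt0// mulr_gt0.
  have [A UA hA] := relatively_compact_ultra UU Du
    (fun k => eq_ind_r (fun z => is_true (z <= 1)) (lexx 1) (qu k)) e1.
  exists (A `&` [set k | k.+1%:R^-1 < s * eps / 8]).
    by apply: filterI => //; apply: inv_small.
  move=> j k [Aj /= hj] [Ak hk].
  have := hA _ _ Aj Ak; have := qformB2 hE hB (Eu j) (Eu k).
  rewrite bE; have := lt_trans (bu j) hj; have := lt_trans (bu k) hk => *.
  by rewrite -(ltr_pM2l s0); lra.
have [A hA] : exists A : nat -> set nat, forall p, U (A p) /\
    forall j k, A p j -> A p k -> q (u j - u k) < p.+1%:R^-1.
  apply: (exists_choice (P := fun p A => U A /\
    forall j k, A j -> A k -> q (u j - u k) < p.+1%:R^-1)) => p.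
  have p0 : 0 < p.+1%:R^-1 :> R by rewrite invr_gt0.
  by have [A ? ?] := cau _ p0; exists A.
(* Diagonal choice: [j p] is taken in the first [p + 1] of the sets [A i], with an index large
   enough, so the tail of [u \o j] is both Cauchy and maximising. *)
pose A' p := [set k | forall i : 'I_p.+1, A i k /\ k.+1%:R^-1 < i.+1%:R^-1 :> R].
have UA' p : U (A' p).
  apply: filter_forall => i; apply: filterI; first exact: (hA i).1.
  by apply: inv_small; rewrite invr_gt0.
have [j hj] : exists j : nat -> nat, forall p, A' p (j p).
  by apply: exists_choice => p; exact: filter_ex (UA' p).
have hj' p r : (r <= p)%N -> A r (j p) /\ (j p).+1%:R^-1 < r.+1%:R^-1 :> R.
  by move=> rp; have := hj p (Ordinal (rp : (r < p.+1)%N)).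
have small (eps : R) : 0 < eps -> exists r, r.+1%:R^-1 < eps.
  by move=> e0; have /filter_ex[r] := inv_small _ e0; exists r.
have [|y Ey hy] := Ecomp (u \o j) (fun p => Eu (j p)).
  move=> eps e0; have [r hr] := small _ e0; exists r => p p' rp rp'.
  apply: lt_trans hr; apply: (hA r).2.
    exact: (hj' _ _ rp).1.
  exact: (hj' _ _ rp').1.
have Dy := ED _ Ey.
have by0 : re (B y y) = 0.
  apply/eqP; rewrite eq_le (form_pos hB)// andbT leNgt; apply/negP => by0.
  have e1 : 0 < re (B y y) / 8 / s by rewrite !divr_gt0.
  have [K hK] := hy _ e1.
  have e2 : 0 < re (B y y) / 8 by lra.
  have [r hr] := small _ e2.
  pose p := maxn K r.
  have h1 := hK p (leq_maxl _ _).
  have h2 := (hj' p r (leq_maxr _ _)).2.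
  have h3 := lt_trans (bu (j p)) (lt_trans h2 hr).
  have := qformD2 hE hB (subspaceB hE Ey (Eu (j p))) (Eu (j p)).
  rewrite subrK => h4.
  have Dd : D (y - u (j p)) := subspaceB hD Dy (Du _).
  have h5 : re (B (y - u (j p)) (y - u (j p))) <= s * q (y - u (j p)).
    by rewrite bE gerBl (form_pos hM).
  have h6 : s * q (y - u (j p)) < s * (re (B y y) / 8 / s).
    by rewrite ltr_pM2l.
  move: h6; rewrite [ltRHS](_ : _ = re (B y y) / 8); last by field; exact: lt0r_neq0.
  by move=> h6; lra.
have qy : 0 < q y.
  rewrite lt_neqAle (form_pos hQ)// andbT; apply/eqP => qy.
  have e4 : 0 < 1 / 4 :> R by lra.
  have [K' hK'] := hy _ e4.
  have h1 := hK' K' (leqnn _).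
  have := qformB2 hD hQ Dy (subspaceB hD Dy (Du (j K'))).
  by rewrite opprB addrC subrK qu; rewrite /comp in h1 *; lra.
have eigy z : E z -> M y z = s%:C%C * Q y z.
  move=> Ez; have := form_eq0 hE hB Ey Ez by0.
  by move=> /eqP; rewrite subr_eq0 => /eqP.
have [b hb qb] := normalize hD hQ Dy qy.
exists (b *: y), s; split=> //; first exact: subspaceZ.
move=> z Ez; have Dz := ED _ Ez.
by rewrite (formZl hD hM)// (formZl hD hQ)// eigy//; ring.
Qed.

(** Allows the maximisation to be repeated on the orthogonal complement of the eigenvectors already
    found; the complement stays complete because [Q x (e i)] is continuous in [x] by
    Cauchy-Schwarz. *)
Lemma orthogonal_subspace k (e : nat -> V) : (forall i, (i < k)%N -> D (e i)) ->
  let E x := D x /\ forall i, (i < k)%N -> Q x (e i) = 0 in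
  subspace E /\ complete_for E.
Proof.
move=> De E; have hE : subspace E.
  split; first by split=> [|i ik]; [exact: subspace0|rewrite (form0l hD hQ)//; exact: De].
  move=> a x y [Dx ex] [Dy ey]; split; first by apply: hD.2.
  by move=> i ik; rewrite (form_lin hQ) ?ex ?ey ?mulr0 ?addr0//; exact: De.
split=> // u Eu cau; have [y Dy hy] := Qcomplete (fun k => (Eu k).1) cau.
exists y => //; split=> // i ik; have Dei := De _ ik.
apply: sqmod_eq0; apply/eqP; rewrite eq_le sqmod_ge0 andbT leNgt; apply/negP => pos.
have qe0 : 0 < q (e i) + 1 by rewrite ltr_wpDl// (form_pos hQ).
have e1 : 0 < sqmod (Q y (e i)) / (q (e i) + 1) by rewrite divr_gt0.
have [K /(_ K (leqnn _))] := hy _ e1; rewrite ltr_pdivlMr//.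
have Dd := subspaceB hD Dy (Eu K).1.
have := form_cauchy_schwarz hD hQ Dd Dei.
rewrite (formBl hQ) ?(Eu K).2 ?subr0//; last exact: (Eu K).1.
have := form_pos hQ Dd; have := form_pos hQ Dei => *; lra.
Qed.

Definition eigen_system K (lam : R) (e : nat -> V) (nu : nat -> R) :=
  [/\ orthonormal Q K e, forall i, (i < K)%N -> D (e i),
      forall i, (i < K)%N -> lam < nu i &
      forall i z, (i < K)%N -> D z -> M (e i) z = (nu i)%:C%C * Q (e i) z].

(** Some nonzero combination of the [K] trial vectors is orthogonal to the [k < K] eigenvectors
    already found and still satisfies [lam * q < m]. The maximum over the orthogonal complement
    therefore exceeds [lam]. *)
Theorem eigen_system_exists K (u : 'I_K -> V) (lam : R) :
  (forall i, D (u i)) -> 0 < lam ->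
  (forall c : 'I_K -> R[i], (exists i, c i != 0) ->
     lam * q (\sum_i c i *: u i) < m (\sum_i c i *: u i)) ->
  exists e nu, eigen_system K lam e nu.
Proof.
move=> Du lam0 hu.
suff H k : (k <= K)%N -> exists e nu, eigen_system k lam e nu by exact: H.
elim: k => [_|k IH kK]; first by exists (fun=> 0), (fun=> 0); split.
have [e [nu [oe De nue eige]]] := IH (ltnW kK).
have [c c0 hc] := orthogonal_comb hD hQ kK Du De.
set x := \sum_j c j *: u j in hc.
have Dx : D x by apply: subspace_comb.
have [hE Ecomp] := orthogonal_subspace De.
set E := (fun x => _) in hE Ecomp.
have Ex : E x by [].
have [y [s [[Dy Ey] qy ls eigy]]] :=
  max_eigenvector hE (fun x (h : E x) => h.1) Ecomp Ex lam0 (hu _ c0).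
exists (fun i => if i == k then y else e i), (fun i => if i == k then s else nu i).
have oy i : (i < k)%N -> Q (e i) y = 0.
  by move=> ik; rewrite (form_sym hQ Dy (De _ ik)) Ey// conjc0.
have lt_case i : (i < k.+1)%N -> i = k \/ (i < k)%N.
  by rewrite ltnS leq_eqVlt => /orP[/eqP|]; [left|right].
split.
- move=> i j /lt_case[->|ik] /lt_case[->|jk]; rewrite ?eqxx ?(ltn_eqF ik) ?(ltn_eqF jk).
  + by rewrite (formxx hQ Dy) qy.
  + by rewrite Ey// eq_sym (ltn_eqF jk).
  + by rewrite oy.
  + exact: oe.
- by move=> i /lt_case[->|ik]; rewrite ?eqxx ?(ltn_eqF ik)//; exact: De.
- by move=> i /lt_case[->|ik]; rewrite ?eqxx ?(ltn_eqF ik)//; exact: nue.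
move=> i z /lt_case[->|ik] Dz; rewrite ?eqxx ?(ltn_eqF ik); last exact: eige.
(* Maximisation gives the eigenvalue equation against [E] only. A general [z] differs from an
   element of [E] by its projection [w], and both forms vanish on the pair [y], [w]. *)
pose w := \sum_(j < k) Q z (e j) *: e j.
have Dw : D w by apply: (subspace_comb hD (fun j : 'I_k => Q z (e j))) => j; apply: De.
have Ezw : E (z - w).
  split; first exact: subspaceB.
  move=> j jk; rewrite (formBl hQ Dz Dw (De j jk)).
  rewrite (form_combl hD hQ (fun j : 'I_k => Q z (e j))
    (fun l : 'I_k => De l (ltn_ord l)) (De j jk)).
  rewrite (bigD1 (Ordinal jk))//= oe// eqxx mulr1 big1 ?addr0 ?subrr// => l lj.
  by rewrite oe// (negbTE (lj : (l : nat) != j)) mulr0.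
have yw (B : V -> V -> R[i]) : semi_inner D B -> (forall j, (j < k)%N -> B y (e j) = 0) ->
    B y w = 0.
  move=> hB h; rewrite (form_combr hD hB (fun j : 'I_k => Q z (e j))
    (fun l : 'I_k => De l (ltn_ord l)) Dy).
  by rewrite big1// => l _; rewrite h ?mulr0.
have := eigy _ Ezw; rewrite (formBr hD hM)// (formBr hD hQ)//.
rewrite (yw M)// ?(yw Q)// ?subr0// => j jk.
by rewrite (form_sym hM (De _ jk) Dy) eige// oy// mulr0 conjc0.
Qed.

(** Both forms are diagonal in the orthonormal eigenvectors. This inequality is what a combination
    vanishing at too many points will contradict. *)
Lemma eigen_system_comb K lam e nu (c : 'I_K -> R[i]) :
  eigen_system K lam e nu -> (exists i, c i != 0) ->
  lam * q (\sum_i c i *: e i) < m (\sum_i c i *: e i).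
Proof.
move=> [oe De nue eige] [i0 ci0]; set y := \sum_i c i *: e i.
have De' (i : 'I_K) : D (e i) by apply: De.
have Dy : D y by apply: (subspace_comb hD c (u := fun i : 'I_K => e i)).
have Qy (i : 'I_K) : Q (e i) y = (c i)^*%C.
  rewrite (form_combr hD hQ c (u := fun i : 'I_K => e i))// (bigD1 i)//= oe// eqxx mulr1.
  by rewrite big1 ?addr0// => j ji; rewrite oe// eq_sym (negbTE (ji : (j : nat) != i)) mulr0.
have -> : q y = \sum_i sqmod (c i).
  rewrite {1}/y (form_combl hD hQ c (u := fun i : 'I_K => e i))// Re_sum.
  by apply: eq_bigr => i _; rewrite Qy mulcJ.
have -> : m y = \sum_(i < K) nu i * sqmod (c i).
  rewrite {1}/y (form_combl hD hM c (u := fun i : 'I_K => e i))// Re_sum.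
  apply: eq_bigr => i _; rewrite eige// Qy mulrCA mulcJ.
  by rewrite ReM !ReR !ImR mulr0 subr0.
rewrite mulr_sumr (bigD1 i0)// [ltRHS](bigD1 i0)//=; apply: ltr_leD.
  rewrite ltr_pM2r ?nue// lt_neqAle sqmod_ge0 andbT eq_sym.
  by apply/negP => /eqP/sqmod_eq0/eqP; rewrite (negbTE ci0).
by apply: ler_sum => i _; rewrite ler_wpM2r ?sqmod_ge0// ltW// nue.
Qed.

End Spectral.

(** * Absolutely continuous functions *)

Section AbsolutelyContinuous.
Context {R : realType}.
Local Notation mu := (leb R).

(* Cousin's lemma: an additive relation between endpoints that holds around each point holds
   on the whole interval. *)
Lemma cousin (a b : R) (C : R -> R -> Prop) : a <= b ->
  (forall u v w, a <= u -> u <= v -> v <= w -> w <= b -> C u v -> C v w -> C u w) ->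
  (forall t, a <= t <= b -> exists2 eta, 0 < eta & forall u v,
     a <= u -> u <= t -> t <= v -> v <= b -> t - eta < u -> v < t + eta -> C u v) ->
  C a b.
Proof.
move=> ab Cadd Cloc.
pose S := [set x | a <= x <= b /\ C a x].
have Sa : S a.
  split; first by rewrite lexx.
  have [|eta e0 H] := Cloc a; first by rewrite lexx.
  by apply: H => //; lra.
have hS : has_sup S by split; [exists a | exists b => x [/andP[]]].
pose s := sup S.
have sa : a <= s by apply: sup_upper_bound.
have sb : s <= b by apply: (sup_le_ub hS.1) => x [/andP[]].
have [|eta e0 H] := Cloc s; first by rewrite sa.
have [x [/andP[ax xb] Cax] xs] := sup_adherent e0 hS.
have xs' : x <= s by apply: sup_upper_bound => //; split=> //; rewrite ax.
have key v : s <= v -> v <= b -> v < s + eta -> C a v.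
  by move=> sv vb vs; apply: (Cadd _ x) => //; [exact: le_trans sv|exact: H].
pose v := Num.min b (s + eta / 2).
have vb : v <= b by rewrite ge_min lexx.
have sv : s <= v by rewrite le_min sb/=; lra.
have vs : v < s + eta by rewrite gt_min; apply/orP; right; lra.
have Cv := key _ sv vb vs.
have : v <= s by apply: sup_upper_bound => //; split=> //; rewrite vb (le_trans sa).
rewrite ge_min => /orP[bs|]; last by lra.
by have <- : v = b by apply/eqP; rewrite eq_le vb /v le_min lexx/=; lra.
Qed.

(** The straddle estimate that feeds Cousin's lemma: the slope function of Caratheodory controls the
    increments on the two sides of [t] separately. *)
Lemma is_derive0_near (F : R -> R) (t eps : R) : 0 < eps -> is_derive t 1 F 0 ->
  exists2 eta, 0 < eta &
    forall u v, u <= t -> t <= v -> t - eta < u -> v < t + eta ->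
      `|F v - F u| <= eps * (v - u).
Proof.
move=> e0 /is_derive1_caratheodory[g [Fg cg gt]].
have /cvgrPdist_lt/(_ _ e0) := cg.
move=> /nbhs_ballP[eta /= eta0 H]; exists eta => // u v ut tv tu vt.
have hg z : t - eta < z -> z < t + eta -> `|g z| <= eps.
  move=> h1 h2; have := H z; rewrite /ball/= gt sub0r normrN => h; apply: ltW; apply: h.
  by rewrite ltr_distlC; apply/andP.
have -> : F v - F u = g v * (v - t) + g u * (t - u).
  by rewrite -Fg (_ : g u * _ = - (g u * (u - t))); [rewrite -Fg; ring|ring].
apply: le_trans (ler_normD _ _) _; rewrite !normrM.
rewrite (ger0_norm (_ : 0 <= v - t)) ?(ger0_norm (_ : 0 <= t - u)) ?subr_ge0//.
have hv : `|g v| <= eps by apply: hg => //; lra.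
have hu : `|g u| <= eps by apply: hg => //; lra.
have : `|g v| * (v - t) <= eps * (v - t) by rewrite ler_wpM2r// subr_ge0.
have : `|g u| * (t - u) <= eps * (t - u) by rewrite ler_wpM2r// subr_ge0.
by lra.
Qed.

Lemma integrable_sub (D E : set R) (f : R -> R) :
  measurable E -> measurable D -> D `<=` E ->
  mu.-integrable E (EFin \o f) -> mu.-integrable D (EFin \o f).
Proof. by move=> mE mD DE; apply: integrableS. Qed.

Lemma Rintegral_cat (f : R -> R) (a b c : R) : a <= b -> b <= c ->
  mu.-integrable `[a, c] (EFin \o f) ->
  \int[mu]_(x in `[a, c]) f x = \int[mu]_(x in `[a, b]) f x + \int[mu]_(x in `[b, c]) f x.
Proof.
move=> ab bc fi; have := Rintegral_itvB (x := b) fi.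
rewrite !bnd_simp => /(_ ab bc)/eqP; rewrite subr_eq => /eqP ->.
by rewrite addrC Rintegral_itv_obnd_cbnd//; apply: integrable_sub fi => //;
  apply: subset_itv; rewrite ?bnd_simp.
Qed.

Lemma Rintegral_EFin (D : set R) (f : R -> R) : measurable D ->
  mu.-integrable D (EFin \o f) ->
  (\int[mu]_(x in D) f x)%:E = (\int[mu]_(x in D) (f x)%:E)%E.
Proof. by move=> mD fi; rewrite /Rintegral fineK//; apply: integrable_fin_num. Qed.

Lemma Rintegral_leb_setU (A B : set R) (f : R -> R) : measurable A -> measurable B ->
  A `&` B = set0 -> mu.-integrable (A `|` B) (EFin \o f) ->
  \int[mu]_(x in A `|` B) f x = \int[mu]_(x in A) f x + \int[mu]_(x in B) f x.
Proof.
by move=> mA mB AB fi; apply: Rintegral_setU => //; rewrite disj_set2E; apply/eqP.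
Qed.

Lemma null_setU (A B : set R) : measurable A -> measurable B ->
  mu A = 0%E -> mu B = 0%E -> mu (A `|` B) = 0%E.
Proof.
move=> mA mB A0 B0; apply/eqP; rewrite eq_le measure_ge0 andbT.
have -> : 0%E = (mu A + mu B)%E by rewrite A0 B0 adde0.
exact: measureU2.
Qed.

(* H being the indefinite integral of G, the difference F - H is absolutely continuous with zero
   derivative off a null set E.  In Cousin's lemma, the points of E are covered by an open set of
   small measure, which contributes little by absolute continuity. *)
Theorem ac_ftc (F G : R -> R) :
  abs_continuous01 F ->
  {ae mu, forall t : R, t \in `]0, 1[ -> is_derive t (1 : R) F (G t)} ->
  mu.-integrable `[0, 1] (EFin \o G) ->
  forall x : R, x \in `[0, 1] -> F x - F 0 = \int[mu]_(t in `[0, x]) G t.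
Proof.
move=> acF dF Gi x0; rewrite in_itv/= => /andP[x00 x01].
pose G1 := G \_ `[0, 1].
have G1i : mu.-integrable setT (EFin \o G1).
  by rewrite /G1 -restrict_EFin; apply/integrable_restrict => //=; rewrite setTI.
have G1i' (D : set R) : measurable D -> mu.-integrable D (EFin \o G1).
  by move=> mD; apply: integrable_sub G1i.
have G1E t : 0 <= t <= 1 -> G1 t = G t.
  by move=> t01; rewrite /G1 patchE mem_setE in_itv/= t01.
pose H y := \int[mu]_(t in `[0, y]) G1 t.
have dH : {ae mu, forall t : R, (0 < t) -> derivable H t 1 /\ derive1 H t = G1 t}.
  have := @FTC1 _ G1 (BLeft 0).
  case; [by move=> y; apply: G1i'|exact: integrable_locally|].
  by move=> A [mA A0 hA]; exists A; split=> // t /= ht; apply: hA => /= ht'; apply: ht => t0;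
    apply: ht'; rewrite bnd_simp ltW.
have [A1 [mA1 A10 hA1]] := dF.
have [A2 [mA2 A20 hA2]] := dH.
(* The endpoints join the exceptional set because the derivatives are given only inside the
   interval. *)
pose E := A1 `|` A2 `|` [set 0] `|` [set 1].
have mE : measurable E by do !apply: measurableU.
have E0 : mu E = 0%E.
  by do !(apply: null_setU; do ?apply: measurableU) => //; exact: lebesgue_measure_set1.
pose D y := F y - H y.
have dD t : 0 <= t <= 1 -> ~ E t -> is_derive t 1 D 0.
  move=> /andP[t0 t1] nE.
  have t0' : 0 < t.
    by rewrite lt_neqAle t0 andbT; apply/eqP => t0'; apply: nE; left; right.
  have t1' : t < 1.
    by rewrite lt_neqAle t1 andbT; apply/eqP => t1'; apply: nE; right.
  have d1 : is_derive t 1 F (G t).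
    apply: contrapT => h; apply: nE; do 3!left; apply: hA1 => /= /(_ _)h'; apply: h.
    by apply: h'; rewrite in_itv/= t0'.
  have [d2 d2'] : derivable H t 1 /\ derive1 H t = G1 t.
    by apply: contrapT => h; apply: nE; do 2!left; right; apply: hA2 => /= /(_ t0').
  have : is_derive t 1 H (G t) by apply: DeriveDef => //; rewrite -derive1E d2' G1E// t0.
  by move=> d3; have := is_deriveB d1 d3; rewrite subrr.
(* One [eps] is for the pieces around points off [E], one for the absolute continuity of [F], and
   one for that of the integral [H]. *)
suff key eps : 0 < eps -> `|D x0 - D 0| <= 3 * eps.
  have : D x0 - D 0 = 0.
    apply/eqP; rewrite -normr_le0; apply/ler_addgt0Pr => eps e0; rewrite add0r.
    have e3 : 0 < eps / 3 by lra.
    by have := key _ e3; rewrite mulrC divfK.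
  rewrite /D {2}/H set_itv1 Rintegral_set1 subr0 => h.
  rewrite (_ : F x0 - F 0 = H x0); last by lra.
  apply: eq_Rintegral => t; rewrite inE/= in_itv/= => /andP[t0 tx].
  by rewrite G1E// t0 (le_trans tx).
move=> e0.
have [d1 d10 hd1] := acF _ e0.
have [d2 [d20 hd2]] := integral_normr_continuous G1i e0.
pose dl := Num.min d1 d2.
have dl0 : 0 < dl by rewrite lt_min d10.
have [U [oU EU mUE]] := lebesgue_regularity_outer mE (eq_ind_r (fun z => is_true (z < +oo)%E) (ltry 0) E0) dl0.
have mU : measurable U by exact: open_measurable.
have muU : (mu U < dl%:E)%E.
  have h : (mu (E `|` (U `\` E)) <= mu E + mu (U `\` E))%E.
    by apply: measureU2 => //; exact: measurableD.
  by move: h; rewrite setDUK// E0 add0e => /le_lt_trans; apply.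
(* An additive certificate. The list [s] collects ordered disjoint pieces placed around points of
   [E]; their lengths are charged to the measure of [U], while all other pieces contribute at most
   [eps] times their length. *)
pose C u v := exists s : seq (R * R), [/\
  all (fun p => (u <= p.1) && (p.1 <= p.2) && (p.2 <= v)) s,
  pairwise (fun p q => p.2 <= q.1) s,
  ((\sum_(p <- s) (p.2 - p.1))%:E <= mu (U `&` `]u, v]))%E &
  `|D v - D u| <= eps * (v - u) + \sum_(p <- s) `|F p.2 - F p.1|
     + \int[mu]_(t in U `&` `]u, v]) `|G1 t| ].
have mUi u v : measurable (U `&` `]u, v] : set R) by exact: measurableI.
have split_itv u v w : u <= v -> v <= w -> `]u, w]%classic = `]u, v]%classic `|` `]v, w]%classic :> set R.
  by move=> uv vw; rewrite -itv_bndbnd_setU// bnd_simp.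
have disj u v w : (U `&` `]u, v]) `&` (U `&` `]v, w]) = set0 :> set R.
  rewrite -subset0 => t [[_ /=]]; rewrite !in_itv/= => /andP[_ tv] [_ /andP[vt _]].
  by have := le_lt_trans tv vt; rewrite ltxx.
have G1abs (B : set R) : measurable B -> mu.-integrable B (EFin \o (fun t => `|G1 t|)).
  by move=> mB; apply: (integrable_norm (G1i' _ mB)).
have C01 : C 0 x0.
  apply: cousin => //.
  - move=> u v w u0 uv vw w1 [s [s1 s2 s3 s4]] [s' [s1' s2' s3' s4']].
    exists (s ++ s'); split.
    + rewrite all_cat; apply/andP; split.
        by apply: sub_all s1 => p /andP[/andP[-> ->] /le_trans->].
      by apply: sub_all s1' => p /andP[/andP[h -> ->]]; rewrite (le_trans uv h).
    + rewrite pairwise_cat s2 s2' !andbT; apply/allrelP => p p' /(allP s1) /andP[_ h] /(allP s1') /andP[/andP[h' _] _].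
      exact: le_trans h h'.
    + have -> : mu (U `&` `]u, w]) = (mu (U `&` `]u, v]) + mu (U `&` `]v, w]))%E.
        by rewrite (split_itv _ _ _ uv vw) setIUr; apply: measureU; [exact: mUi|exact: mUi|exact: disj].
      by rewrite big_cat/= EFinD; apply: leeD.
    + rewrite big_cat/= (split_itv _ _ _ uv vw) setIUr Rintegral_leb_setU ?disj//; last first.
        by apply: G1abs; apply: measurableU.
      have -> : D w - D u = (D v - D u) + (D w - D v) by ring.
      apply: le_trans (ler_normD _ _) _; apply: le_trans (lerD s4 s4') _.
      by rewrite le_eqVlt; apply/orP; left; apply/eqP; ring.
  - move=> t /andP[t0 tx].
    have t01 : 0 <= t <= 1 by rewrite t0 (le_trans tx).
    have [Et|nEt] := pselect (E t); last first.
      have [eta eta0 h] := is_derive0_near e0 (dD _ t01 nEt).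
      exists eta => // u v _ ut tv _ tu vt; exists [::]; split=> //; first by rewrite big_nil.
      rewrite big_nil addr0; apply: ler_wpDr; last exact: h.
      exact: Rintegral_ge0.
    have /nbhs_ballP[eta /= eta0 h] := open_nbhs_nbhs (conj oU (EU _ Et)).
    exists eta => // u v u0 ut tv vx tu vt.
    have uv := le_trans ut tv.
    have sub : `]u, v]%classic `<=` U.
      move=> z /=; rewrite in_itv/= => /andP[uz zv]; apply: h; rewrite /ball/= ltr_distlC.
      apply/andP; split; first exact: lt_trans tu uz.
      exact: le_lt_trans zv vt.
    exists [:: (u, v)]; split=> //.
    + by rewrite /= !lexx uv.
    + rewrite big_seq1/= (setIidr sub) lebesgue_measure_itv/= lte_fin.
      by case: ltP => // vu; rewrite lee_fin subr_le0.
    + rewrite big_seq1/= (setIidr sub).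
      have -> : D v - D u = (F v - F u) - (H v - H u) by rewrite /D; ring.
      apply: le_trans (ler_normB _ _) _.
      suff : `|H v - H u| <= \int[mu]_(t0 in `]u, v]) `|G1 t0|.
        move=> hH; rewrite addrAC addrC; apply: lerD => //; apply: ler_wpDl => //.
        by apply: mulr_ge0; [exact: ltW|rewrite subr_ge0].
      rewrite /H; have := @Rintegral_itvB _ G1 (BLeft 0) (BRight v) u (G1i' _ (measurable_itv _)).
      rewrite !bnd_simp => ->//.
      by apply: le_normr_Rintegral => //; apply: G1i'.
have [s [s1 s2 s3 s4]] := C01.
apply: le_trans s4 _.
have muUx : (mu (U `&` `]0%R, x0]) < dl%:E)%E.
  by apply: le_lt_trans muU; apply: le_measure; rewrite ?inE//; exact: mUi.
have i1 : \int[mu]_(t in U `&` `]0, x0]) `|G1 t| < eps.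
  have h : (mu (U `&` `]0%R, x0]) < d2%:E)%E.
    by apply: lt_le_trans muUx _; rewrite lee_fin ge_min lexx orbT.
  exact: (hd2 _ (mUi 0 x0) h).
have i2 : \sum_(p <- s) `|F p.2 - F p.1| < eps.
  have := hd1 (size s) (fun j => (nth (0, 0) s j).1) (fun j => (nth (0, 0) s j).2).
  rewrite (big_nth (0, 0)) big_mkord; apply.
  - move=> j js; have /andP[/andP[h1 h2] h3] := allP s1 _ (mem_nth (0, 0) js).
    by split=> //; split=> //; apply: le_trans h3 x01.
  - move=> i j is_ js /eqP; have /(pairwiseP (0, 0)) hp := s2.
    by rewrite neq_ltn => /orP[ij|ji]; [left|right]; apply: hp.
  - rewrite -(big_mkord xpredT (fun j => (nth (0, 0) s j).2 - (nth (0, 0) s j).1)).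
    rewrite -(big_nth (0, 0) xpredT (fun p => p.2 - p.1)) -lte_fin.
    apply: le_lt_trans s3 _; apply: lt_le_trans muUx _.
    by rewrite lee_fin ge_min lexx.
have e0' := ltW e0.
have h : eps * (x0 - 0) <= eps * 1 by rewrite subr0 ler_wpM2l.
rewrite (_ : 3 * eps = eps * 1 + eps + eps); last by ring.
exact: lerD (lerD h (ltW i2)) (ltW i1).
Qed.

End AbsolutelyContinuous.

(** * Integrals and square-integrable functions with complex values *)

Section ComplexIntegral.
Context {R : realType} dd {T : measurableType dd}.
Variables (m : {measure set T -> \bar R}) (D : set T).
Hypothesis mD : measurable D.
Implicit Types (f g : T -> R) (u v : T -> R[i]).

Local Notation rint f := (m.-integrable D (EFin \o f)).

Lemma rintD f g : rint f -> rint g -> rint (fun t => f t + g t).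
Proof. by move=> fi gi; apply: (integrableD mD fi gi). Qed.
Lemma rintZ (a : R) f : rint f -> rint (fun t => a * f t).
Proof. by move=> fi; apply: (integrableZl mD a fi). Qed.
Lemma rintN f : rint f -> rint (fun t => - f t).
Proof.
move=> /(rintZ (-1)); apply: eq_integrable => // t _ /=.
by rewrite mulN1r.
Qed.
Lemma rintB f g : rint f -> rint g -> rint (fun t => f t - g t).
Proof. by move=> fi gi; apply: rintD => //; apply: rintN. Qed.
Lemma rint0 : rint (fun=> 0). Proof. exact: integrable0. Qed.
Lemma rint_measurable f : rint f -> measurable_fun D f.
Proof. by move=> /integrableP[/measurable_EFinP]. Qed.
Lemma rint_le f g : measurable_fun D f -> (forall t, D t -> `|f t| <= g t) ->
  rint g -> rint f.
Proof.
move=> mf fg gi; apply: (le_integrable mD _ _ gi); first exact/measurable_EFinP.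
by move=> t Dt /=; rewrite lee_fin; apply: le_trans (fg _ Dt) (ler_norm _).
Qed.

Definition cintegrable u := rint (fun t => re (u t)) /\ rint (fun t => im (u t)).

Lemma cintegrable_lin (a : R[i]) u v :
  cintegrable u -> cintegrable v -> cintegrable (fun t => a * u t + v t).
Proof.
move=> [u1 u2] [v1 v2]; split.
  have := rintD (rintB (rintZ (re a) u1) (rintZ (im a) u2)) v1.
  by apply: eq_integrable => // t _ /=; rewrite ReD ReM.
have := rintD (rintD (rintZ (re a) u2) (rintZ (im a) u1)) v2.
by apply: eq_integrable => // t _ /=; rewrite ImD ImM.
Qed.

Lemma eq_cintegral u v : (forall t, D t -> u t = v t) -> cintegral m D u = cintegral m D v.
Proof.
by move=> uv; apply: eq_ReIm; apply: eq_Rintegral => t /set_mem Dt; rewrite uv.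
Qed.

Lemma cintegral_lin (a : R[i]) u v : cintegrable u -> cintegrable v ->
  cintegral m D (fun t => a * u t + v t) = a * cintegral m D u + cintegral m D v.
Proof.
move=> [u1 u2] [v1 v2]; apply: eq_ReIm; rewrite ?ReD ?ImD ?ReM ?ImM /=.
  under eq_Rintegral do rewrite ReD ReM.
  rewrite (RintegralD mD (rintB (rintZ (re a) u1) (rintZ (im a) u2)) v1).
  by rewrite (RintegralB mD (rintZ (re a) u1) (rintZ (im a) u2)) !RintegralZl.
under eq_Rintegral do rewrite ImD ImM.
rewrite (RintegralD mD (rintD (rintZ (re a) u2) (rintZ (im a) u1)) v2).
by rewrite (RintegralD mD (rintZ (re a) u2) (rintZ (im a) u1)) !RintegralZl.
Qed.

Lemma cintegrable0 : cintegrable (fun=> 0). Proof. by split; exact: rint0. Qed.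
Lemma cintegral0 : cintegral m D (fun=> 0) = 0.
Proof.
have := cintegral_lin (-1) cintegrable0 cintegrable0.
rewrite (_ : (fun=> -1 * 0 + 0) = (fun=> 0)); first by rewrite mulN1r addNr.
by apply/funext => t; rewrite mulr0 addr0.
Qed.
Lemma cintegrableD u v : cintegrable u -> cintegrable v -> cintegrable (fun t => u t + v t).
Proof.
move=> ui vi; have := cintegrable_lin 1 ui vi.
by rewrite (_ : (fun t => 1 * u t + v t) = fun t => u t + v t)//; apply/funext => t; rewrite mul1r.
Qed.
Lemma cintegralD u v : cintegrable u -> cintegrable v ->
  cintegral m D (fun t => u t + v t) = cintegral m D u + cintegral m D v.
Proof.
move=> ui vi; have := cintegral_lin 1 ui vi; rewrite mul1r => <-.
by apply: eq_cintegral => t _; rewrite mul1r.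
Qed.
Lemma cintegralZ a u : cintegrable u -> cintegral m D (fun t => a * u t) = a * cintegral m D u.
Proof.
move=> ui; have := cintegral_lin a ui cintegrable0; rewrite cintegral0 addr0 => <-.
by apply: eq_cintegral => t _; rewrite addr0.
Qed.
Lemma cintegrableB u v : cintegrable u -> cintegrable v -> cintegrable (fun t => u t - v t).
Proof.
move=> ui vi; have := cintegrable_lin (-1) vi ui.
rewrite (_ : (fun t => -1 * v t + u t) = fun t => u t - v t)//; apply/funext => t.
by rewrite mulN1r addrC.
Qed.
Lemma cintegralJ u : cintegrable u ->
  cintegral m D (fun t => (u t)^*%C) = (cintegral m D u)^*%C.
Proof.
move=> [u1 u2]; apply: eq_ReIm; rewrite ?ReJ ?ImJ /=.
  by apply: eq_Rintegral => t _; rewrite ReJ.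
rewrite -[in RHS]mulN1r -RintegralZl//.
by apply: eq_Rintegral => t _; rewrite ImJ mulN1r.
Qed.

Definition sq_integrable u := [/\ measurable_fun D (fun t => re (u t)),
  measurable_fun D (fun t => im (u t)) & m.-integrable D (fun t => (sqmod (u t))%:E)].

Definition sq_inner u v := cintegral m D (fun t => u t * (v t)^*%C).

Lemma sq_integrable_lin (a : R[i]) u v : sq_integrable u -> sq_integrable v ->
  sq_integrable (fun t => a * u t + v t).
Proof.
move=> [u1 u2 u3] [v1 v2 v3].
have m1 : measurable_fun D (fun t => re (a * u t + v t)).
  under eq_fun do rewrite ReD ReM.
  by apply: measurable_funD => //; apply: measurable_funB; apply: measurable_funM.
have m2 : measurable_fun D (fun t => im (a * u t + v t)).
  under eq_fun do rewrite ImD ImM.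
  by apply: measurable_funD => //; apply: measurable_funD; apply: measurable_funM.
split=> //; apply: (@rint_le _ (fun t => (2 * sqmod a) * sqmod (u t) + 2 * sqmod (v t))).
- by rewrite /sqmod; apply: measurable_funD; apply: measurable_funX.
- move=> t _; rewrite ger0_norm ?sqmod_ge0//.
  by apply: le_trans (sqmodD _ _) _; rewrite sqmodM mulrA.
- by apply: rintD; apply: rintZ.
Qed.

Lemma sq_integrableJ u : sq_integrable u -> sq_integrable (fun t => (u t)^*%C).
Proof.
move=> [u1 u2 u3]; split.
- by under eq_fun do rewrite ReJ.
- under eq_fun do rewrite ImJ.
  by apply: measurableT_comp.
- by under eq_fun do rewrite sqmodJ.
Qed.

Lemma sq_integrable_mul u v : sq_integrable u -> sq_integrable v ->
  cintegrable (fun t => u t * v t).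
Proof.
move=> [u1 u2 u3] [v1 v2 v3].
have h (a b : R) : `|a * b| <= a ^+ 2 + b ^+ 2.
  rewrite ler_norml; apply/andP; split; rewrite -subr_ge0.
    by rewrite (_ : _ - _ = (a + b) ^+ 2 / 2 + (a ^+ 2 + b ^+ 2) / 2);
      [rewrite addr_ge0 ?divr_ge0 ?addr_ge0 ?sqr_ge0|field].
  by rewrite (_ : _ - _ = (a - b) ^+ 2 / 2 + (a ^+ 2 + b ^+ 2) / 2);
    [rewrite addr_ge0 ?divr_ge0 ?addr_ge0 ?sqr_ge0|field].
have key (x y z w : R) : `|x * y| + `|z * w| <= x ^+ 2 + z ^+ 2 + (y ^+ 2 + w ^+ 2).
  by apply: le_trans (lerD (h x y) (h z w)) _; rewrite addrACA.
split; apply: (@rint_le _ (fun t => sqmod (u t) + sqmod (v t))); do ?exact: rintD.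
- under eq_fun do rewrite ReM.
  by apply: measurable_funB; apply: measurable_funM.
- by move=> t _; rewrite ReM; apply: le_trans (ler_normB _ _) _; apply: key.
- under eq_fun do rewrite ImM.
  by apply: measurable_funD; apply: measurable_funM.
- move=> t _; rewrite ImM; apply: le_trans (ler_normD _ _) _.
  by rewrite [X in _ <= _ + X]addrC; apply: key.
Qed.

Lemma sq_integrable_subspace : subspace (sq_integrable : (T -> R[i]) -> Prop).
Proof.
split; last by move=> a u v; apply: sq_integrable_lin.
split => /=; [exact: measurable_cst|exact: measurable_cst|].
by under eq_fun do rewrite sqmod0; exact: rint0.
Qed.

Lemma sq_inner_semi : semi_inner sq_integrable sq_inner.
Proof.
split.
- move=> a u v w uL vL wL; rewrite /sq_inner -cintegral_lin; last 2 first.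
  + exact: sq_integrable_mul uL (sq_integrableJ wL).
  + exact: sq_integrable_mul vL (sq_integrableJ wL).
  by apply: eq_cintegral => t _ /=; rewrite mulrDl mulrA.
- move=> u v uL vL; rewrite /sq_inner -cintegralJ; last first.
    exact: sq_integrable_mul uL (sq_integrableJ vL).
  by apply: eq_cintegral => t _; rewrite conjcM conjcK mulrC.
- move=> u uL; apply: Rintegral_ge0 => t _.
  by rewrite mulcJ ReR sqmod_ge0.
Qed.

Lemma sq_innerxx u : re (sq_inner u u) = \int[m]_(t in D) sqmod (u t).
Proof. by apply: eq_Rintegral => t _; rewrite mulcJ ReR. Qed.

End ComplexIntegral.

(** * Continuous functions on the unit interval *)

Section ContinuousFunctions.
Context {R : realType}.
Implicit Types (f g : R -> R).
Local Notation I01 := (`[0 : R, 1 : R]%classic : set (measurableTypeR R)).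
Local Notation cont f := {within `[(0 : R), 1], continuous (f : R -> R)}.

Lemma cont_bounded f : cont f -> exists2 c, 0 <= c & forall t, 0 <= t <= 1 -> `|f t| <= c.
Proof.
move=> cf; have [c _ hc] := EVT_max ler01 cf; have [c' _ hc'] := EVT_min ler01 cf.
exists (`|f c| + `|f c'|); first by rewrite addr_ge0.
move=> t t01; have t01' : t \in `[0, 1] by rewrite in_itv.
have := hc _ t01'; have := hc' _ t01'; rewrite ler_norml => h1 h2.
apply/andP; split.
  rewrite lerNl; apply: le_trans (_ : - f t <= - f c') _; first by rewrite lerN2.
  by apply: le_trans (ler_norm _) _; rewrite normrN lerDr.
by apply: le_trans h2 _; apply: le_trans (ler_norm _) _; rewrite lerDl.
Qed.

Lemma cont_measurable f : cont f -> measurable_fun I01 f.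
Proof. by move=> cf; apply: subspace_continuous_measurable_fun. Qed.

Lemma cont_integrable (mu : {measure set (measurableTypeR R) -> \bar R}) f :
  (mu `[0%R, 1%R]%classic < +oo)%E -> cont f -> mu.-integrable I01 (EFin \o f).
Proof.
move=> mu01 cf; apply: measurable_bounded_integrable => //.
  exact: cont_measurable.
have [c c0 hc] := cont_bounded cf; exists c; split; first exact: num_real.
move=> y cy t /=; rewrite in_itv/= => t01; apply: ltW; apply: le_lt_trans cy.
exact: hc.
Qed.

Lemma leb01 : leb R `[0, 1]%classic = 1%E.
Proof. by rewrite lebesgue_measure_itv/= lte_fin ltr01 sube0. Qed.

Lemma leb01_fin : (leb R `[0%R, 1%R]%classic < +oo)%E.
Proof. by rewrite leb01 ltry. Qed.

Lemma integrable_mul_cont f g : (leb R).-integrable I01 (EFin \o f) -> cont g ->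
  (leb R).-integrable I01 (EFin \o (fun t => f t * g t)).
Proof.
move=> fi cg; have [c c0 hc] := cont_bounded cg.
have mI : measurable I01 by [].
apply: (rint_le mI (g := fun t => c * `|f t|)).
- by apply: measurable_funM; [exact: rint_measurable fi|exact: cont_measurable].
- move=> t /=; rewrite in_itv/= => t01; rewrite normrM mulrC ler_wpM2r//; exact: hc.
- by apply: rintZ => //; apply: (integrable_norm fi).
Qed.

Lemma contD f g : cont f -> cont g -> cont (fun t => f t + g t).
Proof. by move=> cf cg t; apply: cvgD; [exact: cf|exact: cg]. Qed.
Lemma contM f g : cont f -> cont g -> cont (fun t => f t * g t).
Proof. by move=> cf cg t; apply: cvgM; [exact: cf|exact: cg]. Qed.
Lemma contN f : cont f -> cont (fun t => - f t).
Proof. by move=> cf t; apply: cvgN; exact: cf. Qed.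
Lemma cont_cst (a : R) : cont (fun=> a).
Proof. by move=> t; exact: cvg_cst. Qed.
Lemma contB f g : cont f -> cont g -> cont (fun t => f t - g t).
Proof. by move=> cf cg; apply: contD => //; apply: contN. Qed.

Lemma cont_eps f : (forall t eps, 0 <= t <= 1 -> 0 < eps -> exists2 eta, 0 < eta &
    forall s, 0 <= s <= 1 -> `|s - t| < eta -> `|f s - f t| < eps) -> cont f.
Proof.
move=> h; apply/continuous_within_itvP => //; split.
- move=> t; rewrite in_itv/= => /andP[t0 t1]; apply/cvgrPdist_lt => eps e0.
  have [|eta eta0 H] := h t eps _ e0; first by rewrite !ltW.
  near=> s; rewrite distrC; apply: H; last first.
    by near: s; apply/nbhs_ballP; exists eta => // z; rewrite /ball/= distrC.
  apply/andP; split; apply: ltW; near: s.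
    exact: lt_nbhsr.
  exact: lt_nbhsl.
- apply/cvgrPdist_lt => eps e0.
  have [|eta eta0 H] := h 0 eps _ e0; first by rewrite lexx ler01.
  near=> s; rewrite distrC; apply: H.
    by apply/andP; split => //; near: s; exact: nbhs_right_le.
  rewrite subr0 gtr0_norm//; near: s; exact: nbhs_right_lt.
- apply/cvgrPdist_lt => eps e0.
  have [|eta eta0 H] := h 1 eps _ e0; first by rewrite lexx ler01.
  near=> s; rewrite distrC; apply: H.
    by apply/andP; split => //; near: s; exact: nbhs_left_ge.
  rewrite distrC gtr0_norm ?subr_gt0// ltrBlDr -ltrBlDl; near: s; apply: nbhs_left_gt.
  by rewrite gtrBl.
Unshelve. all: by end_near. Qed.

Lemma ac_cont f : abs_continuous01 f -> cont f.
Proof.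
move=> acf; apply: cont_eps => t eps t01 e0.
have [dl dl0 H] := acf _ e0; exists dl => // s s01 st.
wlog ts : s t t01 s01 st / t <= s.
  move=> W; have [/W|/ltW/W] := leP t s; first by apply.
  by rewrite distrC [X in _ -> X < _]distrC distrC; apply; rewrite // distrC.
have := H 1%N (fun=> t) (fun=> s); rewrite !big_ord1; apply.
- by move=> j _; case/andP: t01 => -> _; case/andP: s01.
- by move=> [|//] [|//].
- by rewrite -(ger0_norm (_ : 0 <= s - t)) ?subr_ge0.
Qed.

End ContinuousFunctions.

(** * Calculus of absolutely continuous functions *)

Section AbsolutelyContinuousAlgebra.
Context {R : realType}.
Implicit Types (f g F G : R -> R).
Local Notation I01 := (`[0 : R, 1 : R]%classic : set (measurableTypeR R)).
Local Notation cont f := {within `[(0 : R), 1], continuous (f : R -> R)}.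
Local Notation rint f := ((leb R).-integrable I01 (EFin \o f)).

Lemma leb_aeS (P Q : R -> Prop) : (forall t, P t -> Q t) ->
  {ae leb R, forall t, P t} -> {ae leb R, forall t, Q t}.
Proof. by move=> h; have FF := ae_filter_ringOfSetsType (leb R); apply: filterS. Qed.

Lemma leb_aeS2 (P Q S : R -> Prop) : (forall t, P t -> Q t -> S t) ->
  {ae leb R, forall t, P t} -> {ae leb R, forall t, Q t} -> {ae leb R, forall t, S t}.
Proof. by move=> h; have FF := ae_filter_ringOfSetsType (leb R); apply: filterS2. Qed.

Definition real_ac_derivative F f := abs_continuous01 F /\
  {ae leb R, forall t : R, t \in `]0, 1[ -> is_derive t (1 : R) F (f t)}.

Lemma lipschitz_ac F (K : R) :
  (forall s t, 0 <= s <= 1 -> 0 <= t <= 1 -> `|F s - F t| <= K * `|s - t|) ->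
  abs_continuous01 F.
Proof.
move=> FK eps e0; have K0 : 0 < `|K| + 1 by rewrite ltr_wpDl.
exists (eps / (`|K| + 1)); first exact: divr_gt0.
move=> N a b hab _; rewrite ltr_pdivlMr// => h; apply: le_lt_trans h.
rewrite mulr_suml; apply: ler_sum => i _; have [a0 [ab b1]] := hab i (ltn_ord i).
apply: le_trans (FK _ _ _ _) _; rewrite ?(le_trans a0 ab) ?a0 ?b1 ?(le_trans ab b1)//.
rewrite ger0_norm ?subr_ge0// mulrC ler_wpM2l ?subr_ge0//.
by apply: le_trans (ler_norm _) _; rewrite lerDl.
Qed.

(** A comparison principle that covers sums, scalar multiples and products of absolutely continuous
    functions. *)
Lemma abs_continuous_le2 F f g (c : R) : 0 <= c -> abs_continuous01 f -> abs_continuous01 g ->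
  (forall s t, 0 <= s <= 1 -> 0 <= t <= 1 -> `|F s - F t| <= c * `|f s - f t| + c * `|g s - g t|) ->
  abs_continuous01 F.
Proof.
move=> c0 acf acg H eps e0.
have e2 : 0 < eps / (2 * (c + 1)) by rewrite divr_gt0// mulr_gt0// ltr_wpDl.
have [d1 d10 h1] := acf _ e2; have [d2 d20 h2] := acg _ e2.
exists (Num.min d1 d2); first by rewrite lt_min d10.
move=> N a b hab dab; rewrite lt_min => /andP[/(h1 _ _ _ hab dab) k1 /(h2 _ _ _ hab dab) k2].
apply: (@le_lt_trans _ _ (c * \sum_(j < N) `|f (b j) - f (a j)| + c * \sum_(j < N) `|g (b j) - g (a j)|)).
  rewrite !mulr_sumr -big_split/=; apply: ler_sum => i _.
  have [a0 [ab b1]] := hab i (ltn_ord i).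
  by apply: H; rewrite ?(le_trans a0 ab) ?a0 ?b1 ?(le_trans ab b1).
set x := \sum_j _ in k1 *; set y := \sum_j _ in k2 *.
have x0 : 0 <= x by apply: sumr_ge0.
have y0 : 0 <= y by apply: sumr_ge0.
apply: (@le_lt_trans _ _ ((c + 1) * x + (c + 1) * y)).
  by apply: lerD; rewrite ler_wpM2r// lerDl.
have cp : 0 < c + 1 by rewrite ltr_wpDl.
rewrite -mulrDr mulrC -ltr_pdivlMr//.
rewrite (_ : eps / (c + 1) = eps / (2 * (c + 1)) + eps / (2 * (c + 1))); first exact: ltrD.
by field; rewrite lt0r_neq0.
Qed.

Lemma acD F f G g : real_ac_derivative F f -> real_ac_derivative G g ->
  real_ac_derivative (fun t => F t + G t) (fun t => f t + g t).
Proof.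
move=> [acF dF] [acG dG]; split.
  apply: (abs_continuous_le2 ler01 acF acG) => s t _ _; rewrite !mul1r.
  by rewrite opprD addrACA ler_normD.
by apply: leb_aeS2 dF dG => t h1 h2 t01; apply: is_deriveD; [exact: h1|exact: h2].
Qed.

Lemma acZ (a : R) F f : real_ac_derivative F f ->
  real_ac_derivative (fun t => a * F t) (fun t => a * f t).
Proof.
move=> [acF dF]; split.
  apply: (abs_continuous_le2 (normr_ge0 a) acF acF) => s t _ _.
  by rewrite -mulrBr normrM lerDl mulr_ge0.
by apply: leb_aeS dF => t h1 t01; apply: is_deriveZ; exact: h1.
Qed.

Lemma acN F f : real_ac_derivative F f ->
  real_ac_derivative (fun t => - F t) (fun t => - f t).
Proof.
move=> /(acZ (-1)); rewrite (_ : (fun t => -1 * F t) = fun t => - F t).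
  by rewrite (_ : (fun t => -1 * f t) = fun t => - f t)//; apply/funext => t; rewrite mulN1r.
by apply/funext => t; rewrite mulN1r.
Qed.

Lemma acB F f G g : real_ac_derivative F f -> real_ac_derivative G g ->
  real_ac_derivative (fun t => F t - G t) (fun t => f t - g t).
Proof. by move=> acF acG; apply: acD => //; apply: acN. Qed.

Lemma acM F f G g : real_ac_derivative F f -> real_ac_derivative G g ->
  real_ac_derivative (fun t => F t * G t) (fun t => f t * G t + F t * g t).
Proof.
move=> [acF dF] [acG dG]; split.
  have [c c0 hc] := cont_bounded (ac_cont acF); have [c' c'0 hc'] := cont_bounded (ac_cont acG).
  apply: (abs_continuous_le2 (addr_ge0 c0 c'0) acF acG) => s t s01 t01.
  rewrite (_ : _ - _ = (F s - F t) * G s + F t * (G s - G t)); last by ring.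
  apply: le_trans (ler_normD _ _) _; rewrite !normrM; apply: lerD.
    by rewrite mulrC ler_wpM2r// ler_wpDl// hc'.
  by rewrite ler_wpM2r// ler_wpDr// hc.
apply: leb_aeS2 dF dG => t h1 h2 t01.
have : is_derive t 1 (fun t => F t * G t) (F t * g t + G t * f t).
  exact: is_deriveM (h1 t01) (h2 t01).
by rewrite addrC [G t * _]mulrC.
Qed.

Lemma ac_derivativeP (F f : R -> R[i]) : ac_derivative F f <->
  real_ac_derivative (fun t => re (F t)) (fun t => re (f t)) /\
  real_ac_derivative (fun t => im (F t)) (fun t => im (f t)).
Proof.
split=> [[h1 h2 h3]|[[h1 h2] [h3 h4]]].
  by split; split=> //; apply: leb_aeS h3 => t h t01; case: (h t01).
split=> //.
by apply: leb_aeS2 h2 h4 => t k1 k2 t01; split; [exact: k1|exact: k2].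
Qed.

Lemma ac_integral F f s t : real_ac_derivative F f -> rint f ->
  0 <= s -> s <= t -> t <= 1 -> F t - F s = \int[leb R]_(x in `[s, t]) f x.
Proof.
move=> [acF dF] fi s0 st t1.
have Ft : F t - F 0 = \int[leb R]_(x in `[0, t]) f x.
  by apply: ac_ftc => //; rewrite in_itv/= (le_trans s0 st).
have Fs : F s - F 0 = \int[leb R]_(x in `[0, s]) f x.
  by apply: ac_ftc => //; rewrite in_itv/= s0 (le_trans st).
have fi' : (leb R).-integrable `[0, t] (EFin \o f).
  by apply: integrable_sub fi => //; apply: subset_itv; rewrite ?bnd_simp.
have := Rintegral_cat s0 st fi'; rewrite -Ft -Fs => h.
by apply: (addrI (F s - F 0)); rewrite -h; ring.
Qed.

Lemma ac_derivative_lin (a : R[i]) (F f G g : R -> R[i]) :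
  ac_derivative F f -> ac_derivative G g ->
  ac_derivative (fun t => a * F t + G t) (fun t => a * f t + g t).
Proof.
move=> /ac_derivativeP[F1 F2] /ac_derivativeP[G1 G2]; apply/ac_derivativeP; split.
  have := acD (acB (acZ (re a) F1) (acZ (im a) F2)) G1.
  by congr real_ac_derivative; apply/funext => t; rewrite !ReImE.
have := acD (acD (acZ (re a) F2) (acZ (im a) F1)) G2.
by congr real_ac_derivative; apply/funext => t; rewrite !ReImE.
Qed.

Lemma ac_derivative_mulJ (F f G g : R -> R[i]) :
  ac_derivative F f -> ac_derivative G g ->
  ac_derivative (fun t => F t * (G t)^*%C) (fun t => f t * (G t)^*%C + F t * (g t)^*%C).
Proof.
move=> /ac_derivativeP[F1 F2] /ac_derivativeP[G1 G2]; apply/ac_derivativeP; split.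
  have := acD (acM F1 G1) (acM F2 G2).
  congr real_ac_derivative; apply/funext => t; rewrite !ReImE; ring.
have := acB (acM F2 G1) (acM F1 G2).
congr real_ac_derivative; apply/funext => t; rewrite !ReImE; ring.
Qed.

Lemma cont_eq f g : f =1 g -> cont f -> cont g.
Proof. by move=> /funext ->. Qed.

Definition ccont (F : R -> R[i]) := cont (fun t => re (F t)) /\ cont (fun t => im (F t)).

Lemma ac_derivative_cont (F f : R -> R[i]) : ac_derivative F f -> ccont F.
Proof. by move=> [h1 h2 _]; split; apply: ac_cont. Qed.

Lemma ccont_lin (a : R[i]) (u v : R -> R[i]) : ccont u -> ccont v -> ccont (fun t => a * u t + v t).
Proof.
move=> [u1 u2] [v1 v2]; split.
  apply: cont_eq (contD (contB (contM (@cont_cst _ (re a)) u1) (contM (@cont_cst _ (im a)) u2)) v1).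
  by move=> t; rewrite !ReImE.
apply: cont_eq (contD (contD (contM (@cont_cst _ (re a)) u2) (contM (@cont_cst _ (im a)) u1)) v2).
by move=> t; rewrite !ReImE.
Qed.

Lemma ccontJ (u : R -> R[i]) : ccont u -> ccont (fun t => (u t)^*%C).
Proof.
move=> [u1 u2]; split; first by apply: cont_eq u1 => t; rewrite ReJ.
by apply: cont_eq (contN u2) => t; rewrite ImJ.
Qed.

Lemma ccont_sq_integrable (mu : {measure set (measurableTypeR R) -> \bar R}) (u : R -> R[i]) :
  (mu I01 < +oo)%E -> ccont u -> sq_integrable mu I01 u.
Proof.
move=> mu01 [u1 u2]; split; [exact: cont_measurable|exact: cont_measurable|].
apply: (cont_integrable mu01) => /=; rewrite /sqmod.
by apply: contD; apply: contM.
Qed.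

Lemma cintegrable_mul_cont (f g : R -> R[i]) : cintegrable (leb R) I01 f -> ccont g ->
  cintegrable (leb R) I01 (fun t => f t * g t).
Proof.
have mI : measurable I01 by [].
move=> [f1 f2] [g1 g2]; split.
  have := rintB mI (integrable_mul_cont f1 g1) (integrable_mul_cont f2 g2).
  by apply: eq_integrable => // t _ /=; rewrite ReM.
have := rintD mI (integrable_mul_cont f1 g2) (integrable_mul_cont f2 g1).
by apply: eq_integrable => // t _ /=; rewrite ImM.
Qed.

Lemma ccont_integrable (f : R -> R[i]) : ccont f -> cintegrable (leb R) I01 f.
Proof. by move=> [f1 f2]; split; apply: cont_integrable => //; exact: leb01_fin. Qed.

Lemma ac_cintegral (F f : R -> R[i]) : ac_derivative F f -> cintegrable (leb R) I01 f ->
  cintegral (leb R) I01 f = F 1 - F 0.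
Proof.
move=> /ac_derivativeP[F1 F2] [f1 f2]; apply: eq_ReIm; rewrite ?ReB ?ImB.
  by rewrite (ac_integral F1 f1).
by rewrite (ac_integral F2 f2).
Qed.

Lemma integral_by_parts (F f G g : R -> R[i]) :
  ac_derivative F f -> ac_derivative G g ->
  cintegrable (leb R) I01 f -> cintegrable (leb R) I01 g ->
  cintegral (leb R) I01 (fun t => f t * (G t)^*%C) =
  F 1 * (G 1)^*%C - F 0 * (G 0)^*%C - cintegral (leb R) I01 (fun t => F t * (g t)^*%C).
Proof.
move=> acF acG fi gi.
have mI : measurable I01 by [].
have cG := ccontJ (ac_derivative_cont acG).
have i1 := cintegrable_mul_cont fi cG.
have gJ : cintegrable (leb R) I01 (fun t => (g t)^*%C).
  case: gi => g1 g2; split; first by apply: eq_integrable g1 => // t _ /=; rewrite ReJ.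
  by have := rintN mI g2; apply: eq_integrable => // t _ /=; rewrite ImJ.
have i2 : cintegrable (leb R) I01 (fun t => F t * (g t)^*%C).
  have := cintegrable_mul_cont gJ (ac_derivative_cont acF).
  by congr cintegrable; apply/funext => t; rewrite mulrC.
rewrite -(ac_cintegral (ac_derivative_mulJ acF acG) (cintegrableD mI i1 i2)).
by rewrite (cintegralD mI i1 i2) addrK.
Qed.

End AbsolutelyContinuousAlgebra.

(** * Interpolation between derivatives *)

Section Polynomials.
Context {R : realType}.
Implicit Types p : {poly R}.

Lemma poly_within_continuous p (a b : R) : {within `[a, b], continuous (horner p)}.
Proof. by apply: derivable_within_continuous => x _; exact: derivable_horner. Qed.

Lemma poly_bounded p (a b : R) : a <= b ->
  exists2 c, 0 <= c & forall t, a <= t <= b -> `|p.[t]| <= c.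
Proof.
move=> ab; have cf := poly_within_continuous (p := p) (a := a) (b := b).
have [c _ hc] := EVT_max ab cf; have [c' _ hc'] := EVT_min ab cf.
exists (`|p.[c]| + `|p.[c']|); first by rewrite addr_ge0.
move=> t t01; have t01' : t \in `[a, b] by rewrite in_itv.
have h1 := hc _ t01'; have h2 := hc' _ t01'; rewrite ler_norml.
apply/andP; split.
  rewrite lerNl; apply: le_trans (_ : - p.[t] <= - p.[c']) _; first by rewrite lerN2.
  by apply: le_trans (ler_norm _) _; rewrite normrN lerDr.
by apply: le_trans h1 _; apply: le_trans (ler_norm _) _; rewrite lerDl.
Qed.

Lemma poly_lipschitz p (a b : R) : a <= b -> exists2 K, 0 <= K &
  forall s t, a <= s <= b -> a <= t <= b -> `|p.[s] - p.[t]| <= K * `|s - t|.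
Proof.
move=> ab; have [K K0 hK] := poly_bounded p^`() ab; exists K => // s t.
wlog st : s t / t <= s.
  move=> W hs ht; have [/W|/ltW/W] := leP t s; first exact.
  by rewrite distrC [X in _ -> _ -> _ <= _ * X]distrC; apply.
move=> /andP[sa sb] /andP[ta tb].
have [c] := MVT_segment st (fun x _ => is_derive_poly p x) (@poly_within_continuous p t s).
rewrite in_itv/= => /andP[tc cs] ->; rewrite normrM ler_wpM2r// hK//.
by rewrite (le_trans ta tc) (le_trans cs sb).
Qed.

Lemma poly_ac p : real_ac_derivative (horner p) (horner p^`()).
Proof.
have [K K0 hK] := poly_lipschitz p (@ler01 R).
split; first exact: (@lipschitz_ac _ _ K).
by apply: aeW => t _; exact: is_derive_poly.
Qed.

Lemma poly_primitive p : exists2 P : {poly R}, (size P <= (size p).+1)%N & P^`() = p.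
Proof.
exists (\poly_(i < (size p).+1) (p`_i.-1 / i%:R)); first exact: size_poly.
apply/polyP => i; rewrite coef_deriv coef_poly ltnS.
have [ip|ip] := ltnP i (size p); last by rewrite mul0rn nth_default.
by rewrite /= -(mulr_natr (_ / _)) divfK// pnatr_eq0.
Qed.

End Polynomials.

(** * Sup and L2 estimates for a function and its derivatives *)

Section RealChains.
Context {R : realType}.
Implicit Types (g F G : R -> R).
Local Notation I01 := (`[0 : R, 1 : R]%classic : set (measurableTypeR R)).
Local Notation cont f := {within `[(0 : R), 1], continuous (f : R -> R)}.
Local Notation rint f := ((leb R).-integrable I01 (EFin \o f)).

Definition l2norm g : R := Num.sqrt (\int[leb R]_(t in I01) (g t) ^+ 2).

Definition real_chain (l : nat) (f : nat -> R -> R) :=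
  [/\ forall i, (i < l)%N -> real_ac_derivative (f i) (f i.+1),
      measurable_fun I01 (f l) & rint (fun t => f l t ^+ 2)].

Lemma l2norm_ge0 g : 0 <= l2norm g. Proof. exact: sqrtr_ge0. Qed.

Lemma sqr_rint g : measurable_fun I01 g -> rint (fun t => g t ^+ 2) -> rint g.
Proof.
move=> mg gi; have mI : measurable I01 by [].
have r1 : rint (fun=> 1).
  by apply: (cont_integrable (mu := leb R)); [exact: leb01_fin|exact: cont_cst].
apply: (rint_le mI mg (g := fun t => 1 + g t ^+ 2)); last exact: rintD.
move=> t _; rewrite -[`|g t|]mulr1 -subr_ge0 -(real_normK (num_real (g t))).
rewrite (_ : _ - _ = (1 - `|g t|) ^+ 2 / 2 + (1 + `|g t| ^+ 2) / 2); last by field.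
by rewrite addr_ge0// divr_ge0 ?sqr_ge0// addr_ge0 ?sqr_ge0.
Qed.

Lemma itv_sub01 (s t : R) : 0 <= s -> t <= 1 -> `[s, t]%classic `<=` I01.
Proof. by move=> s0 t1; apply: subset_itv; rewrite bnd_simp. Qed.

Lemma Rintegral_subset (A B : set (measurableTypeR R)) (f : R -> R) : measurable A -> measurable B ->
  A `<=` B -> (leb R).-integrable B (EFin \o f) -> (forall x, B x -> 0 <= f x) ->
  \int[leb R]_(x in A) f x <= \int[leb R]_(x in B) f x.
Proof.
move=> mA mB AB fi f0; rewrite /Rintegral fine_le//.
- by apply: integrable_fin_num => //; apply: integrableS fi.
- exact: integrable_fin_num.
- by apply: ge0_subset_integral => //; move/integrableP: fi => [].
Qed.

Lemma Rintegral_cst_itv (k s t : R) : s <= t -> \int[leb R]_(x in `[s, t]) k = k * (t - s).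
Proof.
move=> st; rewrite Rintegral_cst//; congr (_ * _).
suff h : lebesgue_measure `[s, t]%classic = (t - s)%:E by exact: (congr1 fine h).
rewrite lebesgue_measure_itv/= lte_fin; case: ltP => // ts.
by have -> : t = s; [apply/eqP; rewrite eq_le ts|rewrite subrr].
Qed.

Lemma cst_rint (A : set (measurableTypeR R)) (k : R) : measurable A -> A `<=` I01 ->
  (leb R).-integrable A (EFin \o (fun=> k : R)).
Proof.
move=> mA AI; have mI : measurable I01 by [].
apply: integrableS AI _ => //.
by apply: (cont_integrable (mu := leb R)); [exact: leb01_fin|exact: cont_cst].
Qed.

(** Cauchy-Schwarz on [[s, t]], obtained by integrating 2 |g| <= k + g^2 / k and taking for [k] the
    absolute value of the integral divided by [t - s]. *)
Lemma integral_l2 g (s t : R) : measurable_fun I01 g -> rint (fun t => g t ^+ 2) ->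
  0 <= s -> s <= t -> t <= 1 ->
  `|\int[leb R]_(x in `[s, t]) g x| <= Num.sqrt (t - s) * l2norm g.
Proof.
move=> mg gi s0 st t1; set x := `|_|; set B := \int[leb R]_(t in I01) g t ^+ 2.
have B0 : 0 <= B by apply: Rintegral_ge0 => y _; exact: sqr_ge0.
have sub := itv_sub01 s0 t1.
have mst : measurable (`[s, t]%classic : set (measurableTypeR R)) by [].
have mI : measurable I01 by [].
have ri (f : R -> R) : rint f -> (leb R).-integrable (`[s, t]%classic : set (measurableTypeR R)) (EFin \o f).
  by move=> fi; apply: integrableS fi.
have gi1 := sqr_rint mg gi.
have key (k : R) : 0 < k -> 2 * x <= k * (t - s) + B / k.
  move=> k0.
  have i1 : (leb R).-integrable (`[s, t]%classic : set (measurableTypeR R)) (EFin \o (fun=> k : R)).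
    exact: cst_rint.
  have i2 := rintZ mst (k^-1) (ri _ gi).
  have h1 : 2 * x <= 2 * \int[leb R]_(y in `[s, t]) `|g y|.
    by rewrite ler_wpM2l//; apply: le_normr_Rintegral => //; exact: ri.
  apply: le_trans h1 _.
  have i3 : (leb R).-integrable (`[s, t]%classic : set (measurableTypeR R)) (EFin \o (fun y => `|g y|)).
    exact: integrable_norm (ri _ gi1).
  rewrite -(RintegralZl _ mst i3).
  apply: le_trans (_ : \int[leb R]_(y in `[s, t]) (k + k^-1 * g y ^+ 2) <= _).
    apply: (le_Rintegral mst); [exact: rintZ|exact: rintD|].
    move=> y _; rewrite -(real_normK (num_real (g y))) -subr_ge0.
    rewrite (_ : _ - _ = k^-1 * (k - `|g y|) ^+ 2); last by field; rewrite lt0r_neq0.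
    by rewrite mulr_ge0 ?sqr_ge0// invr_ge0 ltW.
  rewrite (RintegralD mst i1 i2) Rintegral_cst_itv//.
  rewrite (RintegralZl _ mst (ri _ gi)) [B / k]mulrC lerD2l.
  rewrite ler_wpM2l ?invr_ge0 ?(ltW k0)//.
  by apply: Rintegral_subset => // y _; exact: sqr_ge0.
have x0 : 0 <= x by apply: normr_ge0.
have [ts|ts] := leP t s.
  rewrite /x (_ : t = s); last by apply/eqP; rewrite eq_le ts.
  by rewrite set_itv1 Rintegral_set1 normr0 mulr_ge0// sqrtr_ge0.
have A0 : 0 < t - s by rewrite subr_gt0.
rewrite /l2norm -/B -sqrtrM ?(ltW A0)// -(ger0_norm x0) -sqrtr_sqr ler_sqrt; last first.
  by rewrite mulr_ge0// ltW.
have [xp|] := ltP 0 x; last first.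
  move=> xn; have -> : x = 0 by apply/eqP; rewrite eq_le xn.
  by rewrite expr0n/= mulr_ge0// ltW.
have := key (x / (t - s)); rewrite divr_gt0// => /(_ isT).
rewrite divfK ?lt0r_neq0// mulr_natl mulr2n lerD2l invf_div mulrA ler_pdivlMr//.
by rewrite mulrC expr2 [B * _]mulrC.
Qed.

(** [F t] is the mean of [F] over a window of length [h] containing [t], plus the mean of
    [F t - F x]; the latter is an integral of the derivative over a piece of the window. *)
Lemma average_bound F (f : R -> R) (b dl h t : R) : real_ac_derivative F f -> rint f ->
  0 < h -> h <= 1 -> 0 <= t <= 1 ->
  (forall c, 0 <= c -> c + h <= 1 -> `|\int[leb R]_(x in `[c, c + h]) F x| <= b) ->
  (forall s t, 0 <= s -> s <= t -> t <= 1 -> t - s <= h ->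
     `|\int[leb R]_(x in `[s, t]) f x| <= dl) ->
  `|F t| <= b / h + dl.
Proof.
move=> acF fi h0 h1 /andP[t0 t1] hb hd.
(* The window starts at [t], unless it would leave the unit interval on the right. *)
pose c := Num.min t (1 - h).
have c0 : 0 <= c by rewrite le_min t0 subr_ge0.
have ct : c <= t by rewrite ge_min lexx.
have ch1 : c + h <= 1 by rewrite -lerBrDr ge_min lexx orbT.
have tch : t <= c + h.
  by rewrite -lerBlDr le_min lerBlDr lerDl (ltW h0)/= lerB.
have sub := itv_sub01 c0 ch1.
pose A := `[c, c + h]%classic : set (measurableTypeR R).
have mA : measurable A by exact: measurable_itv.
have iF : (leb R).-integrable A (EFin \o F).
  apply: (integrableS _ mA sub) => //.
  by apply: (cont_integrable (mu := leb R)); [exact: leb01_fin|exact: ac_cont acF.1].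
have iC (k : R) := cst_rint k mA sub.
have cc : c <= c + h by rewrite lerDl ltW.
have chc : c + h - c = h by rewrite addrAC subrr add0r.
have hF x : A x -> `|F t - F x| <= dl.
  rewrite /A/= in_itv/= => /andP[cx xc].
  have [tx|/ltW xt] := leP t x.
    rewrite distrC (ac_integral acF fi t0 tx); last exact: le_trans ch1.
    by apply: hd => //; [exact: le_trans ch1|rewrite -chc lerB].
  rewrite (ac_integral acF fi (le_trans c0 cx) xt t1).
  by apply: hd => //; [exact: le_trans cx|rewrite -chc lerB].
have e1 : F t * h = \int[leb R]_(x in A) F x + \int[leb R]_(x in A) (F t - F x).
  rewrite (RintegralB mA (iC (F t)) iF) Rintegral_cst_itv// chc.
  by rewrite addrC subrK.
have e2 : `|\int[leb R]_(x in A) (F t - F x)| <= dl * h.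
  have iB := rintB mA (iC (F t)) iF.
  apply: le_trans (le_normr_Rintegral mA iB) _.
  rewrite -[X in _ <= _ * X]chc -Rintegral_cst_itv//.
  by apply: (le_Rintegral mA) => //; exact: integrable_norm iB.
rewrite -(ler_pM2r h0) mulrDl divfK ?lt0r_neq0// -[X in _ * X <= _](gtr0_norm h0) -normrM e1.
by apply: le_trans (ler_normD _ _) _; apply: lerD => //; exact: hb.
Qed.

Lemma real_chain_rint l f i : real_chain l f -> (i <= l)%N -> rint (f i).
Proof.
move=> [ac ml il]; rewrite leq_eqVlt => /orP[/eqP->|/ac[acf _]]; first exact: sqr_rint.
by apply: (cont_integrable (mu := leb R)); [exact: leb01_fin|exact: ac_cont].
Qed.

Lemma real_chain_sq l f i : real_chain l f -> (i <= l)%N ->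
  measurable_fun I01 (f i) /\ rint (fun t => f i t ^+ 2).
Proof.
move=> [ac ml il]; rewrite leq_eqVlt => /orP[/eqP->//|/ac[acf _]].
split; first by apply: cont_measurable; apply: ac_cont.
apply: (cont_integrable (mu := leb R)); first exact: leb01_fin.
have cf := ac_cont acf.
by apply: cont_eq (contM cf cf) => t; rewrite expr2.
Qed.

(* [s i] stands for the maximum of the i-th derivative, [s l] for the L2 norm of
   the l-th one and [n0] for the L2 norm of the function itself. *)
Definition landau_inequalities (l : nat) (s : nat -> R) (n0 : R) :=
  [/\ 0 <= n0, forall i, 0 <= s i,
      forall k, 0 < k -> k <= 1 -> s 0%N <= n0 / k ^+ 2 + k * s 1%N &
      forall i k, (i.+1 < l)%N -> 0 < k -> k <= 1 ->
        s i.+1 <= 2 * s i / k ^+ 2 + k * s i.+2].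

(** In the induction, the previous step is used with the factor [k ^+ 2 / 4], so that the term
    [2 * s i / k ^+ 2] costs only half of [s i.+1] and is absorbed on the left. *)
Lemma landau_step l i : (i < l)%N -> forall eps : R, 0 < eps ->
  exists2 C, 0 <= C & forall s n0, landau_inequalities l s n0 ->
    s i <= eps * s i.+1 + C * n0.
Proof.
elim: i => [_|i IH il] eps e0.
  pose k := Num.min 1 eps.
  have k0 : 0 < k by rewrite lt_min ltr01.
  have k1 : k <= 1 by rewrite ge_min lexx.
  exists (k ^+ 2)^-1; first by rewrite invr_ge0 sqr_ge0.
  move=> s n0 [n00 s0 h _]; apply: le_trans (h _ k0 k1) _.
  by rewrite addrC mulrC [X in _ <= _ + X]mulrC lerD2r mulrC ler_wpM2r// ge_min lexx orbT.
pose k := Num.min 1 (eps / 2).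
have k0 : 0 < k by rewrite lt_min ltr01 divr_gt0.
have k1 : k <= 1 by rewrite ge_min lexx.
have ke : k <= eps / 2 by rewrite ge_min lexx orbT.
have kk0 : 0 < k ^+ 2 by rewrite exprn_gt0.
have e1 : 0 < k ^+ 2 / 4 by rewrite divr_gt0.
have [C C0 hC] := IH (ltnW il) _ e1.
exists (4 * C / k ^+ 2); first by rewrite divr_ge0 ?mulr_ge0// ltW.
move=> s n0 hs; have h1 := hC _ _ hs; case: hs => n00 s0 _ h.
have h2 := h i k il k0 k1.
have h3 : 2 * s i / k ^+ 2 <= s i.+1 / 2 + 2 * C / k ^+ 2 * n0.
  rewrite ler_pdivrMr//.
  rewrite (_ : (_ + _) * k ^+ 2 = 2 * (k ^+ 2 / 4 * s i.+1 + C * n0)); first by rewrite ler_wpM2l.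
  by field; rewrite lt0r_neq0.
have h4 : k * s i.+2 <= eps / 2 * s i.+2 by rewrite ler_wpM2r.
rewrite (_ : 4 * C / k ^+ 2 * n0 = 2 * (2 * C / k ^+ 2 * n0)); last by field; rewrite lt0r_neq0.
by move: h2 h3 h4; set u := 2 * C / _ * _; set v := _ / k ^+ 2 => *; lra.
Qed.

Lemma landau_bound l i : (i < l)%N -> forall eps : R, 0 < eps ->
  exists2 C, 0 <= C & forall s n0, landau_inequalities l s n0 ->
    s i <= eps * s l + C * n0.
Proof.
move=> il; have [j lj] : exists j, l = (i + j.+1)%N.
  by exists (l - i.+1)%N; rewrite addnS -addSn subnKC.
elim: j i il lj => [|j IH] i il lj eps e0.
  by have := landau_step il e0; rewrite lj addn1.
have [C1 C10 h1] := landau_step il (@ltr01 R).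
have il1 : (i.+1 < l)%N by rewrite lj !addnS !ltnS leq_addr.
have lj1 : l = (i.+1 + j.+1)%N by rewrite lj addSnnS.
have [C2 C20 h2] := IH i.+1 il1 lj1 eps e0.
exists (C1 + C2); first exact: addr_ge0.
move=> s n0 hs; have := h1 _ _ hs; have := h2 _ _ hs; rewrite mul1r mulrDl; lra.
Qed.

Lemma chain_landau l f : (0 < l)%N -> real_chain l f ->
  exists s, [/\ landau_inequalities l s (l2norm (f 0%N)),
    forall i t, (i < l)%N -> 0 <= t <= 1 -> `|f i t| <= s i & s l = l2norm (f l)].
Proof.
move=> l0 hf; have [ac ml il] := hf.
have [s hs] : exists s : nat -> R, forall i, 0 <= s i /\
    ((i < l)%N -> (forall t, 0 <= t <= 1 -> `|f i t| <= s i) /\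
      exists2 t, 0 <= t <= 1 & `|f i t| = s i).
  apply: (exists_choice (P := fun i x => 0 <= x /\
    ((i < l)%N -> (forall t, 0 <= t <= 1 -> `|f i t| <= x) /\
      exists2 t, 0 <= t <= 1 & `|f i t| = x))) => i.
  have [il'|il'] := ltnP i l; last by exists 0; split.
  have cf := ac_cont (ac _ il').1.
  have cf' : {within `[(0 : R), 1], continuous (fun t => `|f i t|)}.
    by move=> t; apply: cvg_norm; exact: cf.
  have [c c01 hc] := EVT_max ler01 cf'.
  exists `|f i c|; split=> // _; split; last by exists c.
  by move=> t t01; apply: hc.
pose s' i := if i == l then l2norm (f l) else s i.
have s'l : s' l = l2norm (f l) by rewrite /s' eqxx.
have s'i i : (i < l)%N -> s' i = s i by move=> ?; rewrite /s' ltn_eqF.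
(* The windows have length [k ^+ 2] because the top derivative is known only in L2, where such a
   window costs its square root [k]. For the lower derivatives the sup norm gives [k ^+ 2 <= k]. *)
have hint i (k : R) : (i < l)%N -> 0 < k -> k <= 1 -> forall u v, 0 <= u -> u <= v -> v <= 1 -> v - u <= k ^+ 2 ->
    `|\int[leb R]_(x in `[u, v]) f i.+1 x| <= k * s' i.+1.
  move=> il' k0 k1 u v u0 uv v1 vk.
  have sk : Num.sqrt (v - u) <= k.
    by rewrite -[leRHS](ger0_norm (ltW k0)) -sqrtr_sqr ler_sqrt ?sqr_ge0.
  move: il'; rewrite leq_eqVlt => /orP[/eqP il'|il'].
    rewrite il' s'l; apply: le_trans (integral_l2 ml il u0 uv v1) _.
    by rewrite ler_wpM2r// l2norm_ge0.
  rewrite s'i//; have [_ /(_ il')[h _]] := hs i.+1.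
  have mA : measurable (`[u, v]%classic : set (measurableTypeR R)) by [].
  have fi : (leb R).-integrable (`[u, v]%classic : set (measurableTypeR R)) (EFin \o f i.+1).
    apply: (integrableS _ mA (itv_sub01 u0 v1)) => //; exact: real_chain_rint hf (ltnW il').
  apply: le_trans (le_normr_Rintegral mA fi) _.
  apply: le_trans (_ : \int[leb R]_(x in `[u, v]) s i.+1 <= _).
    apply: (le_Rintegral mA); [exact: integrable_norm fi|exact: (cst_rint _ mA (itv_sub01 u0 v1))|].
    move=> x /=; rewrite in_itv/= => /andP[ux xv]; apply: h.
    by rewrite (le_trans u0 ux) (le_trans xv v1).
  rewrite Rintegral_cst_itv// mulrC ler_wpM2r ?(hs _).1//.
  apply: le_trans vk _; rewrite expr2 ler_piMr// ltW//.
exists s'; split=> //; last by move=> i t il' t01; rewrite s'i//; exact: ((hs i).2 il').1.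
split.
- exact: l2norm_ge0.
- by move=> i; rewrite /s'; case: eqP => // _; [exact: l2norm_ge0|exact: (hs i).1].
- move=> k k0 k1; rewrite s'i//; have [_ /(_ l0)[_ [t t01 <-]]] := hs 0%N.
  have kk0 : 0 < k ^+ 2 by rewrite exprn_gt0.
  have kk1 : k ^+ 2 <= 1 by rewrite expr_le1// ltW.
  apply: (average_bound (ac _ l0) (real_chain_rint hf l0) kk0 kk1 t01).
    move=> c c0 ch; have [m0 i0] := real_chain_sq hf (leq0n l).
    have cc : c <= c + k ^+ 2 by rewrite lerDl ltW.
    apply: le_trans (integral_l2 m0 i0 c0 cc ch) _.
    rewrite ler_piMl ?l2norm_ge0// addrAC subrr add0r sqrtr_sqr gtr0_norm//.
  exact: hint.
- move=> i k il' k0 k1; rewrite (s'i i.+1)// (s'i i (ltnW il')).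
  have [_ /(_ il')[_ [t t01 <-]]] := hs i.+1.
  have kk0 : 0 < k ^+ 2 by rewrite exprn_gt0.
  have kk1 : k ^+ 2 <= 1 by rewrite expr_le1// ltW.
  apply: (average_bound (ac _ il') (real_chain_rint hf il') kk0 kk1 t01).
    move=> c c0 ch; have cc : c <= c + k ^+ 2 by rewrite lerDl ltW.
    rewrite -(ac_integral (ac _ (ltnW il')) (real_chain_rint hf (ltnW il')) c0 cc ch).
    have [_ /(_ (ltnW il'))[h _]] := hs i.
    apply: le_trans (ler_normB _ _) _; rewrite mulr_natl mulr2n; apply: lerD; apply: h.
      by rewrite ch (le_trans c0 cc).
    by rewrite c0 (le_trans cc ch).
  exact: hint.
Qed.

(** An Ehrling-type inequality. The arbitrarily small factor of the top derivative is what later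
    absorbs the potential and boundary terms. *)
Theorem chain_interpolation l (eps : R) : (0 < l)%N -> 0 < eps ->
  exists2 C, 0 <= C & forall f, real_chain l f -> forall i t, (i < l)%N -> 0 <= t <= 1 ->
    `|f i t| <= eps * l2norm (f l) + C * l2norm (f 0%N).
Proof.
move=> l0 e0.
have [C hC] : exists C : nat -> R, forall i, 0 <= C i /\ ((i < l)%N ->
    forall s n0, landau_inequalities l s n0 -> s i <= eps * s l + C i * n0).
  apply: (exists_choice (P := fun i C => 0 <= C /\ ((i < l)%N ->
    forall s n0, landau_inequalities l s n0 -> s i <= eps * s l + C * n0))) => i.
  have [il|il] := ltnP i l; last by exists 0.
  by have [C C0 h] := landau_bound il e0; exists C.
exists (\sum_(i < l) C i); first by apply: sumr_ge0 => i _; exact: (hC i).1.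
move=> f hf i t il t01; have [s [hs fs sl]] := chain_landau l0 hf.
apply: le_trans (fs i t il t01) _; apply: le_trans ((hC i).2 il _ _ hs) _.
rewrite sl lerD2l ler_wpM2r ?l2norm_ge0// (bigD1 (Ordinal il))//= lerDl.
by apply: sumr_ge0 => j _; exact: (hC j).1.
Qed.

(** Induction on the order: a polynomial close to the derivative is integrated from [c], which gains
    a factor [h]. The factor [Num.sqrt h] comes from Cauchy-Schwarz at the last derivative. *)
Lemma chain_poly_approx l f (c h : R) : real_chain l.+1 f -> 0 <= c -> 0 < h -> c + h <= 1 ->
  exists2 p : {poly R}, (size p <= l.+1)%N & forall t, c <= t <= c + h ->
    `|f 0%N t - p.[t]| <= h ^+ l * Num.sqrt h * l2norm (f l.+1).
Proof.
move=> + c0 h0 ch1; elim: l f => [|l IH] f hf.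
  exists (f 0%N c)%:P; first by rewrite size_polyC leq_b1.
  move=> t /andP[ct tch]; rewrite hornerC expr0 mul1r; have [ac m1 i1] := hf.
  have t1 := le_trans tch ch1.
  rewrite (ac_integral (ac 0%N isT) (real_chain_rint hf (leqnn 1)) c0 ct t1).
  apply: le_trans (integral_l2 m1 i1 c0 ct t1) _.
  by rewrite ler_wpM2r ?l2norm_ge0// ler_sqrt ?(ltW h0)// lerBlDl.
have [ac ml il] := hf.
have hf' : real_chain l.+1 (fun i => f i.+1) by split=> // i il'; apply: ac.
have [p sp hp] := IH _ hf'; have [P sP dP] := poly_primitive p.
exists (P + (f 0%N c - P.[c])%:P).
  apply: leq_trans (size_polyD _ _) _; rewrite geq_max (leq_trans sP)//.
  by rewrite size_polyC (leq_trans (leq_b1 _)).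
move=> t /andP[ct tch]; have t1 := le_trans tch ch1.
have pac := poly_ac P; rewrite dP in pac.
have acB' := acB (ac 0%N isT) pac.
have pi : rint (horner p).
  apply: (cont_integrable (mu := leb R)); first exact: leb01_fin.
  exact: poly_within_continuous.
have mI : measurable I01 by [].
have iB := rintB mI (real_chain_rint hf (isT : (1 <= l.+2)%N)) pi.
have e := ac_integral acB' iB c0 ct t1.
rewrite hornerD hornerC (_ : _ - _ = f 0%N t - P.[t] - (f 0%N c - P.[c])); last by ring.
rewrite e; have mA : measurable (`[c, t]%classic : set (measurableTypeR R)) by [].
have sub := itv_sub01 c0 t1.
have iB' : (leb R).-integrable (`[c, t]%classic : set (measurableTypeR R)) (EFin \o (fun x => f 1%N x - p.[x])).
  exact: integrableS iB.
apply: le_trans (le_normr_Rintegral mA iB') _.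
set E := h ^+ l * Num.sqrt h * l2norm (f l.+2) in hp *.
have E0 : 0 <= E by rewrite !mulr_ge0 ?sqrtr_ge0 ?l2norm_ge0// exprn_ge0 ?ltW.
apply: le_trans (_ : \int[leb R]_(x in `[c, t]) E <= _).
  apply: (le_Rintegral mA); [exact: integrable_norm iB'|exact: (cst_rint _ mA sub)|].
  move=> x /=; rewrite in_itv/= => /andP[cx xt]; apply: hp.
  by rewrite cx (le_trans xt tch).
rewrite Rintegral_cst_itv// (_ : h ^+ l.+1 * _ * _ = E * h); last by rewrite /E exprS; ring.
by rewrite ler_wpM2l// lerBlDl.
Qed.

(** The Lebesgue constant of equidistant nodes in the unit interval. Affine rescaling preserves it,
    so one constant serves every interval [[c, c + h]]. *)
Lemma lagrange_bound l : exists2 Lam : R, 0 <= Lam &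
  forall t, 0 <= t <= 1 -> \sum_(i < l) `|(tnth (l.-lagrange (fun i : nat => i%:R / l%:R)) i : {poly R}).[t]| <= Lam.
Proof.
have [c hc] : exists c : 'I_l -> R, forall i, 0 <= c i /\ forall t, 0 <= t <= 1 ->
    `|(tnth (l.-lagrange (fun i : nat => i%:R / l%:R)) i : {poly R}).[t]| <= c i.
  apply: (exists_choice (P := fun (i : 'I_l) c => 0 <= c /\ forall t, 0 <= t <= 1 ->
    `|(tnth (l.-lagrange (fun i : nat => i%:R / l%:R)) i : {poly R}).[t]| <= c)) => i.
  by have [c c0 h] := poly_bounded (tnth (l.-lagrange (fun i : nat => i%:R / l%:R)) i : {poly R}) (@ler01 R); exists c.
exists (\sum_i c i); first by apply: sumr_ge0 => i _; exact: (hc i).1.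
by move=> t t01; apply: ler_sum => i _; exact: (hc i).2.
Qed.

(** Lagrange interpolation reproduces the approximating polynomial [p], so the interpolation error
    of [f] is that of [f - p]; hence the constant 1 plus the Lebesgue constant. Nodes and weights
    are the same for all [f], which turns smallness on the interval into finitely many linear
    conditions. *)
Theorem chain_evaluation_estimate l : exists2 Lam : R, 0 <= Lam &
  forall c h, 0 <= c -> 0 < h -> c + h <= 1 ->
  exists (tau : 'I_l.+1 -> R) (w : 'I_l.+1 -> R -> R),
    (forall i, 0 <= tau i <= 1) /\
    forall f, real_chain l.+1 f -> forall t, c <= t <= c + h ->
      `|f 0%N t - \sum_i f 0%N (tau i) * w i t| <= Lam * (h ^+ l * Num.sqrt h * l2norm (f l.+1)).
Proof.
have [Lam Lam0 hLam] := lagrange_bound l.+1.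
exists (1 + Lam); first by rewrite addr_ge0.
move=> c h c0 h0 ch1.
pose x (i : nat) : R := i%:R / l.+1%:R.
have l0 : 0 < l.+1%:R :> R by [].
have xinj : injective x.
  move=> i j /(mulIf _); rewrite invr_eq0 lt0r_neq0// => /(_ isT)/eqP.
  by rewrite eqr_nat => /eqP.
pose tau (i : 'I_l.+1) := c + h * x i.
pose w (i : 'I_l.+1) t := (tnth (l.+1.-lagrange x) i : {poly R}).[(t - c) / h].
have x01 (i : 'I_l.+1) : 0 <= x i <= 1.
  by rewrite /x divr_ge0//= ler_pdivrMr// mul1r ler_nat ltnW.
have tauI i : c <= tau i <= c + h.
  have /andP[h1 h2] := x01 i; rewrite /tau lerDl mulr_ge0 ?(ltW h0)//= lerD2l.
  by rewrite ler_piMr// ltW.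
exists tau, w; split.
  by move=> i; have /andP[h1 h2] := tauI i; rewrite (le_trans c0 h1) (le_trans h2 ch1).
move=> f hf t tI; have [p sp hp] := chain_poly_approx hf c0 h0 ch1.
set E := _ * l2norm _ in hp *.
have E0 : 0 <= E by rewrite !mulr_ge0 ?sqrtr_ge0 ?l2norm_ge0// exprn_ge0 ?ltW.
have pE : p.[t] = \sum_i p.[tau i] * w i t.
  pose r := p \Po (h *: 'X + c%:P).
  have sr : (size r <= l.+1)%N.
    apply: leq_trans (size_comp_poly_leq _ _) _.
    rewrite (_ : size (h *: 'X + c%:P) = 2%N); last first.
      by rewrite size_polyDl size_scale ?lt0r_neq0// ?size_polyX// size_polyC; case: eqP.
    by rewrite muln1; case: (size p) sp => //.
  have := lagrange_gen (ltn0Sn l) xinj sr => /(congr1 (fun q => q.[(t - c) / h])).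
  rewrite horner_comp hornerD hornerZ hornerX hornerC.
  rewrite (_ : h * ((t - c) / h) + c = t); last by field; rewrite lt0r_neq0.
  move=> ->; rewrite horner_sum; apply: eq_bigr => i _.
  rewrite hornerM hornerC /w horner_comp hornerD hornerZ hornerX hornerC /tau; congr (p.[_] * _).
  by rewrite addrC.
rewrite (_ : _ - _ = (f 0%N t - p.[t]) - \sum_i (f 0%N (tau i) - p.[tau i]) * w i t); last first.
  have -> : \sum_i (f 0%N (tau i) - p.[tau i]) * w i t = \sum_i f 0%N (tau i) * w i t - p.[t].
    by rewrite pE -sumrB; apply: eq_bigr => i _; rewrite mulrBl.
  by ring.
apply: le_trans (ler_normB _ _) _; rewrite mulrDl mul1r; apply: lerD; first exact: hp.
apply: le_trans (ler_norm_sum _ _ _) _.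
apply: le_trans (_ : \sum_i E * `|w i t| <= _).
  by apply: ler_sum => i _; rewrite normrM ler_wpM2r// hp.
rewrite -mulr_sumr mulrC ler_wpM2r// hLam//.
by case/andP: tI => h1 h2; rewrite divr_ge0 ?subr_ge0 ?(ltW h0)//= ler_pdivrMr// mul1r lerBlDl.
Qed.

End RealChains.

(** * Green's formula and estimates for the operator *)

Section ComplexModulus.
Context {R : realType}.
Implicit Types z : R[i].

Definition cabs z : R := Num.sqrt (sqmod z).

Lemma cabs_ge0 z : 0 <= cabs z. Proof. exact: sqrtr_ge0. Qed.
Lemma cabs_sq z : cabs z ^+ 2 = sqmod z.
Proof. by rewrite sqr_sqrtr// sqmod_ge0. Qed.
Lemma cabsM z z' : cabs (z * z') = cabs z * cabs z'.
Proof. by rewrite /cabs sqmodM sqrtrM// sqmod_ge0. Qed.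
Lemma cabsJ z : cabs z^*%C = cabs z. Proof. by rewrite /cabs sqmodJ. Qed.
Lemma cabsR (x : R) : cabs x%:C%C = `|x|.
Proof. by rewrite /cabs sqmodR sqrtr_sqr. Qed.
Lemma conjc_sign i : ((-1 : R[i]) ^+ i)^*%C = (-1) ^+ i.
Proof.
elim: i => [|i IH]; first by rewrite expr0 conjc1.
by rewrite exprS conjcM IH; congr (_ * _); apply: eq_ReIm; rewrite /= ?oppr0.
Qed.
Lemma Re_sign i z : `|re ((-1) ^+ i * z)| = `|re z|.
Proof.
by elim: i => [|i IH]; [rewrite mul1r|rewrite exprS -mulrA mulN1r ReN normrN].
Qed.
Lemma Re_cabs z : `|re z| <= cabs z.
Proof. by rewrite -sqrtr_sqr ler_sqrt ?sqmod_ge0// Re_sqmod. Qed.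
Lemma sqmod_le z (b : R) : `|re z| <= b -> `|im z| <= b -> sqmod z <= 2 * b ^+ 2.
Proof.
move=> h1 h2; have h (x : R) : `|x| <= b -> x ^+ 2 <= b ^+ 2.
  by move=> xb; rewrite -(real_normK (num_real x)) lerXn2r// nnegrE ?(le_trans _ xb).
by rewrite /sqmod mulr_natl mulr2n; apply: lerD; exact: h.
Qed.
Lemma le_cabs z (b : R) : 0 <= b -> sqmod z <= b ^+ 2 -> cabs z <= b.
Proof. by move=> b0 h; rewrite -(ger0_norm b0) -sqrtr_sqr ler_sqrt// sqr_ge0. Qed.

End ComplexModulus.

(** * Hermitian pairings between two families of boundary data *)

Section BoundaryForm.
Context {R : realType} (N : nat).
Implicit Types u v : 'rV[R[i]]_N.

Definition bdot v u : R[i] := \sum_k v 0 k * (u 0 k)^*%C.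

Variable S : 'rV[R[i]]_N -> 'rV[R[i]]_N -> Prop.

(** The family is chosen with first components of the largest possible rank; a first component
    outside their span would increase it. *)
Lemma spanning_family : exists r (U V : 'M[R[i]]_(r, N)),
  (forall i, S (row i U) (row i V)) /\ forall u v, S u v -> (u <= U)%MS.
Proof.
pose T k := `[< exists r (U V : 'M[R[i]]_(r, N)),
  (forall i, S (row i U) (row i V)) /\ \rank U = k >].
have T0 : exists k, T k.
  by exists 0%N; apply/asboolP; exists 0%N, 0, 0; split; [case|rewrite mxrank0].
have TN k : T k -> (k <= N)%N.
  by move=> /asboolP[r [U [V [_ <-]]]]; exact: rank_leq_col.
case: (ex_maxnP T0 TN) => k /asboolP[r [U [V [hU rU]]]] kmax.
exists r, U, V; split=> // u v Suv; apply: contrapT => /negP nu.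
have : T (\rank (col_mx U u)).
  apply/asboolP; exists (r + 1)%N, (col_mx U u), (col_mx V v); split=> // i.
  rewrite -(splitK i); case: (fintype.split i) => j /=.
    by rewrite !rowKu.
  by rewrite !rowKd !row_id.
move=> /kmax; rewrite leqNgt -rU => /negP; apply.
have : (U < col_mx U u)%MS.
  rewrite ltmxE -{1}addsmxE addsmxSl/= col_mx_sub; apply: contra nu.
  by case/andP.
by rewrite ltmxErank => /andP[].
Qed.

(* On pairs (u, v) the hermitian form depends on u alone, hence it is u T u^* for
   a fixed matrix T. *)
Lemma hermitian_pairing_bound :
  (forall u v u' v', S u v -> S u' v' -> bdot v u' = (bdot v' u)^*%C) ->
  exists2 C : R, 0 <= C & forall u v, S u v -> `|re (bdot v u)| <= C * \sum_k sqmod (u 0 k).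
Proof.
move=> hS; have [r [U [V [hU Usp]]]] := spanning_family.
pose T := pinvmx U *m V.
exists (\sum_j \sum_k cabs (T j k)).
  by do 2!(apply: sumr_ge0 => ? _); exact: cabs_ge0.
move=> u v Suv.
have uE : u = u *m pinvmx U *m U by rewrite mulmxKpV// (Usp _ _ Suv).
(* The second argument is expanded in the rows of [U]; the symmetry then trades [v] for the
   corresponding rows of [V], so that [v] disappears. *)
have key : bdot v u = (\sum_j \sum_k u 0 j * T j k * (u 0 k)^*%C)^*%C.
  transitivity (\sum_i ((u *m pinvmx U) 0 i)^*%C * bdot v (row i U)).
    rewrite {1}uE /bdot; under eq_bigr => k _.
      rewrite mxE rmorph_sum mulr_sumr; over.
    rewrite exchange_big/=; apply: eq_bigr => i _; rewrite mulr_sumr.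
    by apply: eq_bigr => k _; rewrite [row i U 0 k]mxE conjcM; ring.
  transitivity (\sum_i (((u *m pinvmx U) 0 i) * bdot (row i V) u)^*%C).
    by apply: eq_bigr => i _; rewrite conjcM (hS _ _ _ _ Suv (hU i)).
  rewrite -rmorph_sum; congr (_^*%C).
  transitivity (\sum_i \sum_j \sum_k u 0 j * pinvmx U j i * V i k * (u 0 k)^*%C).
    apply: eq_bigr => i _; rewrite mxE mulr_suml; apply: eq_bigr => j _.
    by rewrite mulr_sumr; apply: eq_bigr => k _; rewrite [row i V 0 k]mxE; ring.
  rewrite exchange_big/=; apply: eq_bigr => j _.
  rewrite exchange_big/=; apply: eq_bigr => k _.
  rewrite mxE mulr_sumr mulr_suml; apply: eq_bigr => i _; ring.
rewrite key ReJ Re_sum mulr_suml; apply: le_trans (ler_norm_sum _ _ _) _.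
apply: ler_sum => j _; rewrite Re_sum mulr_suml.
apply: le_trans (ler_norm_sum _ _ _) _; apply: ler_sum => k _.
apply: le_trans (Re_cabs _) _; rewrite !cabsM cabsJ mulrAC mulrC ler_wpM2l ?cabs_ge0//.
set s := \sum_k0 _.
have sk i : cabs (u 0 i) ^+ 2 <= s.
  rewrite cabs_sq /s (bigD1 i)//= lerDl; apply: sumr_ge0 => ? _; exact: sqmod_ge0.
have := sk j; have := sk k; have := sqr_ge0 (cabs (u 0 j) - cabs (u 0 k)).
by rewrite sqrrB; lra.
Qed.

End BoundaryForm.

(** * Integration by parts for the differential expression *)

Section Green.
Context {R : realType}.
Local Notation I01 := (`[0 : R, 1 : R]%classic : set (measurableTypeR R)).
Local Notation cont f := {within `[(0 : R), 1], continuous (f : R -> R)}.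
Local Notation rint f := ((leb R).-integrable I01 (EFin \o f)).
Local Notation cint := (cintegral (leb R) I01).

Variables (l : nat) (P : nat -> R -> R).
Hypothesis hl : (0 < l)%N.
Hypothesis hP : forall i, (i < l)%N -> (leb R).-integrable `[0, 1] (EFin \o P i).

Let mI : measurable I01. Proof. exact: measurable_itv. Qed.

Lemma I01P (t : R) : I01 t -> 0 <= t <= 1. Proof. by rewrite /= in_itv. Qed.

Definition energy_chain (Y : nat -> R -> R[i]) :=
  (forall i, (i < l)%N -> ac_derivative (Y i) (Y i.+1)) /\ in_L2 (Y l).

(** A normal form of [diff_operator] without its boundary conditions: the last quasi-derivative is
    [w] itself rather than a function equal to it almost everywhere, and the l-th derivative is
    recorded as square-integrable. *)
Definition operator_chain (y w : R -> R[i]) (Y W : nat -> R -> R[i]) :=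
  [/\ energy_chain Y, forall t : R, t \in `[0, 1] -> Y 0%N t = y t,
    forall t : R, t \in `[0, 1] -> W 0%N t = (-1) ^+ l * Y l t,
    forall k, (k < l)%N -> ac_derivative (W k)
        (fun t => W k.+1 t - (P (l - k.+1)%N t)%:C%C * Y (l - k.+1)%N t) &
    W l = w /\ in_L2 w].

Lemma ccont_eq01 (u v : R -> R[i]) : (forall t : R, t \in `[0, 1] -> u t = v t) -> ccont u -> ccont v.
Proof.
move=> uv [u1 u2]; split.
  have : {in `[(0 : R), 1]%classic, (fun t => re (u t)) =1 (fun t => re (v t))}.
    by move=> t; rewrite inE/= => /uv ->.
  by move=> /(subspace_eq_continuous); apply; exact: u1.
have : {in `[(0 : R), 1]%classic, (fun t => im (u t)) =1 (fun t => im (v t))}.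
  by move=> t; rewrite inE/= => /uv ->.
by move=> /(subspace_eq_continuous); apply; exact: u2.
Qed.

(** As [l > 0], the function [W 0] is absolutely continuous, so [Y l], equal to it up to sign, is
    continuous on [0,1] and thus square-integrable. Changing [W l] on a null set is harmless since
    it enters only through an almost everywhere derivative. *)
Lemma diff_operator_chain r (B : 'M[R[i]]_((l + l) + (l + l), r)) y w :
  diff_operator P B y w -> exists Y W, operator_chain y w Y W.
Proof.
move=> [yL wL [Y [W [[hY hW0 hW] Y0 Wl _]]]].
exists Y, (fun k => if k == l then w else W k).
have l0 : (0 == l)%N = false by rewrite eq_sym; apply/negbTE; rewrite -lt0n.
split; rewrite ?l0 ?eqxx//.
- split=> //; apply: (@ccont_sq_integrable _ (leb R)); first exact: leb01_fin.
  have := ccont_lin ((-1) ^+ l) (ac_derivative_cont (hW _ hl)) (u := W 0%N) (v := fun=> 0).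
  move=> /(_ (conj (@cont_cst _ _) (@cont_cst _ _))).
  apply: ccont_eq01 => t t01; rewrite hW0// addr0 mulrA -exprD addnn -mul2n exprM.
  by rewrite sqrrN !expr1n mul1r.
- move=> k kl; rewrite (ltn_eqF kl); have [kl'|_] := eqVneq k.+1 l; last exact: hW.
  have [h1 h2 h3] := hW _ kl; split=> //; apply: leb_aeS2 h3 Wl => t h3 h4 t01.
  have <- : W k.+1 t = w t; last exact: h3.
  by rewrite kl' h4//; move: t01; rewrite !in_itv/= => /andP[? ?]; rewrite !ltW.
Qed.

Lemma energy_chain_cont Y i : energy_chain Y -> (i < l)%N -> ccont (Y i).
Proof. by move=> [hY _] il; exact: ac_derivative_cont (hY _ il). Qed.

Lemma in_L2_integrable (u : R -> R[i]) : in_L2 u -> cintegrable (leb R) I01 u.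
Proof.
move=> uL; have c1 : ccont (fun=> 1 : R[i]) by split; exact: cont_cst.
have L1 := ccont_sq_integrable leb01_fin c1.
have := sq_integrable_mul mI (uL : sq_integrable (leb R) I01 u) L1.
by congr cintegrable; apply/funext => t; rewrite mulr1.
Qed.

Lemma energy_chain_integrable Y i : energy_chain Y -> (i <= l)%N -> cintegrable (leb R) I01 (Y i).
Proof.
move=> hY; rewrite leq_eqVlt => /orP[/eqP ->|il]; first exact: in_L2_integrable hY.2.
exact: ccont_integrable (energy_chain_cont hY il).
Qed.

Lemma cintegrable_real (p : R -> R) (u : R -> R[i]) : rint p -> ccont u ->
  cintegrable (leb R) I01 (fun t => (p t)%:C%C * u t).
Proof.
move=> pi cu; apply: cintegrable_mul_cont => //; split=> //.
by apply: rint0.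
Qed.

(** What integration by parts leaves of (Ly, z) once the boundary terms are removed; the sign (-1)^i
    comes from moving i derivatives off the i-th potential term. *)
Definition energy (Y Z : nat -> R -> R[i]) : R[i] :=
  cint (fun t => Y l t * (Z l t)^*%C) +
  \sum_(i < l) (-1) ^+ i * cint (fun t => (P i t)%:C%C * (Y i t * (Z i t)^*%C)).

Definition boundary_term (W Z : nat -> R -> R[i]) : R[i] :=
  \sum_(i < l) (-1) ^+ i * (W (l - i.+1)%N 1 * (Z i 1)^*%C - W (l - i.+1)%N 0 * (Z i 0)^*%C).

Theorem green_formula y w Y W phi Z : operator_chain y w Y W ->
  energy_chain Z -> (forall t : R, t \in `[0, 1] -> Z 0%N t = phi t) ->
  L2dot w phi = energy Y Z + boundary_term W Z.
Proof.
move=> [hY Y0 hW0 hW [Wl wL]] hZ Z0.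
have -> : L2dot w phi = cint (fun t => W l t * (Z 0%N t)^*%C).
  by apply: eq_cintegral => t t01; rewrite Wl Z0.
have PY i Z' : (i < l)%N -> ccont Z' ->
    cintegrable (leb R) I01 (fun t => (P i t)%:C%C * (Y i t * Z' t)).
  move=> il cZ; have := cintegrable_mul_cont (cintegrable_real (hP il) (energy_chain_cont hY il)) cZ.
  by congr cintegrable; apply/funext => t; rewrite mulrA.
have Wi k : (0 < k)%N -> (k <= l)%N -> cintegrable (leb R) I01 (W k).
  move=> k0; rewrite leq_eqVlt => /orP[/eqP ->|kl]; first by rewrite Wl; exact: in_L2_integrable.
  by apply: ccont_integrable; exact: ac_derivative_cont (hW _ kl).
(* After [j] integrations by parts, [W l] has been lowered to [W (l - j)] and [j] derivatives have
   moved to the other factor; each of them releases one boundary term and one potential term. *)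
suff H j : (j <= l)%N -> cint (fun t => W l t * (Z 0%N t)^*%C) =
    \sum_(i < j) (-1) ^+ i * (W (l - i.+1)%N 1 * (Z i 1)^*%C - W (l - i.+1)%N 0 * (Z i 0)^*%C) +
    \sum_(i < j) (-1) ^+ i * cint (fun t => (P i t)%:C%C * (Y i t * (Z i t)^*%C)) +
    (-1) ^+ j * cint (fun t => W (l - j)%N t * (Z j t)^*%C).
  rewrite (H l (leqnn l)) subnn /energy /boundary_term.
  have -> : (-1) ^+ l * cint (fun t => W 0%N t * (Z l t)^*%C) = cint (fun t => Y l t * (Z l t)^*%C).
    have -> : cint (fun t => W 0%N t * (Z l t)^*%C) = cint (fun t => (-1) ^+ l * (Y l t * (Z l t)^*%C)).
      by apply: eq_cintegral => t t01; rewrite hW0// mulrA.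
    rewrite (cintegralZ mI); last first.
      by apply: (sq_integrable_mul mI); [exact: hY.2|apply: (sq_integrableJ (m := leb R)); exact: hZ.2].
    by rewrite mulrA -exprD addnn -mul2n exprM sqrrN !expr1n mul1r.
  by rewrite [RHS]addrC [in RHS]addrCA addrA [in RHS]addrC; ring.
elim: j => [_|j IH jl]; first by rewrite !big_ord0 subn0 expr0 mul1r !add0r.
rewrite IH ?(ltnW jl)// !big_ord_recr/=.
have kl : (l - j.+1 < l)%N by rewrite ltn_subrL.
have k1 : (l - j.+1).+1 = (l - j)%N by rewrite subnSK.
have k2 : (l - (l - j))%N = j by rewrite subKn// ltnW.
have acW := hW _ kl; rewrite k1 k2 in acW.
set g := (fun t => _ - _) in acW.
have PYi : cintegrable (leb R) I01 (fun t => (P j t)%:C%C * Y j t).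
  exact: cintegrable_real (hP jl) (energy_chain_cont hY jl).
have gi : cintegrable (leb R) I01 g.
  by apply: (cintegrableB mI) => //; apply: Wi; rewrite ?leq_subr// subn_gt0.
have cZ := ccontJ (energy_chain_cont hZ jl).
have -> : cint (fun t => W (l - j)%N t * (Z j t)^*%C) =
    cint (fun t => g t * (Z j t)^*%C) + cint (fun t => (P j t)%:C%C * (Y j t * (Z j t)^*%C)).
  rewrite -(cintegralD mI); [|exact: cintegrable_mul_cont|exact: PY].
  by apply: eq_cintegral => t _; rewrite /g; ring.
rewrite (integral_by_parts acW (hZ.1 _ jl) gi (energy_chain_integrable hZ jl)).
rewrite exprS; ring.
Qed.

Lemma energy_sym Y Z : energy_chain Y -> energy_chain Z -> energy Z Y = (energy Y Z)^*%C.
Proof.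
move=> hY hZ; rewrite /energy conjcD rmorph_sum; congr (_ + _).
  rewrite -(cintegralJ mI); last first.
    by apply: (sq_integrable_mul mI); [exact: hY.2|apply: (sq_integrableJ (m := leb R)); exact: hZ.2].
  by apply: eq_cintegral => t _; rewrite conjcM conjcK mulrC.
apply: eq_bigr => i _; rewrite -[RHS]/((_ * _)^*%C) conjcM; congr (_ * _).
  by rewrite conjc_sign.
have cY := energy_chain_cont hY (ltn_ord i); have cZ := energy_chain_cont hZ (ltn_ord i).
rewrite -(cintegralJ mI); last first.
  have := cintegrable_mul_cont (cintegrable_real (hP (ltn_ord i)) cY) (ccontJ cZ).
  by congr cintegrable; apply/funext => t; rewrite mulrA.
apply: eq_cintegral => t _.
by rewrite !conjcM conjcK conjc_real; ring.
Qed.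

Definition trace_row (Y : nat -> R -> R[i]) : 'rV[R[i]]_(l + l) :=
  row_mx (\row_(i < l) Y i 0) (\row_(i < l) Y i 1).
(** The alternating signs and the minus sign at 0 are stored here, so that the boundary term becomes
    the plain pairing [bdot]. *)
Definition cotrace_row (W : nat -> R -> R[i]) : 'rV[R[i]]_(l + l) :=
  row_mx (\row_(i < l) - ((-1) ^+ i * W (l - i.+1)%N 0))
         (\row_(i < l) ((-1) ^+ i * W (l - i.+1)%N 1)).

Lemma boundary_termE W Z : boundary_term W Z = bdot (cotrace_row W) (trace_row Z).
Proof.
rewrite /bdot big_split_ord/= -big_split/=; apply: eq_bigr => i _.
by rewrite !row_mxEl !row_mxEr !mxE; ring.
Qed.

Definition L2sq (u : R -> R[i]) : R := \int[leb R]_(t in I01) sqmod (u t).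

Lemma L2sq_ge0 u : 0 <= L2sq u.
Proof. by apply: Rintegral_ge0 => t _; exact: sqmod_ge0. Qed.

Lemma L2dotxx u : re (L2dot u u) = L2sq u. Proof. exact: sq_innerxx. Qed.

Lemma energy_chain_re Y : energy_chain Y -> real_chain l (fun i t => re (Y i t)).
Proof.
move=> [hY [m1 m2 YL]]; split=> //; first by move=> i /hY/ac_derivativeP[].
apply: (rint_le mI _ _ YL); first exact: measurable_funX.
by move=> t _; rewrite ger0_norm ?sqr_ge0//; exact: Re_sqmod.
Qed.

Lemma energy_chain_im Y : energy_chain Y -> real_chain l (fun i t => im (Y i t)).
Proof.
move=> [hY [m1 m2 YL]]; split=> //; first by move=> i /hY/ac_derivativeP[].
apply: (rint_le mI _ _ YL); first exact: measurable_funX.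
by move=> t _; rewrite ger0_norm ?sqr_ge0//; exact: Im_sqmod.
Qed.

Lemma l2norm_re u : in_L2 u -> l2norm (fun t => re (u t)) <= Num.sqrt (L2sq u).
Proof.
move=> [m1 m2 uL]; rewrite /l2norm ler_sqrt ?L2sq_ge0//.
apply: (le_Rintegral mI) => // [|t _]; last exact: Re_sqmod.
apply: (rint_le mI _ _ uL); first exact: measurable_funX.
by move=> t _; rewrite ger0_norm ?sqr_ge0//; exact: Re_sqmod.
Qed.

Lemma l2norm_im u : in_L2 u -> l2norm (fun t => im (u t)) <= Num.sqrt (L2sq u).
Proof.
move=> [m1 m2 uL]; rewrite /l2norm ler_sqrt ?L2sq_ge0//.
apply: (le_Rintegral mI) => // [|t _]; last exact: Im_sqmod.
apply: (rint_le mI _ _ uL); first exact: measurable_funX.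
by move=> t _; rewrite ger0_norm ?sqr_ge0//; exact: Im_sqmod.
Qed.

Lemma energy_chain_L2 Y i : energy_chain Y -> (i <= l)%N -> in_L2 (Y i).
Proof.
move=> hY; rewrite leq_eqVlt => /orP[/eqP ->|il]; first exact: hY.2.
exact: (ccont_sq_integrable leb01_fin (energy_chain_cont hY il)).
Qed.

Lemma energy_chain_interpolation (eps : R) : 0 < eps -> exists2 C, 0 <= C &
  forall Y, energy_chain Y -> forall i t, (i < l)%N -> 0 <= t <= 1 ->
    sqmod (Y i t) <= eps * L2sq (Y l) + C * L2sq (Y 0%N).
Proof.
(* Passing from a bound [M] on the real and imaginary parts to [sqmod] costs a factor 2, and
   squaring the sum [M] another 2; hence the quarter here and the 4 in the constant below. *)
move=> e0; pose ep := Num.sqrt (eps / 4).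
have ep0 : 0 < ep by rewrite sqrtr_gt0 divr_gt0.
have [C C0 hC] := chain_interpolation hl ep0.
exists (4 * C ^+ 2); first by rewrite mulr_ge0 ?sqr_ge0.
move=> Y hY i t il t01.
set a := L2sq (Y l); set b := L2sq (Y 0%N).
have a0 : 0 <= a := L2sq_ge0 _. have b0 : 0 <= b := L2sq_ge0 _.
pose M := ep * Num.sqrt a + C * Num.sqrt b.
have hr : `|re (Y i t)| <= M.
  apply: le_trans (hC _ (energy_chain_re hY) i t il t01) _.
  apply: lerD; rewrite ler_wpM2l ?(ltW ep0)//; apply: l2norm_re; exact: energy_chain_L2.
have hi : `|im (Y i t)| <= M.
  apply: le_trans (hC _ (energy_chain_im hY) i t il t01) _.
  apply: lerD; rewrite ler_wpM2l ?(ltW ep0)//; apply: l2norm_im; exact: energy_chain_L2.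
apply: le_trans (sqmod_le hr hi) _.
have : M ^+ 2 <= 2 * (eps / 4 * a) + 2 * (C ^+ 2 * b).
  have -> : eps / 4 * a = (ep * Num.sqrt a) ^+ 2.
    by rewrite exprMn !sqr_sqrtr// divr_ge0// ltW.
  have -> : C ^+ 2 * b = (C * Num.sqrt b) ^+ 2 by rewrite exprMn sqr_sqrtr.
  rewrite /M; set x := ep * _; set z := C * _.
  have := sqr_ge0 (x - z); rewrite sqrrB sqrrD; lra.
lra.
Qed.

End Green.

(** * Estimates on the domain of the operator *)

Section OperatorEstimates.
Context {R : realType}.
Local Notation I01 := (`[0 : R, 1 : R]%classic : set (measurableTypeR R)).
Local Notation rint f := ((leb R).-integrable I01 (EFin \o f)).
Local Notation cint := (cintegral (leb R) I01).

Variables (l : nat) (P : nat -> R -> R).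
Hypothesis hl : (0 < l)%N.
Hypothesis hP : forall i, (i < l)%N -> (leb R).-integrable `[0, 1] (EFin \o P i).
Variables (r : nat) (B : 'M[R[i]]_((l + l) + (l + l), r)).
Local Notation L := (diff_operator P B).
Hypothesis hsa : self_adjoint L.
Hypothesis hpos : positive_definite L.

Let mI : measurable I01. Proof. exact: measurable_itv. Qed.

Lemma operator_in_L2 y w : L y w -> in_L2 y /\ in_L2 w.
Proof. by case. Qed.

Lemma operator_symmetric y w z v : L y w -> L z v -> L2dot w z = L2dot y v.
Proof.
move=> Lyw Lzv; have [zL vL] := operator_in_L2 Lzv.
apply: (hsa.2 z v zL vL).2 Lyw; exists z => //.
by apply: aeW.
Qed.

Lemma L2_semi_inner : semi_inner (in_L2 : (R -> R[i]) -> Prop) L2dot.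
Proof.
have [h1 h2 h3] := sq_inner_semi (leb R) mI.
by split; [exact: h1|exact: h2|exact: h3].
Qed.

Lemma L2_subspace : subspace (in_L2 : (R -> R[i]) -> Prop).
Proof.
have [h1 h2] := sq_integrable_subspace (leb R) mI.
by split; [exact: h1|exact: h2].
Qed.

Definition potential_norm : R := \sum_(i < l) \int[leb R]_(t in I01) `|P i t|.

Lemma potential_norm_ge0 : 0 <= potential_norm.
Proof. by apply: sumr_ge0 => i _; apply: Rintegral_ge0. Qed.

Lemma potential_bound (Y Z : nat -> R -> R[i]) (a b : R) :
  energy_chain l Y -> energy_chain l Z -> 0 <= a -> 0 <= b ->
  (forall i t, (i < l)%N -> 0 <= t <= 1 -> sqmod (Y i t) <= a ^+ 2) ->
  (forall i t, (i < l)%N -> 0 <= t <= 1 -> sqmod (Z i t) <= b ^+ 2) ->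
  `|re (\sum_(i < l) (-1) ^+ i * cint (fun t => (P i t)%:C%C * (Y i t * (Z i t)^*%C)))|
  <= potential_norm * (a * b).
Proof.
move=> hY hZ a0 b0 ha hb; rewrite Re_sum /potential_norm mulr_suml.
apply: le_trans (ler_norm_sum _ _ _) _; apply: ler_sum => i _; rewrite Re_sign.
have cY := energy_chain_cont hY (ltn_ord i); have cZ := energy_chain_cont hZ (ltn_ord i).
have ci : cintegrable (leb R) I01 (fun t => (P i t)%:C%C * (Y i t * (Z i t)^*%C)).
  have := cintegrable_mul_cont (cintegrable_real (hP (ltn_ord i)) cY) (ccontJ cZ).
  by congr cintegrable; apply/funext => t; rewrite mulrA.
have Pi : rint (fun t => `|P i t|) by exact: integrable_norm (hP (ltn_ord i)).
rewrite -(RintegralZr _ mI Pi); apply: le_trans (le_normr_Rintegral mI ci.1) _.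
apply: (le_Rintegral mI); first exact: integrable_norm ci.1.
  by have := rintZ mI (a * b) Pi; apply: eq_integrable => // t _ /=; rewrite mulrC.
move=> t /I01P t01; apply: le_trans (Re_cabs _) _; rewrite !cabsM cabsJ cabsR.
rewrite ler_wpM2l//; apply: ler_pM; rewrite ?cabs_ge0//; apply: le_cabs => //.
  exact: ha.
exact: hb.
Qed.

(** By Green's formula, the pairing of the cotrace of one element of the domain with the trace of
    another is [L2dot] minus [energy]. Both are hermitian, the first since the operator is symmetric
    and the second since the potentials are real. The general bound for hermitian pairings then
    eliminates the quasi-derivatives [W]. *)
Lemma boundary_form_bound : exists2 C : R, 0 <= C &
  forall y w Y W (b : R), L y w -> operator_chain l P y w Y W ->
    (forall i t, (i < l)%N -> 0 <= t <= 1 -> sqmod (Y i t) <= b) ->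
    `|re (boundary_term l W Y)| <= C * b.
Proof.
pose S u v := exists y w Y W, [/\ L y w, operator_chain l P y w Y W,
  u = trace_row l Y & v = cotrace_row l W].
have [u v u' v'|C C0 hC] := @hermitian_pairing_bound R (l + l) S.
  move=> [y [w [Y [W [Lyw hYW -> ->]]]]] [y' [w' [Y' [W' [Lyw' hYW' -> ->]]]]].
  have bE y1 w1 Y1 W1 y2 Y2 : operator_chain l P y1 w1 Y1 W1 -> energy_chain l Y2 ->
      (forall t : R, t \in `[0, 1] -> Y2 0%N t = y2 t) ->
      bdot (cotrace_row l W1) (trace_row l Y2) = L2dot w1 y2 - energy l P Y1 Y2.
    move=> h1 h2 h3; rewrite -boundary_termE (green_formula hl hP h1 h2 h3).
    by rewrite addrC addKr.
  have [hY Y0 _ _ _] := hYW; have [hY' Y0' _ _ _] := hYW'.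
  rewrite (bE _ _ _ _ _ _ hYW hY' Y0') (bE _ _ _ _ _ _ hYW' hY Y0).
  rewrite -[RHS]/((_ + _)^*%C) conjcD -[(- _)^*%C]/(conjc (- _)) rmorphN/=.
  rewrite (energy_sym hP hY' hY); congr (_ - _).
  have [yL wL] := operator_in_L2 Lyw; have [yL' wL'] := operator_in_L2 Lyw'.
  by rewrite (operator_symmetric Lyw Lyw') (form_sym L2_semi_inner wL' yL).
exists (C * (l + l)%:R); first by rewrite mulr_ge0.
move=> y w Y W b Lyw hYW hb; rewrite boundary_termE.
apply: le_trans (hC _ _ _) _; first by exists y, w, Y, W.
rewrite -mulrA ler_wpM2l// mulr_natl -[X in b *+ X]card_ord -sumr_const.
apply: ler_sum => k _; rewrite /trace_row; case: (split_ordP k) => j ->.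
  by rewrite row_mxEl mxE hb// lexx ler01.
by rewrite row_mxEr mxE hb// lexx ler01.
Qed.

(* In Green's formula the potential and boundary terms are at most a multiple of the squared sup norms
   of y, ..., y^(l-1), hence, by interpolation, at most (1/2) ||y^(l)||^2 + C ||y||^2. *)
Theorem energy_estimate : exists2 K : R, 0 <= K &
  forall y w Y W, L y w -> operator_chain l P y w Y W ->
    L2sq (Y l) <= K * re (L2dot w y).
Proof.
have [c c0 hc] := hpos; have [Cb Cb0 hCb] := boundary_form_bound.
pose M := potential_norm + Cb.
have M0 : 0 <= M by rewrite addr_ge0 ?potential_norm_ge0.
(* With this factor, [M * b] is at most half of the squared norm of the top derivative plus a
   multiple of that of [y]. The latter is at most [q / c] by positive definiteness, whence the
   constant below. *)
have e0 : 0 < (2 * (M + 1))^-1 by rewrite invr_gt0 mulr_gt0// ltr_wpDl.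
have [C C0 hC] := energy_chain_interpolation hl e0.
exists (2 + 2 * M * C / c).
  by rewrite addr_ge0// divr_ge0 ?mulr_ge0// ltW.
move=> y w Y W Lyw hYW; have [hY Y0 _ _ _] := hYW.
set q := re (L2dot w y); set Nl := L2sq (Y l).
pose b := (2 * (M + 1))^-1 * Nl + C * L2sq (Y 0%N).
have Nl0 : 0 <= Nl := L2sq_ge0 _.
have N00 : 0 <= L2sq (Y 0%N) := L2sq_ge0 _.
have b0 : 0 <= b by rewrite addr_ge0// mulr_ge0// ltW.
have hb i t : (i < l)%N -> 0 <= t <= 1 -> sqmod (Y i t) <= b by exact: hC.
have hb' i t : (i < l)%N -> 0 <= t <= 1 -> sqmod (Y i t) <= Num.sqrt b ^+ 2.
  by rewrite sqr_sqrtr//; exact: hb.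
have h1 := potential_bound hY hY (sqrtr_ge0 b) (sqrtr_ge0 b) hb' hb'.
rewrite -expr2 sqr_sqrtr// in h1.
have h2 := hCb _ _ _ _ _ Lyw hYW hb.
have qE : q = Nl + re (\sum_(i < l) (-1) ^+ i * cint (fun t => (P i t)%:C%C * (Y i t * (Y i t)^*%C)))
    + re (boundary_term l W Y).
  rewrite /q (green_formula hl hP hYW hY Y0) /energy !ReD; congr (_ + _ + _).
  exact: L2dotxx.
have N0E : L2sq (Y 0%N) = L2sq y by apply: eq_Rintegral => t; rewrite inE => /Y0 ->.
have hq : c * L2sq y <= q := hc _ _ Lyw.
move: h1 h2; rewrite !ler_norml => /andP[h1 _] /andP[h2 _].
have h3 : Nl - M * b <= q by rewrite qE /M mulrDl; lra.
have h4 : M * b <= Nl / 2 + M * C * L2sq y.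
  have h : M * ((2 * (M + 1))^-1 * Nl) <= Nl / 2.
    rewrite mulrA [leRHS]mulrC ler_wpM2r// ler_pdivrMr ?mulr_gt0 ?ltr_wpDl//.
    by rewrite mulrA mulVf// mul1r lerDl.
  by rewrite /b N0E mulrDr [X in _ + X <= _]mulrA lerD2r.
have h5 : M * C * L2sq y <= M * C * (q / c).
  by rewrite ler_wpM2l ?mulr_ge0// ler_pdivlMr// mulrC.
rewrite (_ : (2 + 2 * M * C / c) * q = 2 * (q + M * C * (q / c))); last by field; rewrite lt0r_neq0.
by lra.
Qed.

Theorem operator_sup_bound : exists2 K : R, 0 <= K &
  forall y w Y W, L y w -> operator_chain l P y w Y W ->
    forall i t, (i < l)%N -> 0 <= t <= 1 -> sqmod (Y i t) <= K * re (L2dot w y).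
Proof.
have [c c0 hc] := hpos; have [K K0 hK] := energy_estimate.
have [C C0 hC] := energy_chain_interpolation hl (@ltr01 R).
exists (K + C / c); first by rewrite addr_ge0// divr_ge0// ltW.
move=> y w Y W Lyw hYW i t il t01; have [hY Y0 _ _ _] := hYW.
apply: le_trans (hC Y hY i t il t01) _; rewrite mul1r mulrDl; apply: lerD; first exact: hK Lyw hYW.
have -> : L2sq (Y 0%N) = L2sq y by apply: eq_Rintegral => x; rewrite inE => /Y0 ->.
rewrite -mulrA ler_wpM2l// ler_pdivlMl//; exact: hc.
Qed.

Theorem operator_evaluation_estimate : exists2 K : R, 0 <= K &
  forall c h, 0 <= c -> 0 < h -> c + h <= 1 ->
  exists (tau : 'I_l -> R) (wt : 'I_l -> R -> R),
    (forall i, 0 <= tau i <= 1) /\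
    forall y w, L y w -> forall t, c <= t <= c + h ->
      sqmod (y t - \sum_i (wt i t)%:C%C * y (tau i)) <= K * h ^+ (2 * l - 1) * re (L2dot w y).
Proof.
have [K K0 hK] := energy_estimate.
have ll : l = l.-1.+1 by rewrite prednK.
have := @chain_evaluation_estimate R l.-1; rewrite -ll => -[Lam Lam0 hLam].
exists (2 * Lam ^+ 2 * K); first by rewrite !mulr_ge0// sqr_ge0.
move=> c h c0 h0 ch1; have [tau [wt [tau01 hw]]] := hLam c h c0 h0 ch1.
exists tau, wt; split=> // y w Lyw t tI.
have [Y [W hYW]] := diff_operator_chain hl Lyw; have [hY Y0 _ _ _] := hYW.
have yY (s : R) : 0 <= s <= 1 -> y s = Y 0%N s by move=> s01; rewrite Y0// in_itv.
have t01 : 0 <= t <= 1.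
  by case/andP: tI => h1 h2; rewrite (le_trans c0 h1) (le_trans h2 ch1).
set E := h ^+ l.-1 * Num.sqrt h * Num.sqrt (L2sq (Y l)).
have hE : `|re (y t - \sum_i (wt i t)%:C%C * y (tau i))| <= Lam * E.
  apply: le_trans (_ : Lam * (h ^+ l.-1 * Num.sqrt h * l2norm (fun t => re (Y l t))) <= _); last first.
    rewrite ler_wpM2l// ler_wpM2l ?mulr_ge0 ?exprn_ge0 ?(ltW h0) ?sqrtr_ge0//.
    exact: l2norm_re hY.2.
  apply: le_trans (hw _ (energy_chain_re hY) t tI).
  rewrite ReB Re_sum (yY _ t01); under eq_bigr do rewrite ReM ReR ImR mul0r subr0 (yY _ (tau01 _)) mulrC.
  by [].
have hE' : `|im (y t - \sum_i (wt i t)%:C%C * y (tau i))| <= Lam * E.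
  apply: le_trans (_ : Lam * (h ^+ l.-1 * Num.sqrt h * l2norm (fun t => im (Y l t))) <= _); last first.
    rewrite ler_wpM2l// ler_wpM2l ?mulr_ge0 ?exprn_ge0 ?(ltW h0) ?sqrtr_ge0//.
    exact: l2norm_im hY.2.
  apply: le_trans (hw _ (energy_chain_im hY) t tI).
  rewrite ImB Im_sum (yY _ t01); under eq_bigr do rewrite ImM ReR ImR mul0r addr0 (yY _ (tau01 _)) mulrC.
  by [].
apply: le_trans (sqmod_le hE hE') _; rewrite exprMn mulrA -!mulrA.
rewrite ler_wpM2l// ler_wpM2l ?sqr_ge0//.
rewrite /E !exprMn !sqr_sqrtr ?(ltW h0) ?L2sq_ge0// -exprM -exprSr.
(* The exponent 2l - 1 arises here, as the square of [h ^+ l.-1 * Num.sqrt h]. *)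
have -> : (l.-1 * 2).+1 = (2 * l - 1)%N by rewrite {2}ll mulnC mulnS.
rewrite [leRHS](_ : _ = Lam * (h ^+ (2 * l - 1) * (K * re (L2dot w y)))); last by ring.
rewrite ler_wpM2l// ler_wpM2l ?exprn_ge0 ?(ltW h0)//; exact: hK Lyw hYW.
Qed.

(** The boundary term of Green's formula drops because the test function vanishes at both ends to
    order [l]. A test function is in general outside the operator domain, so its energy is
    approached through its pairing with that domain. *)
Theorem test_function_bound : exists2 K : R, 0 <= K &
  forall (phi : R -> R[i]) (Z : nat -> R -> R[i]) (b : R), energy_chain l Z ->
    (forall t : R, t \in `[0, 1] -> Z 0%N t = phi t) ->
    (forall i, (i < l)%N -> Z i 0 = 0 /\ Z i 1 = 0) -> 0 <= b ->
    (forall i t, (i < l)%N -> 0 <= t <= 1 -> sqmod (Z i t) <= b ^+ 2) ->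
    L2sq (Z l) <= b ^+ 2 ->
    forall y w, L y w -> `|re (L2dot w phi)| <= K * b * Num.sqrt (re (L2dot w y)).
Proof.
have [K1 K10 hK1] := energy_estimate; have [K2 K20 hK2] := operator_sup_bound.
exists (Num.sqrt K1 + potential_norm * Num.sqrt K2).
  by rewrite addr_ge0 ?mulr_ge0 ?sqrtr_ge0 ?potential_norm_ge0.
move=> phi Z b hZ Z0 Zbd b0 hb hbl y w Lyw.
have [Y [W hYW]] := diff_operator_chain hl Lyw; have [hY Y0 _ _ _] := hYW.
have [c c0 hc] := hpos.
set q := re (L2dot w y).
have q0 : 0 <= q.
  by apply: le_trans (hc _ _ Lyw); rewrite mulr_ge0 ?(ltW c0)//; exact: L2sq_ge0.
have -> : L2dot w phi = energy l P Y Z.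
  rewrite (green_formula hl hP hYW hZ Z0) /boundary_term big1 ?addr0// => i _.
  by have [-> ->] := Zbd i (ltn_ord i); rewrite conjc0 !mulr0 subr0 mulr0.
rewrite /energy ReD; apply: le_trans (ler_normD _ _) _.
rewrite -mulrA [(_ + _) * _]mulrDl; apply: lerD.
  have := form_re_le L2_subspace L2_semi_inner hY.2 hZ.2; rewrite (L2dotxx (Y l)) (L2dotxx (Z l)) => h.
  apply: le_trans h _; rewrite [leRHS](_ : _ = Num.sqrt K1 * Num.sqrt q * b); last by ring.
  apply: ler_pM; rewrite ?sqrtr_ge0//.
    by rewrite -sqrtrM// ler_sqrt ?mulr_ge0//; exact: hK1 Lyw hYW.
  by rewrite -(ger0_norm b0) -sqrtr_sqr ler_sqrt ?sqr_ge0.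
have ha i t : (i < l)%N -> 0 <= t <= 1 -> sqmod (Y i t) <= (Num.sqrt (K2 * q)) ^+ 2.
  by move=> il t01; rewrite sqr_sqrtr ?mulr_ge0//; exact: hK2 Lyw hYW _ _ il t01.
apply: le_trans (potential_bound hY hZ (sqrtr_ge0 _) b0 ha hb) _.
by rewrite -mulrA ler_wpM2l ?potential_norm_ge0// sqrtrM// mulrAC mulrA.
Qed.

End OperatorEstimates.

(** * The closed form *)

Section SequenceLimits.
Context {R : realType}.
Implicit Types (u v w : nat -> R).

Definition eventually_small u :=
  forall eps : R, 0 < eps -> exists K, forall k, (K <= k)%N -> u k < eps.

Definition eventually_small2 (u : nat -> nat -> R) :=
  forall eps : R, 0 < eps -> exists K, forall j k, (K <= j)%N -> (K <= k)%N -> u j k < eps.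

Lemma eventually_smallZ u v (C : R) : 0 <= C -> (forall k, v k <= C * u k) ->
  eventually_small u -> eventually_small v.
Proof.
move=> C0 uv hu eps e0; have C1 : 0 < C + 1 by rewrite ltr_wpDl.
have [K hK] := hu (eps / (C + 1)) (divr_gt0 e0 C1).
exists K => k Kk; apply: le_lt_trans (uv k) _; have := hK k Kk; rewrite ltr_pdivlMr// => h.
have [u0|u0] := leP 0 (u k).
  by rewrite mulrC; apply: le_lt_trans h; rewrite ler_wpM2l// lerDl.
by apply: le_lt_trans e0; rewrite mulr_ge0_le0// ltW.
Qed.

Lemma eventually_smallD u v w (C : R) : 0 <= C -> (forall k, w k <= C * u k + 2 * v k) ->
  eventually_small u -> eventually_small v -> eventually_small w.
Proof.
move=> C0 uvw hu hv eps e0; have e2 : 0 < eps / 2 by rewrite divr_gt0.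
have [K1 h1] := eventually_smallZ C0 (fun k => lexx (C * u k)) hu e2.
have [K2 h2] := eventually_smallZ (ler0n _ 2) (fun k => lexx (2 * v k)) hv e2.
exists (maxn K1 K2) => k; rewrite geq_max => /andP[/h1 k1 /h2 k2].
by apply: le_lt_trans (uvw k) _; lra.
Qed.

Lemma eventually_small2D (u v w : nat -> nat -> R) (C : R) : 0 <= C ->
  (forall j k, w j k <= C * u j k + 2 * v j k) ->
  eventually_small2 u -> eventually_small2 v -> eventually_small2 w.
Proof.
move=> C0 uvw hu hv eps e0.
have C1 : 0 < 2 * (C + 1) by rewrite mulr_gt0// ltr_wpDl.
have e4 : 0 < eps / 4 by rewrite divr_gt0.
have [K1 h1] := hu (eps / (2 * (C + 1))) (divr_gt0 e0 C1); have [K2 h2] := hv _ e4.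
exists (maxn K1 K2) => j k; rewrite !geq_max => /andP[j1 j2] /andP[k1 k2].
apply: le_lt_trans (uvw j k) _; have := h2 _ _ j2 k2.
have := h1 _ _ j1 k1; rewrite ltr_pdivlMr// => h h'.
have : C * u j k <= eps / 2.
  have [u0|u0] := leP 0 (u j k); last by apply: le_trans (_ : 0 <= _); [rewrite mulr_ge0_le0// ltW|rewrite divr_ge0 ?ltW].
  by move: h; rewrite mulrCA mulrDr mulr1 [C * _]mulrC; lra.
lra.
Qed.

Lemma cvg_eventually_small u (a : R) :
  u k @[k --> \oo] --> a <-> eventually_small (fun k => `|u k - a|).
Proof.
split.
  move=> /cvgrPdist_lt h eps /h[K _ hK]; exists K => k Kk.
  by rewrite distrC; exact: (hK k).
move=> h; apply/cvgrPdist_lt => eps /h[K hK]; exists K => // k /= Kk.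
by rewrite distrC; exact: hK.
Qed.

Lemma cauchy_seq_cvg u : eventually_small2 (fun j k => `|u j - u k|) ->
  exists a : R, u k @[k --> \oo] --> a.
Proof.
move=> h; have : cvg (u k @[k --> \oo]).
  apply: cauchy_cvg; apply: cauchy_exP => eps e0.
  have [K hK] := h eps e0; exists (u K); exists K => // k /= Kk.
  by rewrite /ball/=; apply: hK.
by move=> hc; exists (lim (u k @[k --> \oo])).
Qed.

Lemma cvg_seq_unique u (a b : R) : u k @[k --> \oo] --> a -> u k @[k --> \oo] --> b -> a = b.
Proof. by move=> h1 h2; rewrite -(cvg_lim _ h1)//; apply: cvg_lim. Qed.

Lemma cvg_seq_le u (a b : R) K : u k @[k --> \oo] --> a ->
  (forall k, (K <= k)%N -> u k <= b) -> a <= b.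
Proof.
move=> /cvg_eventually_small ua ub; rewrite leNgt; apply/negP => ba.
have [K' hK] := ua (a - b) (eq_ind_r is_true ba (subr_gt0 b a)).
have := hK (maxn K K') (leq_maxr _ _); have := ub (maxn K K') (leq_maxl _ _).
by rewrite ltr_norml => h /andP[h' _]; lra.
Qed.

Lemma cvg_seq_ge u (a b : R) K : u k @[k --> \oo] --> a ->
  (forall k, (K <= k)%N -> b <= u k) -> b <= a.
Proof.
move=> /cvgN ua ub; rewrite -lerN2; apply: (cvg_seq_le (K := K) ua) => k Kk.
by rewrite lerN2; exact: ub.
Qed.

Lemma eventually_small_inv : eventually_small (fun k => k.+1%:R^-1).
Proof.
move=> eps e0; exists (Num.truncn eps^-1).+1 => k hk.
rewrite invf_plt ?posrE//.
by apply: lt_le_trans (truncnS_gt _) _; rewrite ler_nat ltnW.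
Qed.

End SequenceLimits.

(** * Closure of a form represented by an operator *)

Section FormClosure.
Context {R : realType} {V : lmodType R[i]}.
Variables (D2 D0 : V -> Prop) (N A : V -> V -> R[i]).
Hypotheses (hD2 : subspace D2) (hD0 : subspace D0) (hN : semi_inner D2 N) (hA : semi_inner D0 A).
Hypothesis D02 : forall x, D0 x -> D2 x.
Hypothesis A_rep : forall y, D0 y -> exists2 w, D2 w & forall z, D0 z -> A y z = N w z.
Local Notation q x := (re (A x x)).
Local Notation nq x := (re (N x x)).

Lemma form_triangle x y : D0 x -> D0 y ->
  Num.sqrt (q (x + y)) <= Num.sqrt (q x) + Num.sqrt (q y).
Proof.
move=> Dx Dy; have h := form_re_le hD0 hA Dx Dy.
rewrite -[leRHS]ger0_norm ?addr_ge0 ?sqrtr_ge0// -sqrtr_sqr ler_sqrt ?sqr_ge0//.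
rewrite (qformD hD0 hA)// sqrrD !sqr_sqrtr ?(form_pos hA)//.
by have := le_trans (ler_norm _) h; lra.
Qed.

Lemma form_triangle_dist x y : D0 x -> D0 y ->
  `|Num.sqrt (q x) - Num.sqrt (q y)| <= Num.sqrt (q (x - y)).
Proof.
move=> Dx Dy; have h1 := form_triangle (subspaceB hD0 Dx Dy) Dy.
have h2 := form_triangle (subspaceB hD0 Dy Dx) Dx.
rewrite subrK in h1; rewrite subrK (qform_BC hD0 hA Dy Dx) in h2.
by rewrite ler_norml; apply/andP; split; lra.
Qed.

Definition approx y (ys : nat -> V) := [/\ D2 y, forall k, D0 (ys k),
  eventually_small (fun k => nq (ys k - y)) &
  eventually_small2 (fun j k => q (ys j - ys k))].

Lemma approx_cst y : D0 y -> approx y (fun=> y).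
Proof.
move=> Dy; split=> //; first exact: D02.
- by move=> eps e0; exists 0%N => k _; rewrite subrr (qform0 hD2 hN).
- by move=> eps e0; exists 0%N => j k _ _; rewrite subrr (qform0 hD0 hA).
Qed.

Lemma approx_lin (a : R[i]) y ys z zs : approx y ys -> approx z zs ->
  approx (a *: y + z) (fun k => a *: ys k + zs k).
Proof.
move=> [Dy Dys ny qy] [Dz Dzs nz qz].
have e (x x' w w' : V) : a *: x + w - (a *: x' + w') = a *: (x - x') + (w - w').
  by rewrite opprD addrACA scalerBr.
split.
- exact: hD2.2.
- by move=> k; apply: hD0.2.
- apply: (eventually_smallD (C := 2 * sqmod a) _ _ ny nz).
    by rewrite mulr_ge0// sqmod_ge0.
  move=> k; have h1 := subspaceB hD2 (D02 (Dys k)) Dy; have h2 := subspaceB hD2 (D02 (Dzs k)) Dz.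
  rewrite e; apply: le_trans (qformD2 hD2 hN (subspaceZ hD2 a h1) h2) _.
  by rewrite (qformZ hD2 hN)// mulrA.
- apply: (eventually_small2D (C := 2 * sqmod a) _ _ qy qz).
    by rewrite mulr_ge0// sqmod_ge0.
  move=> j k; have h1 := subspaceB hD0 (Dys j) (Dys k); have h2 := subspaceB hD0 (Dzs j) (Dzs k).
  rewrite e; apply: le_trans (qformD2 hD0 hA (subspaceZ hD0 a h1) h2) _.
  by rewrite (qformZ hD0 hA)// mulrA.
Qed.

Lemma approx_sub y ys z zs : approx y ys -> approx z zs ->
  approx (y - z) (fun k => ys k - zs k).
Proof.
move=> hy hz; have := approx_lin (-1) hz hy.
by rewrite scaleN1r addrC; congr approx; apply/funext => k; rewrite scaleN1r addrC.
Qed.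

Lemma approx_add y ys z zs : approx y ys -> approx z zs ->
  approx (y + z) (fun k => ys k + zs k).
Proof.
move=> hy hz; have := approx_lin 1 hy hz.
by rewrite scale1r; congr approx; apply/funext => k; rewrite scale1r.
Qed.

(* Closability: q(u_k) <= q(u_k - u_j) + 2 re A(u_k, u_j), and A(u_k, u_j) = N(w_k, u_j)
   tends to 0 as j grows. *)
Lemma closable us : approx 0 us -> eventually_small (fun k => q (us k)).
Proof.
move=> [_ Du nu qu] eps e0; have e2 : 0 < eps / 2 by rewrite divr_gt0.
have [K hK] := qu _ e2; exists K => k Kk.
have [w Dw Aw] := A_rep (Du k).
have w0 : 0 < nq w + 1 by rewrite ltr_wpDl// (form_pos hN).
have e3 : 0 < (eps / 4) ^+ 2 / (nq w + 1) by rewrite divr_gt0// exprn_gt0// divr_gt0.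
have [K' hK'] := nu _ e3; pose j := maxn K K'.
have h1 := hK k j Kk (leq_maxl _ _).
have := hK' j (leq_maxr _ _); rewrite subr0 ltr_pdivlMr// => h2.
have h3 : `|re (A (us k) (us j))| <= eps / 4.
  rewrite Aw//; apply: le_trans (form_re_le hD2 hN Dw (D02 (Du j))) _.
  rewrite -sqrtrM ?(form_pos hN)// -[leRHS]ger0_norm; last by rewrite divr_ge0// ltW.
  rewrite -sqrtr_sqr ler_sqrt ?sqr_ge0//; apply/ltW; apply: le_lt_trans h2.
  by rewrite mulrC ler_wpM2l ?lerDl// (form_pos hN)//; apply: D02.
move: h1; rewrite (qformB hD0 hA)//; have := form_pos hA (Du j).
by have := le_trans (ler_norm _) h3; lra.
Qed.

Lemma sqrt_small (u : nat -> R) : eventually_small u -> eventually_small (fun k => Num.sqrt (u k)).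
Proof.
move=> hu eps e0; have [K hK] := hu (eps ^+ 2) (exprn_gt0 _ e0); exists K => k /hK h.
by rewrite -[ltRHS]gtr0_norm// -sqrtr_sqr ltr_sqrt// exprn_gt0.
Qed.

Lemma sqrt_cvg_sq (u : nat -> R) (a : R) : (forall k, 0 <= u k) ->
  Num.sqrt (u k) @[k --> \oo] --> a -> u k @[k --> \oo] --> a ^+ 2.
Proof.
move=> u0 ua; rewrite expr2 (_ : u = fun k => Num.sqrt (u k) * Num.sqrt (u k)).
  exact: cvgM.
by apply/funext => k; rewrite -expr2 sqr_sqrtr.
Qed.

(** Along an approximating sequence the square roots of [q] are Cauchy by the triangle inequality.
    Two approximations of the same vector differ by an approximation of 0, so closability makes the
    limit independent of the choice. *)
Lemma closed_qform : exists qf : V -> R, forall y ys, approx y ys ->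
  q (ys k) @[k --> \oo] --> qf y.
Proof.
apply: (exists_choice (P := fun y a => forall ys, approx y ys -> q (ys k) @[k --> \oo] --> a)) => y.
have [[ys hys]|no] := pselect (exists ys, approx y ys); last first.
  by exists 0 => ys hys; exfalso; apply: no; exists ys.
have [_ Dys _ qys] := hys.
have [a ha] : exists a : R, Num.sqrt (q (ys k)) @[k --> \oo] --> a.
  apply: cauchy_seq_cvg => eps e0; have [K hK] := qys (eps ^+ 2) (exprn_gt0 _ e0).
  exists K => j k Kj Kk; apply: le_lt_trans (form_triangle_dist (Dys j) (Dys k)) _.
  by rewrite -[ltRHS]gtr0_norm// -sqrtr_sqr ltr_sqrt ?exprn_gt0//; exact: hK.
exists (a ^+ 2) => zs hzs; have [_ Dzs _ _] := hzs.
apply: sqrt_cvg_sq; first by move=> k; exact: (form_pos hA).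
have h0 : approx 0 (fun k => zs k - ys k) by have := approx_sub hzs hys; rewrite subrr.
have h1 := sqrt_small (closable h0).
apply/cvg_eventually_small; move/cvg_eventually_small: ha => ha.
apply: (eventually_smallD (C := 2) _ _ ha h1) => // k.
have h2 := form_triangle_dist (Dzs k) (Dys k).
rewrite (_ : _ - a = (Num.sqrt (q (zs k)) - Num.sqrt (q (ys k))) + (Num.sqrt (q (ys k)) - a)); last by ring.
apply: le_trans (ler_normD _ _) _; have := normr_ge0 (Num.sqrt (q (ys k)) - a).
have := sqrtr_ge0 (q (zs k - ys k)); lra.
Qed.

Lemma polarization x z : D0 x -> D0 z -> re (A x z) = (q (x + z) - q (x - z)) / 4.
Proof. by move=> Dx Dz; rewrite (qformD hD0 hA)// (qformB hD0 hA)//; field. Qed.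

Lemma im_polarization x z : D0 x -> D0 z -> im (A x z) = re (A x ('i%C *: z)).
Proof. by move=> Dx Dz; rewrite (formZr hD0 hA)// ReM /=; ring. Qed.

Definition ccvg (u : nat -> R[i]) (z : R[i]) :=
  re (u k) @[k --> \oo] --> re z /\ im (u k) @[k --> \oo] --> im z.

Lemma ccvg_unique u z z' : ccvg u z -> ccvg u z' -> z = z'.
Proof. by move=> [h1 h2] [h1' h2']; apply: eq_ReIm;
  [exact: cvg_seq_unique h1 h1'|exact: cvg_seq_unique h2 h2']. Qed.

Lemma ccvg_lin (a : R[i]) u v z z' : ccvg u z -> ccvg v z' ->
  ccvg (fun k => a * u k + v k) (a * z + z').
Proof.
move=> [h1 h2] [h1' h2']; split; rewrite !ReImE.
  under eq_fun do rewrite !ReImE.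
  by apply: cvgD => //; apply: cvgB; apply: cvgM => //; exact: cvg_cst.
under eq_fun do rewrite !ReImE.
by apply: cvgD => //; apply: cvgD; apply: cvgM => //; exact: cvg_cst.
Qed.

Lemma ccvgJ u z : ccvg u z -> ccvg (fun k => (u k)^*%C) z^*%C.
Proof.
move=> [h1 h2]; split; rewrite ?ReJ ?ImJ; first by under eq_fun do rewrite ReJ.
by under eq_fun do rewrite ImJ; apply: cvgN.
Qed.

Definition closed_form_spec (Qf : V -> V -> R[i]) := forall y z ys zs,
  approx y ys -> approx z zs -> ccvg (fun k => A (ys k) (zs k)) (Qf y z).

(** By polarization, the limits of the quadratic form determine those of the sesquilinear form. *)
Lemma closed_form_exists : exists Qf, closed_form_spec Qf.
Proof.
have [qf hqf] := closed_qform.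
exists (fun y z => ((qf (y + z) - qf (y - z)) / 4) +i*
  ((qf (y + 'i%C *: z) - qf (y - 'i%C *: z)) / 4))%C.
have key y z ys zs : approx y ys -> approx z zs ->
    re (A (ys k) (zs k)) @[k --> \oo] --> (qf (y + z) - qf (y - z)) / 4.
  move=> hy hz; have [_ Dy _ _] := hy; have [_ Dz _ _] := hz.
  under eq_fun do rewrite polarization//.
  apply: cvgM; last exact: cvg_cst.
  by apply: cvgB; apply: hqf; [exact: approx_add|exact: approx_sub].
move=> y z ys zs hy hz; split => /=; first exact: key.
have [_ Dy _ _] := hy; have [_ Dz _ _] := hz.
under eq_fun do rewrite im_polarization//.
apply: key => //; have := approx_lin 'i%C hz (approx_cst (subspace0 hD0)).
by rewrite addr0; congr approx; apply/funext => k; rewrite addr0.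
Qed.

Definition form_closure y := exists ys, approx y ys.

Lemma form_closure_subspace : subspace form_closure.
Proof.
split; first by exists (fun=> 0); apply: approx_cst; exact: subspace0.
by move=> a x y [xs hx] [ys hy]; exists (fun k => a *: xs k + ys k); apply: approx_lin.
Qed.

Variable Qf : V -> V -> R[i].
Hypothesis hQf : closed_form_spec Qf.

Lemma closed_form_semi_inner : semi_inner form_closure Qf.
Proof.
split.
- move=> a x y z [xs hx] [ys hy] [zs hz].
  have := ccvg_lin a (hQf hx hz) (hQf hy hz); apply: ccvg_unique.
  have := hQf (approx_lin a hx hy) hz; congr ccvg; apply/funext => k.
  have [_ Dx _ _] := hx; have [_ Dy _ _] := hy; have [_ Dz _ _] := hz.
  by rewrite (form_lin hA).
- move=> x y [xs hx] [ys hy]; have := ccvgJ (hQf hx hy); apply: ccvg_unique.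
  have := hQf hy hx; congr ccvg; apply/funext => k.
  have [_ Dx _ _] := hx; have [_ Dy _ _] := hy.
  by rewrite (form_sym hA).
- move=> x [xs hx]; have [h _] := hQf hx hx; have [_ Dx _ _] := hx.
  by apply: (cvg_seq_ge (K := 0) h) => k _; exact: (form_pos hA).
Qed.

Lemma closed_form_ext y z : D0 y -> D0 z -> Qf y z = A y z.
Proof.
move=> Dy Dz; apply: ccvg_unique (hQf (approx_cst Dy) (approx_cst Dz)) _.
by split; exact: cvg_cst.
Qed.

Lemma closed_form_approx y ys : approx y ys ->
  eventually_small (fun k => re (Qf (y - ys k) (y - ys k))).
Proof.
move=> hy eps e0; have [_ Dy _ qy] := hy; have e2 : 0 < eps / 2 by rewrite divr_gt0.
have [K hK] := qy _ e2; exists K => k Kk.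
have h := approx_sub hy (approx_cst (Dy k)).
apply: le_lt_trans (_ : eps / 2 < eps); last by lra.
apply: (cvg_seq_le (K := K) (hQf h h).1) => j Kj.
by apply: ltW; exact: hK.
Qed.

End FormClosure.

(** * Continuous representatives and uniform limits *)

Section FormDomain.
Context {R : realType}.
Local Notation I01 := (`[0 : R, 1 : R]%classic : set (measurableTypeR R)).
Local Notation cont f := {within `[(0 : R), 1], continuous (f : R -> R)}.

Lemma cont_ae_eq0 (f : R -> R) : cont f -> {ae leb R, forall t : R, t \in `[0, 1] -> f t = 0} ->
  forall t : R, t \in `[0, 1] -> f t = 0.
Proof.
move=> cf aef t t01; apply/eqP/negPn/negP => ft0.
have e0 : 0 < `|f t| by rewrite normr_gt0.
have [eta eta0 heta] : exists2 eta : R, 0 < eta & forall s : R, s \in `[0, 1] -> `|t - s| < eta -> f s != 0.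
  move: cf => /subspace_continuousP /(_ t t01) /cvgrPdist_lt /(_ _ e0).
  move=> /nbhs_ballP [eta /= eta0 h]; exists eta => // s s01 st.
  by apply/eqP => fs0; have := h s st s01; rewrite /from_subspace/= fs0 subr0 ltxx.
move: t01; rewrite in_itv/= => /andP[t0 t1].
pose a := Num.max 0 (t - eta / 2); pose b := Num.min 1 (t + eta / 2).
have e2 : 0 < eta / 2 by rewrite divr_gt0.
have ab : a < b by rewrite gt_max !lt_min; apply/andP; split; apply/andP; split; lra.
have [Z [mZ Z0 hZ]] := aef.
have sub : `]a, b[%classic `<=` Z.
  move=> s /=; rewrite in_itv/= gt_max lt_min => /andP[/andP[s0 s2] /andP[s1 s3]].
  apply: hZ => /= h; have s01 : s \in `[0, 1] by rewrite in_itv/= !ltW.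
  move: (h s01); apply/eqP; apply: heta => //; rewrite ltr_norml; apply/andP; split; lra.
have : (leb R `]a, b[%classic <= 0)%E.
  rewrite -Z0; exact: (le_measure (leb R) (mem_set (measurable_itv `]a, b[)) (mem_set mZ) sub).
by rewrite lebesgue_measure_itv/= lte_fin ab -EFinB lee_fin leNgt subr_gt0 ab.
Qed.

Lemma ccont_ae_eq (u v : R -> R[i]) : ccont u -> ccont v -> ae_eq01 u v ->
  forall t : R, t \in `[0, 1] -> u t = v t.
Proof.
move=> [u1 u2] [v1 v2] uv t t01; apply: eq_ReIm; apply/eqP; rewrite -subr_eq0; apply/eqP.
  apply: (cont_ae_eq0 (contB u1 v1)) t01; apply: leb_aeS uv => s h s01.
  by rewrite h// subrr.
apply: (cont_ae_eq0 (contB u2 v2)) t01; apply: leb_aeS uv => s h s01.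
by rewrite h// subrr.
Qed.

Lemma L2sq_eq0 (u : R -> R[i]) : in_L2 u -> L2sq u = 0 -> ae_eq01 u (fun=> 0).
Proof.
move=> [u1 u2 u3] u0; have mI : measurable I01 by exact: measurable_itv.
have mu : measurable_fun I01 (EFin \o (fun t => sqmod (u t))) by case/integrableP: u3.
have h0 : (\int[leb R]_(x in I01) `|(EFin \o (fun t => sqmod (u t))) x|)%E = (L2sq u)%:E.
  rewrite /L2sq Rintegral_EFin//; apply: eq_integral => x _.
  by rewrite /= ger0_norm// sqmod_ge0.
rewrite u0 in h0; have := (ae_eq_integral_abs (leb R) mI mu).1 h0.
apply: leb_aeS => t h t01; apply: sqmod_eq0; apply: EFin_inj; exact: h.
Qed.

Definition uniformly_cauchy (v : nat -> R -> R[i]) := forall eps : R, 0 < eps ->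
  exists K, forall j k, (K <= j)%N -> (K <= k)%N -> forall t, 0 <= t <= 1 -> sqmod (v j t - v k t) < eps.

Lemma uniformly_cauchy_limit (v : nat -> R -> R[i]) : uniformly_cauchy v ->
  exists g : R -> R[i], forall eps : R, 0 < eps -> exists K, forall k, (K <= k)%N ->
    forall t, 0 <= t <= 1 -> sqmod (v k t - g t) < eps.
Proof.
move=> vc.
have part (p : R[i] -> R) : (forall a b, p (a - b) = p a - p b) -> (forall a, p a ^+ 2 <= sqmod a) ->
    forall t, exists a : R, 0 <= t <= 1 -> p (v k t) @[k --> \oo] --> a.
  move=> pB p2 t; have [t01|nt] := boolP (0 <= t <= 1); last by exists 0.
  have [a ha] : exists a : R, p (v k t) @[k --> \oo] --> a; last by exists a.
  apply: cauchy_seq_cvg => eps e0; have [K hK] := vc _ (exprn_gt0 2 e0).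
  exists K => j k Kj Kk; rewrite -pB -[ltRHS]gtr0_norm// -ltr_sqr ?nnegrE// !real_normK ?num_real//.
  exact: le_lt_trans (p2 _) (hK j k Kj Kk t t01).
have [g1 hg1] := exists_choice (part _ (@ReB R) (@Re_sqmod R)).
have [g2 hg2] := exists_choice (part _ (@ImB R) (@Im_sqmod R)).
exists (fun t => (g1 t +i* g2 t)%C) => eps e0; have [K hK] := vc _ (divr_gt0 e0 (ltr0Sn _ 1)).
exists K => k Kk t t01; apply: le_lt_trans (_ : eps / 2 < eps); last by rewrite ltr_pdivrMr// mulr_natr mulr2n ltrDl.
have lim : (fun j => sqmod (v k t - v j t)) @ \oo --> sqmod (v k t - (g1 t +i* g2 t)%C).
  rewrite /sqmod; under eq_fun do rewrite ReB ImB.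
  rewrite ReB ImB /= !expr2; apply: cvgD; apply: cvgM; apply: cvgB; do ?[exact: cvg_cst|exact: hg1|exact: hg2].
apply: (cvg_seq_le (K := K) lim) => j Kj; apply: ltW; exact: hK.
Qed.

Lemma cont_uniform_limit (v : nat -> R -> R) (g : R -> R) : (forall k, cont (v k)) ->
  (forall eps : R, 0 < eps -> exists k, forall t, 0 <= t <= 1 -> `|v k t - g t| < eps) -> cont g.
Proof.
move=> cv vg; apply: cont_eps => t eps t01 e0; have e3 : 0 < eps / 3 by rewrite divr_gt0.
have [k hk] := vg _ e3; have t01' : t \in `[0, 1] by rewrite in_itv.
have := cv k; move=> /subspace_continuousP /(_ t t01') /cvgrPdist_lt /(_ _ e3).
move=> /nbhs_ballP [eta /= eta0 h]; exists eta => // s s01 st.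
have s01' : s \in `[0, 1] by rewrite in_itv.
have h1 := hk _ s01; have h2 := hk _ t01.
have h3 : `|v k t - v k s| < eps / 3.
  by apply: (h s _ s01'); rewrite /ball/= distrC.
move: h1 h2 h3; rewrite !ltr_norml => /andP[? ?] /andP[? ?] /andP[? ?].
by apply/andP; split; lra.
Qed.

Lemma ccont_uniform_limit (v : nat -> R -> R[i]) (g : R -> R[i]) : (forall k, ccont (v k)) ->
  (forall eps : R, 0 < eps -> exists K, forall k, (K <= k)%N ->
    forall t, 0 <= t <= 1 -> sqmod (v k t - g t) < eps) -> ccont g.
Proof.
move=> cv vg; have part (p : R[i] -> R) : (forall a b, p (a - b) = p a - p b) ->
    (forall a, p a ^+ 2 <= sqmod a) -> forall eps : R, 0 < eps -> exists k, forall t, 0 <= t <= 1 ->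
    `|p (v k t) - p (g t)| < eps.
  move=> pB p2 eps e0; have [K hK] := vg _ (exprn_gt0 2 e0); exists K => t t01.
  rewrite -pB -[ltRHS]gtr0_norm// -ltr_sqr ?nnegrE// !real_normK ?num_real//.
  exact: le_lt_trans (p2 _) (hK K (leqnn _) t t01).
split.
  by apply: (cont_uniform_limit (fun k => (cv k).1)); apply: part; [exact: ReB|exact: Re_sqmod].
by apply: (cont_uniform_limit (fun k => (cv k).2)); apply: part; [exact: ImB|exact: Im_sqmod].
Qed.

Lemma L2sq_le_sup (u : R -> R[i]) (b : R) : in_L2 u -> (forall t, 0 <= t <= 1 -> sqmod (u t) <= b) ->
  L2sq u <= b.
Proof.
move=> [_ _ ui] ub; have mI : measurable I01 by exact: measurable_itv.
have -> : b = \int[leb R]_(t in I01) b.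
  by rewrite Rintegral_cst_itv ?ler01// subr0 mulr1.
apply: (le_Rintegral mI) => //.
exact: cst_rint.
Qed.

Lemma sobolev_chain_lin l (a : R[i]) y Y z Z : sobolev_chain l y Y -> sobolev_chain l z Z ->
  sobolev_chain l (a *: y + z) (fun i t => a * Y i t + Z i t).
Proof.
move=> [Y0 hY Yl] [Z0 hZ Zl]; split.
- by move=> t t01; rewrite Y0// Z0.
- by move=> i il; apply: ac_derivative_lin; [exact: hY|exact: hZ].
- by have := L2_subspace.2 a _ _ Yl Zl.
Qed.

Lemma sobolev_chain_cont l (y : R -> R[i]) Y : (0 < l)%N -> sobolev_chain l y Y -> ccont y.
Proof.
move=> l0 [Y0 hY Yl]; apply: (ccont_eq01 (u := Y 0%N)) => //.
exact: ac_derivative_cont (hY _ l0).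
Qed.

Lemma L2sq_ae (u v : R -> R[i]) : in_L2 u -> in_L2 v -> ae_eq01 u v -> L2sq u = L2sq v.
Proof.
move=> [_ _ ui] [_ _ vi] uv; have mI : measurable I01 by exact: measurable_itv.
congr fine; apply: ae_eq_integral => //.
- by case/integrableP: ui.
- by case/integrableP: vi.
- by apply: leb_aeS uv => t h t01 /=; rewrite h.
Qed.

Lemma sobolev_chain_L2 l (y : R -> R[i]) Y : (0 < l)%N -> sobolev_chain l y Y -> in_L2 y.
Proof.
by move=> l0 /(sobolev_chain_cont l0) cy; apply: (@ccont_sq_integrable _ (leb R)) => //; exact: leb01_fin.
Qed.

End FormDomain.

(** * The form of the differential operator *)

Section OperatorForm.
Context {R : realType}.
Local Notation I01 := (`[0 : R, 1 : R]%classic : set (measurableTypeR R)).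
Variables (l : nat) (P : nat -> R -> R).
Hypothesis hl : (0 < l)%N.
Hypothesis hP : forall i, (i < l)%N -> (leb R).-integrable `[0, 1] (EFin \o P i).
Variables (r : nat) (B : 'M[R[i]]_((l + l) + (l + l), r)).
Local Notation L := (diff_operator P B).
Hypothesis hsa : self_adjoint L.
Hypothesis hpos : positive_definite L.
Hypothesis hdom : form_domain_between l L.

Lemma boundary_values_lin (a : R[i]) (Y W Z V : nat -> R -> R[i]) :
  boundary_values l (fun i t => a * Y i t + Z i t) (fun i t => a * W i t + V i t) =
  a *: boundary_values l Y W + boundary_values l Z V.
Proof.
rewrite /boundary_values !scale_row_mx !add_row_mx.
by congr (row_mx (row_mx _ _) (row_mx _ _)); apply/rowP => i; rewrite !mxE.
Qed.

Lemma operator_lin (a : R[i]) y w z v : L y w -> L z v -> L (a *: y + z) (a *: w + v).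
Proof.
move=> [y2 w2 [Y [W [[hY hW0 hW] Y0 Wl bY]]]] [z2 v2 [Z [V [[hZ hV0 hV] Z0 Vl bZ]]]].
split; [exact: L2_subspace.2|exact: L2_subspace.2|].
exists (fun i t => a * Y i t + Z i t), (fun i t => a * W i t + V i t); split.
- split.
  + by move=> i il; apply: ac_derivative_lin; [exact: hY|exact: hZ].
  + by move=> t tI; rewrite hW0// hV0//; ring.
  + move=> k kl; have := ac_derivative_lin a (hW k kl) (hV k kl).
    by congr ac_derivative; apply/funext => t; ring.
- by move=> t tI; rewrite Y0// Z0.
- by apply: leb_aeS2 Wl Vl => t h1 h2 t01; rewrite h1// h2.
- by rewrite boundary_values_lin mulmxDl -scalemxAl bY bZ scaler0 addr0.
Qed.

Lemma operator0 : L 0 0.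
Proof.
split; [exact: L2_subspace.1|exact: L2_subspace.1|].
have ac0 : ac_derivative (fun=> 0 : R[i]) (fun=> 0).
  apply/ac_derivativeP; have h : real_ac_derivative (fun=> 0 : R) (fun=> 0).
    split; first by apply: (lipschitz_ac (K := 0)) => s t _ _; rewrite subrr normr0 mul0r.
    by apply: aeW => t _; exact: is_derive_cst.
  by split.
exists (fun _ _ => 0), (fun _ _ => 0); split.
- split=> //; first by move=> t _; rewrite mulr0.
  by move=> k _; move: ac0; congr ac_derivative; apply/funext => t; rewrite mulr0 subr0.
- by [].
- by apply: aeW.
- rewrite (_ : boundary_values _ _ _ = 0) ?mul0mx//.
  rewrite /boundary_values -[RHS](@row_mx0 _ 1 (l + l) (l + l)) -(@row_mx0 _ 1 l l).
  by congr (row_mx (row_mx _ _) (row_mx _ _)); apply/rowP => i; rewrite !mxE.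
Qed.

Definition operator_domain (y : R -> R[i]) := exists w, L y w.

Lemma operator_domain_subspace : subspace operator_domain.
Proof.
split; first by exists 0; exact: operator0.
by move=> a x y [w hw] [v hv]; exists (a *: w + v); apply: operator_lin.
Qed.

Lemma operator_domain_L2 y : operator_domain y -> in_L2 y.
Proof. by move=> [w /operator_in_L2[]]. Qed.

(** The graph may relate [y] to several functions [w]. One of them is chosen, and symmetry shows
    that [L2dot w z] does not depend on the choice when [z] lies in the domain. *)
Lemma operator_form_exists : exists A : (R -> R[i]) -> (R -> R[i]) -> R[i],
  (forall y w z, L y w -> operator_domain z -> A y z = L2dot w z) /\
  semi_inner operator_domain A.
Proof.
have [Lop hLop] : exists Lop : (R -> R[i]) -> (R -> R[i]),
    forall y, operator_domain y -> L y (Lop y).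
  apply: (exists_choice (P := fun y w => operator_domain y -> L y w)) => y.
  by have [[w hw]|h] := pselect (operator_domain y); [exists w|exists 0].
have hA y w z : L y w -> operator_domain z -> L2dot (Lop y) z = L2dot w z.
  move=> Lyw [v Lzv]; have Ly : L y (Lop y) by apply: hLop; exists w.
  by rewrite (operator_symmetric hsa Ly Lzv) (operator_symmetric hsa Lyw Lzv).
exists (fun y z => L2dot (Lop y) z); split=> //; split.
- move=> a x y z [w hw] [v hv] Dz.
  rewrite (hA _ _ _ (operator_lin a hw hv) Dz) (hA _ _ _ hw Dz) (hA _ _ _ hv Dz).
  by rewrite (form_lin L2_semi_inner)//; [exact: (operator_in_L2 hw).2|exact: (operator_in_L2 hv).2|exact: operator_domain_L2].
- move=> x y Dx Dy; have [w hw] := Dx; have [v hv] := Dy.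
  rewrite (hA _ _ _ hv Dx) (hA _ _ _ hw Dy) (operator_symmetric hsa hw hv).
  by rewrite (form_sym L2_semi_inner)//; [exact: operator_domain_L2|exact: (operator_in_L2 hv).2].
- move=> x Dx; have [w hw] := Dx; rewrite (hA _ _ _ hw Dx).
  have [c c0 hc] := hpos; apply: le_trans (hc _ _ hw).
  by rewrite mulr_ge0 ?L2sq_ge0// ltW.
Qed.

Section WithForm.
Variable A : (R -> R[i]) -> (R -> R[i]) -> R[i].
Hypothesis A_op : forall y w z, L y w -> operator_domain z -> A y z = L2dot w z.
Hypothesis hA : semi_inner operator_domain A.
Local Notation D2 := (in_L2 : (R -> R[i]) -> Prop).
Local Notation N := (@L2dot R).

Lemma operator_form_rep y : operator_domain y ->
  exists2 w, in_L2 w & forall z, operator_domain z -> A y z = L2dot w z.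
Proof.
by move=> [w hw]; exists w; [exact: (operator_in_L2 hw).2|move=> z Dz; exact: A_op].
Qed.

Lemma operator_sub y w z v : L y w -> L z v -> L (y - z) (w - v).
Proof.
move=> hy hz; have := operator_lin (-1) hz hy.
by rewrite !scaleN1r ![- _ + _]addrC.
Qed.

Lemma form_approxP y ys ws : in_L2 y -> form_approx L y ys ws <->
  (forall k, L (ys k) (ws k)) /\ approx D2 operator_domain N A y ys.
Proof.
move=> yL.
have qE j k : (forall k, L (ys k) (ws k)) ->
    re (L2dot (ws j \- ws k) (ys j \- ys k)) = re (A (ys j - ys k) (ys j - ys k)).
  move=> hL; have h := operator_sub (hL j) (hL k).
  by rewrite (A_op h)//; exists (ws j - ws k).
have nE k : L2sqnorm (ys k \- y) = re (L2dot (ys k - y) (ys k - y)).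
  by rewrite L2dotxx.
split=> [[hL h1 h2]|[hL [_ Dys h1 h2]]].
  split=> //; split=> //.
  - by move=> k; exists (ws k).
  - move/cvg_eventually_small: h1 => h1 eps e0; have [K hK] := h1 eps e0; exists K => k Kk.
    by have := hK k Kk; rewrite subr0 nE; apply: le_lt_trans; exact: ler_norm.
  - move=> eps e0; have [K hK] := h2 eps e0; exists K => j k Kj Kk.
    by rewrite -qE//; exact: hK.
split=> //.
  apply/cvg_eventually_small => eps e0; have [K hK] := h1 eps e0; exists K => k Kk.
  by have := hK k Kk; rewrite subr0 nE ger0_norm// -nE; exact: L2sq_ge0.
move=> eps e0; have [K hK] := h2 eps e0; exists K => j k Kj Kk.
by rewrite qE//; exact: hK.
Qed.

Lemma approx_images y ys : approx D2 operator_domain N A y ys ->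
  exists ws, form_approx L y ys ws.
Proof.
move=> h; have [yL Dys _ _] := h; have [ws hws] := exists_choice Dys.
by exists ws; apply/form_approxP.
Qed.

Lemma in_form_closureP y : in_form_closure L y <-> form_closure D2 operator_domain N A y.
Proof.
split=> [[yL [ys [ws h]]]|[ys h]]; first by exists ys; have [_] := (form_approxP ys ws yL).1 h.
have [ws hws] := approx_images h; split; last by exists ys, ws.
by case: h.
Qed.

Lemma qform_closed : closed_form_spec D2 operator_domain N A (qform L).
Proof.
have [Qf hQf] := closed_form_exists L2_subspace operator_domain_subspace L2_semi_inner hA
  operator_domain_L2 operator_form_rep.
have val y z ys ws zs vs : in_L2 y -> in_L2 z -> form_approx L y ys ws -> form_approx L z zs vs ->
    ccvg (fun k => L2dot (ws k) (zs k)) (Qf y z).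
  move=> yL zL hy hz; have [hL1 a1] := (form_approxP ys ws yL).1 hy.
  have [hL2 a2] := (form_approxP zs vs zL).1 hz.
  have := hQf _ _ _ _ a1 a2; congr ccvg; apply/funext => k.
  by rewrite (A_op (hL1 k))//; exists (vs k).
move=> y z ys zs hy hz; suff -> : qform L y z = Qf y z by exact: hQf.
have [yL _ _ _] := hy; have [zL _ _ _] := hz.
have [ws hws] := approx_images hy; have [vs hvs] := approx_images hz.
(* The default value 0 of [xget] does not occur: on approximable vectors a form value exists, and
   any two of them agree as limits. *)
rewrite /qform; case: xgetP => [q _ [ys' [ws' [zs' [vs' [h1 h2 h3 h4]]]]]|none].
  by apply: ccvg_unique (val _ _ _ _ _ _ yL zL h1 h2).
exfalso; apply: (none (Qf y z)); exists ys, ws, zs, vs; split=> //.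
  by have [] := val _ _ _ _ _ _ yL zL hws hvs.
by have [] := val _ _ _ _ _ _ yL zL hws hvs.
Qed.

End WithForm.
End OperatorForm.

Section ComplexLimits.
Context {R : realType}.

Lemma cvg_seq_le2 (u v : nat -> R) (a b : R) : u k @[k --> \oo] --> a -> v k @[k --> \oo] --> b ->
  (forall k, u k <= v k) -> a <= b.
Proof.
move=> ua vb uv; rewrite -subr_ge0; apply: (cvg_seq_ge (K := 0) (cvgB vb ua)) => k _.
by rewrite subr_ge0.
Qed.

Lemma small_ccvg (u : nat -> R[i]) z : eventually_small (fun k => sqmod (u k - z)) -> ccvg u z.
Proof.
move=> h; have part (p : R[i] -> R) : (forall a b, p (a - b) = p a - p b) ->
    (forall a, p a ^+ 2 <= sqmod a) -> p (u k) @[k --> \oo] --> p z.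
  move=> pB p2; apply/cvg_eventually_small => eps e0; have [K hK] := h _ (exprn_gt0 2 e0).
  exists K => k Kk; rewrite -pB -[ltRHS]gtr0_norm// -ltr_sqr ?nnegrE// !real_normK ?num_real//.
  exact: le_lt_trans (p2 _) (hK k Kk).
by split; apply: part; [exact: ReB|exact: Re_sqmod|exact: ImB|exact: Im_sqmod].
Qed.

Lemma ccvg_sqmod (u : nat -> R[i]) z : ccvg u z -> sqmod (u k) @[k --> \oo] --> sqmod z.
Proof. by move=> [h1 h2]; rewrite /sqmod !expr2; apply: cvgD; apply: cvgM. Qed.

Lemma ccvg_cst (z : R[i]) : ccvg (fun=> z) z.
Proof. by split; exact: cvg_cst. Qed.

Lemma ccvg_comb (I : Type) (s : seq I) (c : I -> R[i]) (u : I -> nat -> R[i]) z :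
  (forall i, ccvg (u i) (z i)) ->
  ccvg (fun n => \sum_(i <- s) c i * u i n) (\sum_(i <- s) c i * z i).
Proof.
move=> uz; elim: s => [|i s IH].
  by rewrite big_nil; under eq_fun do rewrite big_nil; exact: ccvg_cst.
by rewrite big_cons; under eq_fun do rewrite big_cons; exact: ccvg_lin.
Qed.

End ComplexLimits.

Section FormLimits.
Context {R : realType} {V : lmodType R[i]}.
Variables (D : V -> Prop) (Q : V -> V -> R[i]).
Hypotheses (hD : subspace D) (hQ : semi_inner D Q).
Local Notation q x := (re (Q x x)).

Lemma form_cvg y ys : D y -> (forall k, D (ys k)) -> eventually_small (fun k => q (y - ys k)) ->
  forall z, D z -> ccvg (fun k => Q (ys k) z) (Q y z).
Proof.
move=> Dy Dys h z Dz; apply: small_ccvg.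
apply: (eventually_smallZ (C := q z) _ _ h); first exact: (form_pos hQ).
move=> k; rewrite -sqmodN opprB -(formBl hQ)// mulrC.
apply: (form_cauchy_schwarz hD hQ) => //; exact: (subspaceB hD).
Qed.

Lemma qform_cvg y ys : D y -> (forall k, D (ys k)) -> eventually_small (fun k => q (y - ys k)) ->
  q (ys k) @[k --> \oo] --> q y.
Proof.
move=> Dy Dys h; have [h1 _] := form_cvg Dy Dys h Dy.
have -> : (fun k => q (ys k)) = fun k => q (y - ys k) + 2 * re (Q (ys k) y) - q y.
  by apply/funext => k; rewrite (qformB hD hQ)// (form_re_sym hQ (Dys k) Dy); ring.
rewrite -[X in _ --> X](_ : 0 + 2 * q y - q y = _); last by ring.
apply: cvgB; last exact: cvg_cst.
apply: cvgD; last by apply: cvgM => //; exact: cvg_cst.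
apply/cvg_eventually_small => eps e0; have [K hK] := h _ e0; exists K => k Kk.
rewrite subr0 ger0_norm; first exact: hK.
by apply: (form_pos hQ); exact: (subspaceB hD).
Qed.

Lemma perturbed_cauchy u v : (forall k, D (u k)) -> (forall k, D (v k)) ->
  eventually_small2 (fun j k => q (u j - u k)) -> eventually_small (fun k => q (u k - v k)) ->
  eventually_small2 (fun j k => q (v j - v k)).
Proof.
move=> Du Dv cau small.
have s2 : eventually_small2 (fun j k => 2 * q (u j - v j) + 2 * q (u k - v k)).
  move=> eps e0; have e4 : 0 < eps / 4 by rewrite divr_gt0.
  have [K hK] := small _ e4; exists K => j k Kj Kk.
  by move: (hK j Kj) (hK k Kk); move: (q _) (q _) => a b ha hb; lra.
apply: (eventually_small2D (C := 2) _ _ cau s2) => // j k.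
have h1 := subspaceB hD (Du j) (Du k).
have h2 := subspaceB hD (Du j) (Dv j); have h3 := subspaceB hD (Du k) (Dv k).
have -> : v j - v k = (u j - u k) - ((u j - v j) - (u k - v k)).
  rewrite (_ : u j - v j - (u k - v k) = (u j - u k) - (v j - v k)); first by rewrite opprB [RHS]addrC subrK.
  by rewrite !opprD !opprK addrACA.
apply: le_trans (qformB2 hD hQ h1 (subspaceB hD h2 h3)) _.
by rewrite lerD2l// ler_pM2l//; exact: (qformB2 hD hQ h2 h3).
Qed.

Lemma perturbed_limit y u v : D y -> (forall k, D (u k)) -> (forall k, D (v k)) ->
  eventually_small (fun k => q (y - v k)) -> eventually_small (fun k => q (u k - v k)) ->
  eventually_small (fun k => q (y - u k)).
Proof.
move=> Dy Du Dv h1 h2; apply: (eventually_smallD (C := 2) _ _ h1 h2) => // k.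
have -> : y - u k = (y - v k) - (u k - v k) by rewrite opprB addrA subrK.
exact: (qformB2 hD hQ (subspaceB hD Dy (Dv k)) (subspaceB hD (Du k) (Dv k))).
Qed.

End FormLimits.

(** * Passage from the operator domain to the form domain *)

Section FormDomainEstimates.
#[local] Opaque qform.
Context {R : realType}.
Local Notation I01 := (`[0 : R, 1 : R]%classic : set (measurableTypeR R)).
Variables (l : nat) (P : nat -> R -> R).
Hypothesis hl : (0 < l)%N.
Hypothesis hP : forall i, (i < l)%N -> (leb R).-integrable `[0, 1] (EFin \o P i).
Variables (r : nat) (B : 'M[R[i]]_((l + l) + (l + l), r)).
Local Notation L := (diff_operator P B).
Hypothesis hsa : self_adjoint L.
Hypothesis hpos : positive_definite L.
Hypothesis hdom : form_domain_between l L.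
Local Notation Dom := (operator_domain P B).
Local Notation FD := (form_domain l L).
Local Notation Q := (qform L).
Local Notation q y := (re (Q y y)).
Local Notation D2 := (in_L2 : (R -> R[i]) -> Prop).
Local Notation N := (@L2dot R).

Lemma form_domain_cont y : FD y -> ccont y.
Proof. by move=> [[Y hY] _]; exact: sobolev_chain_cont hY. Qed.

Lemma form_domain_L2 y : FD y -> in_L2 y.
Proof. by case=> _ []. Qed.

Lemma form_domain_subspace : subspace FD.
Proof.
have [A [A_op hA]] := operator_form_exists hsa hpos.
have [h0 hlin] := form_closure_subspace L2_subspace (@operator_domain_subspace _ l P r B) L2_semi_inner
  hA (@operator_domain_L2 _ l P r B).
split.
  split; last by apply/(in_form_closureP A_op).
  have [w hw] := subspace0 (@operator_domain_subspace _ l P r B).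
  by have [Y [W [[h1 h2] h3 _ _ _]]] := diff_operator_chain hl hw; exists Y.
move=> a x y [[X hX] xc] [[Y hY] yc]; split.
  by exists (fun i t => a * X i t + Y i t); exact: sobolev_chain_lin.
by apply/(in_form_closureP A_op); apply: hlin; apply/(in_form_closureP A_op).
Qed.

Lemma qform_semi_inner : semi_inner FD Q.
Proof.
have [A [A_op hA]] := operator_form_exists hsa hpos.
have hQ := qform_closed A_op hA.
have [h1 h2 h3] := closed_form_semi_inner L2_subspace (@operator_domain_subspace _ l P r B) L2_semi_inner
  hA (@operator_domain_L2 _ l P r B) hQ.
have cl y : FD y -> form_closure D2 Dom N A y by move=> [_ /(in_form_closureP A_op)].
by split; [move=> a x y z /cl Dx /cl Dy /cl Dz; exact: h1|move=> x y /cl Dx /cl Dy; exact: h2|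
  move=> x /cl Dx; exact: h3].
Qed.

Lemma operator_domain_form_domain y : Dom y -> FD y.
Proof.
move=> Dy; have [A [A_op hA]] := operator_form_exists hsa hpos; split.
  have [w hw] := Dy.
  by have [Y [W [[h1 h2] h3 _ _ _]]] := diff_operator_chain hl hw; exists Y.
apply/(in_form_closureP A_op); exists (fun=> y).
by apply: (approx_cst L2_subspace (@operator_domain_subspace _ l P r B) L2_semi_inner
  hA (@operator_domain_L2 _ l P r B)).
Qed.

Lemma qform_operator y w z : L y w -> Dom z -> Q y z = L2dot w z.
Proof.
move=> hw Dz; have [A [A_op hA]] := operator_form_exists hsa hpos.
have hQ := qform_closed A_op hA.
rewrite -(A_op _ _ _ hw Dz); apply: (closed_form_ext L2_subspace (@operator_domain_subspace _ l P r B)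
  L2_semi_inner hA (@operator_domain_L2 _ l P r B) hQ) => //.
by exists w.
Qed.

Lemma operator_domain_sup_bound : exists2 K : R, 0 <= K &
  forall y, Dom y -> forall t, 0 <= t <= 1 -> sqmod (y t) <= K * q y.
Proof.
have [K K0 hK] := operator_sup_bound hl hP hsa hpos.
exists K => // y Dy t t01; have [w hw] := Dy.
have [Y [W hYW]] := diff_operator_chain hl hw.
rewrite (qform_operator hw Dy).
have -> : y t = Y 0%N t by have [_ h _ _ _] := hYW; rewrite h// in_itv.
exact: hK hw hYW 0%N t hl t01.
Qed.

(** The sup bound makes an approximating sequence uniformly Cauchy. Its uniform limit is continuous
    and equals [y] in L2, hence at every point of [0,1] as [y] is continuous there. Pointwise
    convergence is what transfers evaluation estimates to the form domain. *)
Lemma form_domain_approx y : FD y -> exists ys, [/\ forall k, Dom (ys k),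
  eventually_small (fun k => q (y - ys k)),
  eventually_small (fun k => L2sq (ys k - y)) &
  forall t, 0 <= t <= 1 -> ccvg (fun k => ys k t) (y t)].
Proof.
move=> Dy; have [A [A_op hA]] := operator_form_exists hsa hpos.
have hQ := qform_closed A_op hA.
have [ys hys] := (in_form_closureP A_op y).1 Dy.2; have [yL Dys l2 qc] := hys.
have QA x z : Dom x -> Dom z -> Q x z = A x z.
  exact: (closed_form_ext L2_subspace (@operator_domain_subspace _ l P r B)
  L2_semi_inner hA (@operator_domain_L2 _ l P r B) hQ).
have l2' : eventually_small (fun k => L2sq (ys k - y)).
  by move=> eps /l2[K hK]; exists K => k /hK; rewrite L2dotxx.
exists ys; split=> //.
  exact: (closed_form_approx L2_subspace (@operator_domain_subspace _ l P r B)
  L2_semi_inner hA (@operator_domain_L2 _ l P r B) hQ hys).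
have [K K0 hK] := operator_domain_sup_bound.
have uc : uniformly_cauchy ys.
  have h : eventually_small2 (fun j k => K * q (ys j - ys k)).
    move=> eps e0; have K1 : 0 < K + 1 by rewrite ltr_wpDl.
    have [K' hK'] := qc _ (divr_gt0 e0 K1); exists K' => j k Kj Kk.
    have Djk := subspaceB (@operator_domain_subspace _ l P r B) (Dys j) (Dys k).
    have := hK' j k Kj Kk; rewrite QA// ltr_pdivlMr//; apply: le_lt_trans.
    by rewrite mulrC ler_wpM2l// ?lerDl// (form_pos hA).
  move=> eps e0; have [K' hK'] := h _ e0; exists K' => j k Kj Kk t t01.
  apply: le_lt_trans (hK' j k Kj Kk).
  by apply: (hK (ys j - ys k)) => //; apply: subspaceB => //; exact: operator_domain_subspace.
have [g hg] := uniformly_cauchy_limit uc.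
have cys k : ccont (ys k) by apply: form_domain_cont; exact: operator_domain_form_domain.
have cg : ccont g := ccont_uniform_limit cys hg.
have gL : in_L2 g by apply: (@ccont_sq_integrable _ (leb R)) => //; exact: leb01_fin.
have cy := form_domain_cont Dy.
have gy : L2sq (g - y) = 0.
  apply/eqP; rewrite eq_le L2sq_ge0 andbT leNgt; apply/negP => e0.
  have e4 : 0 < L2sq (g - y) / 4 by rewrite divr_gt0.
  have [K1 h1] := l2' _ e4; have [K2 h2] := hg _ e4.
  have := h1 _ (leq_maxl K1 K2).
  have := h2 _ (leq_maxr K1 K2); set k := maxn K1 K2 => h3 h4.
  have ykL := operator_domain_L2 (Dys k).
  have h5 : L2sq (ys k - g) <= L2sq (g - y) / 4.
    apply: L2sq_le_sup; first by apply: subspaceB => //; exact: L2_subspace.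
    by move=> t t01; apply: ltW; exact: h3.
  have := qformB2 L2_subspace L2_semi_inner (subspaceB L2_subspace ykL yL)
    (subspaceB L2_subspace ykL gL).
  rewrite !L2dotxx (_ : ys k - y - (ys k - g) = g - y); last first.
    by rewrite opprB addrC addrA subrK.
  by move: (L2sq _) (L2sq _) (L2sq _) h4 h5 e0 => a b c h4 h5 e0; lra.
have eq01 : forall t : R, t \in `[0, 1] -> g t = y t.
  apply: ccont_ae_eq => //; have := L2sq_eq0 (subspaceB L2_subspace gL yL) gy.
  by apply: leb_aeS => t h t01; apply/eqP; rewrite -subr_eq0; apply/eqP; exact: h.
move=> t t01; rewrite -eq01 ?in_itv//; apply: small_ccvg => eps /hg[K' hK'].
by exists K' => k Kk; exact: hK'.
Qed.

Lemma operator_form_cvg y ys : FD y -> (forall k, Dom (ys k)) ->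
  eventually_small (fun k => q (y - ys k)) ->
  (forall z, FD z -> ccvg (fun k => Q (ys k) z) (Q y z)) /\ q (ys k) @[k --> \oo] --> q y.
Proof.
move=> Dy Dys h; have Fys k := operator_domain_form_domain (Dys k).
by split; [exact: (form_cvg form_domain_subspace qform_semi_inner Dy Fys h)|
  exact: (qform_cvg form_domain_subspace qform_semi_inner Dy Fys h)].
Qed.

Theorem form_domain_sup_bound : exists2 K : R, 0 <= K &
  forall y, FD y -> forall t, 0 <= t <= 1 -> sqmod (y t) <= K * q y.
Proof.
have [K K0 hK] := operator_domain_sup_bound; exists K => // y Dy t t01.
have [ys [Dys qs _ pt]] := form_domain_approx Dy.
apply: (cvg_seq_le2 (ccvg_sqmod (pt t t01)) (cvgM (cvg_cst _) ((operator_form_cvg Dy Dys qs).2))) => k.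
exact: hK.
Qed.

Theorem form_domain_evaluation_estimate : exists2 K : R, 0 <= K &
  forall c h, 0 <= c -> 0 < h -> c + h <= 1 ->
  exists (tau : 'I_l -> R) (wt : 'I_l -> R -> R),
    (forall i, 0 <= tau i <= 1) /\
    forall y, FD y -> forall t, c <= t <= c + h ->
      sqmod (y t - \sum_i (wt i t)%:C%C * y (tau i)) <= K * h ^+ (2 * l - 1) * q y.
Proof.
have [K K0 hK] := operator_evaluation_estimate hl hP hsa hpos; exists K => // c h c0 h0 ch.
have [tau [wt [tau01 hw]]] := hK c h c0 h0 ch; exists tau, wt; split=> // y Dy t tI.
have t01 : 0 <= t <= 1 by move: tI => /andP[? ?]; apply/andP; split; lra.
have [ys [Dys qs _ pt]] := form_domain_approx Dy.
have := ccvg_lin (-1) (ccvg_comb (index_enum 'I_l) (fun i => (wt i t)%:C%C) (fun i => pt _ (tau01 i))) (pt t t01).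
rewrite mulN1r addrC => /ccvg_sqmod lim.
apply: (cvg_seq_le2 lim (cvgM (cvg_cst _) ((operator_form_cvg Dy Dys qs).2))) => k.
have [w hyw] := Dys k; rewrite (qform_operator hyw (Dys k)) mulN1r addrC; exact: hw.
Qed.

(** Duality: [Q y phi] is bounded by a multiple of [b] times the square root of [q y] on the
    operator domain. Along a sequence [y] tending to [phi], this bounds the square of [q phi] by a
    multiple of [q phi]. *)
Theorem form_domain_test_function : exists2 K : R, 0 <= K &
  forall (phi : R -> R[i]) (Z : nat -> R -> R[i]) (b : R), sobolev_chain l phi Z ->
    (forall i, (i < l)%N -> Z i 0 = 0 /\ Z i 1 = 0) -> 0 <= b ->
    (forall i t, (i < l)%N -> 0 <= t <= 1 -> sqmod (Z i t) <= b ^+ 2) ->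
    L2sq (Z l) <= b ^+ 2 ->
    FD phi /\ q phi <= K * b ^+ 2.
Proof.
have [K K0 hK] := test_function_bound hl hP hsa hpos; exists (K ^+ 2); first exact: sqr_ge0.
move=> phi Z b hZ Z01 b0 Zb Zlb.
have Dphi : FD phi.
  by split; [exists Z|apply: hdom.1; exists Z].
split=> //; rewrite -exprMn; have [Z0 hZd Zl] := hZ; have hZe : energy_chain l Z by split.
have [A [A_op hA]] := operator_form_exists hsa hpos.
have hQ := qform_closed A_op hA.
have [ys [Dys qs l2s pt]] := form_domain_approx Dphi.
(* [qform_operator] has its second argument in the operator domain; the identity extends to [phi]
   because both sides are limits along the approximating sequence. *)
have Qphi y w : L y w -> Q y phi = L2dot w phi.
  move=> hw; have Dy : Dom y by exists w.
  have wL := (operator_in_L2 hw).2; have pL := form_domain_L2 Dphi.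
  have lim1 : ccvg (fun k => Q y (ys k)) (Q y phi).
    have := ccvgJ ((operator_form_cvg Dphi Dys qs).1 _ (operator_domain_form_domain Dy)).
    rewrite -(form_sym qform_semi_inner Dphi (operator_domain_form_domain Dy)).
    congr ccvg; apply/funext => k.
    by rewrite -(form_sym qform_semi_inner)//; exact: operator_domain_form_domain.
  apply: ccvg_unique lim1 _; apply: small_ccvg.
  apply: (eventually_smallZ (C := L2sq w) _ _ l2s); first exact: L2sq_ge0.
  move=> k; have kL := operator_domain_L2 (Dys k).
  rewrite (qform_operator hw (Dys k)) -(formBr L2_subspace L2_semi_inner)// -!L2dotxx.
  apply: (form_cauchy_schwarz L2_subspace L2_semi_inner) => //.
  exact: (subspaceB L2_subspace).
have bnd k : re (Q (ys k) phi) ^+ 2 <= (K * b) ^+ 2 * q (ys k).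
  have [w hw] := Dys k; have h := hK phi Z b hZe Z0 Z01 b0 Zb Zlb _ _ hw.
  rewrite -(Qphi _ _ hw) -(qform_operator hw (Dys k)) in h.
  have qk : 0 <= q (ys k) by apply: (form_pos qform_semi_inner); exact: operator_domain_form_domain.
  rewrite -[X in _ * X](sqr_sqrtr qk) -exprMn -ler_sqrt ?sqr_ge0// !sqrtr_sqr.
  by apply: le_trans h _; rewrite ler_norm.
have q0 : 0 <= q phi by exact: (form_pos qform_semi_inner).
have [lim1 _] := (operator_form_cvg Dphi Dys qs).1 _ Dphi.
have h : q phi * q phi <= (K * b) ^+ 2 * q phi.
  apply: (cvg_seq_le2 (cvgM lim1 lim1) (cvgM (cvg_cst _) (operator_form_cvg Dphi Dys qs).2)) => k.
  by rewrite -expr2.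
move: q0; rewrite le_eqVlt => /predU1P[<-|q0]; first exact: sqr_ge0.
by rewrite -(ler_pM2r q0).
Qed.

(** The Cauchy sequence is replaced by a nearby one in the operator domain, where the sup bound
    yields a uniform limit; that limit belongs to the closure by construction. *)
Theorem form_domain_complete : complete_for Q FD.
Proof.
move=> u Du cau; have [A [A_op hA]] := operator_form_exists hsa hpos.
have hQ := qform_closed A_op hA; have hFD := form_domain_subspace.
have hq := qform_semi_inner.
have QA x z : Dom x -> Dom z -> Q x z = A x z.
  exact: (closed_form_ext L2_subspace (@operator_domain_subspace _ l P r B)
  L2_semi_inner hA (@operator_domain_L2 _ l P r B) hQ).
have [ys hys] : exists ys : nat -> R -> R[i], forall k, Dom (ys k) /\ q (u k - ys k) < k.+1%:R^-1.
  apply: (exists_choice (P := fun k y => Dom y /\ q (u k - y) < k.+1%:R^-1)) => k.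
  have [vs [Dvs qs _ _]] := form_domain_approx (Du k).
  have k0 : 0 < k.+1%:R^-1 :> R by rewrite invr_gt0.
  by have [K hK] := qs _ k0; exists (vs K); split=> //; exact: hK.
have Dys k : Dom (ys k) := (hys k).1.
have Fys k : FD (ys k) := operator_domain_form_domain (Dys k).
have small : eventually_small (fun k => q (u k - ys k)).
  move=> eps e0; have [K hK] := eventually_small_inv e0; exists K => k Kk.
  exact: lt_trans (hys k).2 (hK k Kk).
have qc : eventually_small2 (fun j k => q (ys j - ys k)).
  exact: (perturbed_cauchy hFD hq Du Fys cau small).
have [K K0 hK] := operator_domain_sup_bound.
have uc : uniformly_cauchy ys.
  have K1 : 0 < K + 1 by rewrite ltr_wpDl.
  move=> eps e0; have [K' hK'] := qc _ (divr_gt0 e0 K1); exists K' => j k Kj Kk t t01.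
  have Djk := subspaceB (@operator_domain_subspace _ l P r B) (Dys j) (Dys k).
  apply: le_lt_trans (hK _ Djk t t01) _; have := hK' j k Kj Kk; rewrite ltr_pdivlMr//; apply: le_lt_trans.
  by rewrite mulrC ler_wpM2l// ?lerDl// (form_pos hq)//; exact: operator_domain_form_domain.
have [g hg] := uniformly_cauchy_limit uc.
have cg : ccont g := ccont_uniform_limit (fun k => form_domain_cont (Fys k)) hg.
have gL : in_L2 g by apply: (@ccont_sq_integrable _ (leb R)) => //; exact: leb01_fin.
have l2 y : in_L2 y -> ae_eq01 y g -> approx D2 Dom N A y ys.
  move=> yL yg; split=> //.
    move=> eps e0; have [K' hK'] := hg _ (divr_gt0 e0 (ltr0Sn _ 1)); exists K' => k Kk.
    rewrite L2dotxx; have kL := operator_domain_L2 (Dys k).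
    rewrite (L2sq_ae (v := ys k - g)).
    + apply: (@le_lt_trans _ _ (eps / 2)); last by lra.
      apply: L2sq_le_sup; first exact: (subspaceB L2_subspace).
      by move=> t t01; apply: ltW; exact: hK'.
    + exact: (subspaceB L2_subspace).
    + exact: (subspaceB L2_subspace).
    + by apply: leb_aeS yg => t h t01; rewrite !fctE h.
  by move=> eps e0; have [K' hK'] := qc _ e0; exists K' => j k Kj Kk; rewrite -QA ?hK'//;
    exact: (subspaceB (@operator_domain_subspace _ l P r B)).
have gc : in_form_closure L g.
  by apply/(in_form_closureP A_op); exists ys; apply: l2 => //; exact: aeW.
(* The limit [g] is in the closure but is not known to be a Sobolev function, so a representative in
   the form domain replaces it. *)
have [y yg [Y hY]] := hdom.2 g gc.
have yL : in_L2 y := sobolev_chain_L2 hl hY.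
have ya := l2 y yL yg.
have Dy : FD y by split; [exists Y|apply/(in_form_closureP A_op); exists ys].
exists y; first exact: Dy.
have lim := closed_form_approx L2_subspace (@operator_domain_subspace _ l P r B)
  L2_semi_inner hA (@operator_domain_L2 _ l P r B) hQ ya.
exact: (perturbed_limit hFD hq Dy Du Fys lim small).
Qed.

End FormDomainEstimates.

(** * Atoms of the self-similar measure *)

Section SideLimits.
Context {R : realType}.
Implicit Types (f g : R -> R) (s t a b : R).

(* s is 1 for limits from the right and -1 for limits from the left. *)
Definition side_limit s f t a := forall eps : R, 0 < eps -> exists2 delta : R, 0 < delta &
  forall x, 0 < s * (x - t) < delta -> `|f x - a| < eps.

Lemma side_limit_right f t a : f x @[x --> t^'+] --> a -> side_limit 1 f t a.
Proof.
move=> /cvgrPdist_lt h eps /h /nbhs_ballP[delta /= d0 hd]; exists delta => // x.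
rewrite mul1r => /andP[x0 xd]; rewrite distrC; apply: hd; last by rewrite -subr_gt0.
by rewrite /ball/= distrC gtr0_norm.
Qed.

Lemma side_limit_left f t a : f x @[x --> t^'-] --> a -> side_limit (-1) f t a.
Proof.
move=> /cvgrPdist_lt h eps /h /nbhs_ballP[delta /= d0 hd]; exists delta => // x.
rewrite mulN1r opprB => /andP[x0 xd]; rewrite distrC; apply: hd; last by rewrite -subr_gt0.
by rewrite /ball/= gtr0_norm.
Qed.

Lemma ae_meets_itv (G : R -> Prop) a b : a < b -> {ae leb R, forall x : R, G x} ->
  exists2 x, a < x < b & G x.
Proof.
move=> ab [Z [mZ Z0 hZ]]; apply: contrapT => no.
have sub : `]a, b[%classic `<=` Z.
  by move=> x /=; rewrite in_itv/= => xab; apply: hZ => /= Gx; apply: no; exists x.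
have : (leb R `]a, b[%classic <= 0)%E.
  rewrite -Z0; exact: (le_measure (leb R) (mem_set (measurable_itv `]a, b[)) (mem_set mZ) sub).
by rewrite lebesgue_measure_itv/= lte_fin ab -EFinB lee_fin leNgt subr_gt0 ab.
Qed.

(** A one-sided limit can be computed on any set of full measure. Thus the fixed point equation,
    which holds only almost everywhere, becomes exact for one-sided values. *)
Lemma side_limit_ae s f g t a b c : s = 1 \/ s = -1 -> 0 < c ->
  side_limit s f t a -> side_limit s g t b ->
  {ae leb R, forall x : R, 0 < s * (x - t) < c -> f x = g x} -> a = b.
Proof.
move=> s1 c0 fa gb fg; apply/eqP/negPn/negP => ab.
have e0 : 0 < `|a - b| / 2 by rewrite divr_gt0// normr_gt0 subr_eq0.
have [d1 d10 h1] := fa _ e0; have [d2 d20 h2] := gb _ e0.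
pose d := Num.min c (Num.min d1 d2).
have d0 : 0 < d by rewrite !lt_min c0 d10.
have [x xd fgx] : exists2 x, 0 < s * (x - t) < d & (0 < s * (x - t) < c -> f x = g x).
  case: s1 => s1; rewrite {}s1 in fg *.
    have [|x /andP[x1 x2] hx] := ae_meets_itv (a := t) (b := t + d) _ fg; first by rewrite ltrDl.
    by exists x => //; rewrite mul1r; apply/andP; split; lra.
  have [|x /andP[x1 x2] hx] := ae_meets_itv (a := t - d) (b := t) _ fg; first by rewrite ltrBlDr ltrDl.
  by exists x => //; rewrite mulN1r; apply/andP; split; lra.
move: xd => /andP[x0]; rewrite !lt_min => /and3P[xc x1 x2].
have k1 : `|f x - a| < `|a - b| / 2 by apply: h1; rewrite x0.
have k2 : `|f x - b| < `|a - b| / 2 by rewrite fgx ?x0//; apply: h2; rewrite x0.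
have : `|a - b| <= `|f x - a| + `|f x - b|.
  by rewrite distrC [`|f x - b|]distrC (_ : b - a = (b - f x) + (f x - a)) 1?addrC ?ler_normD//; ring.
by rewrite leNgt => /negP; apply; lra.
Qed.

Lemma side_limit_affine s f g u a sg k x0 b0 b1 : 0 < k -> sg = 1 \/ sg = -1 ->
  side_limit s f u a -> (forall y, g (x0 + sg * k * y) = b1 * f y + b0) ->
  side_limit (sg * s) g (x0 + sg * k * u) (b1 * a + b0).
Proof.
move=> k0 sg1 fa fg eps e0; have b10 : 0 < `|b1| + 1 by rewrite ltr_wpDl.
have [d d0 hd] := fa _ (divr_gt0 e0 b10); exists (k * d); first by exact: mulr_gt0.
have sgE : sg * sg = 1 by case: sg1 => ->; rewrite ?mulrNN mulr1.
move=> y hy; pose x := sg * (y - x0) / k.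
have yx : y = x0 + sg * k * x.
  rewrite /x (_ : sg * k * _ = (sg * sg) * (y - x0) * (k / k)); last by ring.
  by rewrite sgE divff ?gt_eqF// mulr1 mul1r addrC subrK.
have : 0 < s * (x - u) < d.
  move: hy; rewrite yx (_ : sg * s * _ = (sg * sg) * (k * (s * (x - u)))); last by ring.
  by rewrite sgE mul1r pmulr_rgt0// ltr_pM2l.
move=> /hd; rewrite ltr_pdivlMr// => h.
rewrite yx fg (_ : _ - _ = b1 * (f x - a)); last by ring.
by rewrite normrM mulrC; apply: le_lt_trans h; rewrite ler_wpM2l// lerDl.
Qed.

End SideLimits.

(** * Masses of points and intervals under the similarities *)

Section SelfSimilarPrimitive.
Context {R : realType}.
Implicit Types (x y s t u v : R).
Variables (n : nat) (alpha : nat -> R) (e : nat -> bool) (d beta : nat -> R).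
Hypothesis sub : subdivision n alpha.
Local Notation S := (simmap alpha e).
Local Notation a k := (alpha k.+1 - alpha k).
Definition orientation k : R := if e k then -1 else 1.

Lemma alpha_lt i j : (i < j)%N -> (j <= n)%N -> alpha i < alpha j.
Proof.
move=> + jn; elim: j jn => // j IH jn; rewrite ltnS leq_eqVlt => /predU1P[->|ij].
  by case: sub => _ _; apply.
by apply: lt_trans (IH (ltnW jn) ij) _; case: sub => _ _; apply.
Qed.

Lemma alpha_le i j : (i <= j)%N -> (j <= n)%N -> alpha i <= alpha j.
Proof. by rewrite leq_eqVlt => /predU1P[->//|ij jn]; apply/ltW/alpha_lt. Qed.

Lemma alpha01 i : (i <= n)%N -> 0 <= alpha i <= 1.
Proof.
by move=> hi; case: sub => <- <- _; apply/andP; split; apply: alpha_le.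
Qed.

Lemma a_gt0 k : (k < n)%N -> 0 < a k.
Proof. by move=> kn; rewrite subr_gt0; apply: alpha_lt. Qed.

Lemma orientation1 k : orientation k = 1 \/ orientation k = -1.
Proof. by rewrite /orientation; case: (e k); [right|left]. Qed.

Lemma simmapB k x y : S k x - S k y = orientation k * a k * (x - y).
Proof. by rewrite /simmap /orientation; case: (e k); ring. Qed.

Lemma simmapE k x : S k x = S k 0 + orientation k * a k * x.
Proof. by rewrite -[x in RHS]subr0 -simmapB addrC subrK. Qed.

Lemma simmap_itv k x : (k < n)%N -> 0 <= x <= 1 -> alpha k <= S k x <= alpha k.+1.
Proof.
move=> /a_gt0 a0 /andP[x0 x1].
have := mulr_ge0 (ltW a0) x0; have : 0 <= a k * (1 - x) by apply: mulr_ge0; [exact: ltW|rewrite subr_ge0].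
by rewrite /simmap; case: (e k) => h1 h2; apply/andP; split; lra.
Qed.

Lemma simmap_oitv k x : (k < n)%N -> 0 < x < 1 -> alpha k < S k x < alpha k.+1.
Proof.
move=> /a_gt0 a0 /andP[x0 x1].
have := mulr_gt0 a0 x0; have : 0 < a k * (1 - x) by apply: mulr_gt0 => //; rewrite subr_gt0.
by rewrite /simmap; case: (e k) => h1 h2; apply/andP; split; lra.
Qed.

Lemma simop_itv f k y : (k < n)%N -> alpha k < y < alpha k.+1 ->
  simop n alpha e d beta f y = d k * f (simmap_inv alpha e k y) + beta k.
Proof.
move=> kn yk; rewrite /simop (bigD1 (Ordinal kn))//= big1 ?addr0 => [|i ik].
  by rewrite indicE mem_set ?mulr1//= in_itv.
rewrite indicE memNset ?mulr0//= in_itv/= => /andP[yi1 yi2].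
have ne : (i : nat) != k by apply: contra ik => /eqP ik; apply/eqP/val_inj.
move: yk => /andP[y1 y2]; have [ik'|ki] := ltnP i k.
  have := alpha_le ik' (ltnW kn); have := lt_trans y1 yi2; lra.
have ki' : (k < i)%N by rewrite ltn_neqAle eq_sym ne.
have := alpha_le ki' (ltnW (ltn_ord i)); have := lt_trans yi1 y2; lra.
Qed.

Variables (f : R -> R) (mu : probability (measurableTypeR R) R).
Hypotheses (hf : normalized_fixed_point n alpha e d beta f) (hmu : has_primitive mu f).

Lemma point_mass u : 0 <= u <= 1 -> mu [set u] = (right_value f u - f u)%:E.
Proof. by move=> /andP[u0 u1]; rewrite -hmu.2// set_itv1. Qed.

Lemma oitv_mass u v : 0 <= u -> u < v -> v <= 1 -> mu `]u, v[%classic = (f v - right_value f u)%:E.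
Proof.
move=> u0 uv v1; have h := hmu.2 u v u0 (ltW uv) v1.
have hu : mu [set u] = (right_value f u - f u)%:E by apply: point_mass; rewrite u0 (le_trans (ltW uv)).
have hv : mu [set v] = (right_value f v - f v)%:E by apply: point_mass; rewrite v1 (le_trans u0 (ltW uv)).
have E : `[u, v]%classic = ([set u] `|` `]u, v[ `|` [set v])%classic.
  apply/seteqP; split=> x /=; rewrite !in_itv/=.
    move=> /andP[]; rewrite le_eqVlt => /predU1P[->|ux]; first by left; left.
    by rewrite le_eqVlt => /predU1P[->|xv]; [right|left; right; rewrite ux].
  by move=> [[->|/andP[? ?]]|->]; rewrite ?lexx ?(ltW uv)// !ltW.
have fin : mu `]u, v[%classic \is a fin_num by rewrite fin_num_measure.
have key : mu ([set u] `|` `]u, v[ `|` [set v])%classic = (mu [set u] + mu `]u, v[%classic + mu [set v])%E.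
  rewrite measureU//; last 2 first.
  - by apply: measurableU.
  - apply/seteqP; split=> // x [[/= ->|/=]]; first by move=> xE; rewrite xE ltxx in uv.
    by rewrite in_itv/= => /andP[_ xv] xE; rewrite xE ltxx in xv.
  congr (_ + _)%E; rewrite measureU//.
  by apply/seteqP; split=> // x [/= ->]; rewrite in_itv/= ltxx.
rewrite E in h; rewrite h hu hv -(fineK fin) -!EFinD in key; case: key => key.
by rewrite -(fineK fin); congr EFin; lra.
Qed.

Lemma right_value_ge u : 0 <= u <= 1 -> f u <= right_value f u.
Proof. by move=> u01; rewrite -subr_ge0 -lee_fin -point_mass. Qed.

Lemma primitive_nondecreasing u v : 0 <= u -> u <= v -> v <= 1 -> f u <= f v.
Proof.
move=> u0; rewrite le_eqVlt => /predU1P[->//|uv] v1.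
apply: le_trans (right_value_ge _) _; first by rewrite u0 (le_trans (ltW uv)).
by rewrite -subr_ge0 -lee_fin -oitv_mass.
Qed.

Lemma right_value_limit u : 0 <= u < 1 -> side_limit 1 f u (right_value f u).
Proof.
move=> /andP[u0 u1]; apply: side_limit_right; rewrite /right_value u1.
have h : f x @[x --> u^'+] --> inf [set f x | x in `]u, 1[%classic].
  apply: nondecreasing_at_right_cvgr; first by rewrite bnd_simp.
    by move=> x y; rewrite !in_itv/= => /andP[ux _] /andP[_ y1] xy;
      apply: primitive_nondecreasing => //; [exact: le_trans u0 (ltW ux)|exact: ltW].
  exists (f u) => _ [x /= + <-]; rewrite in_itv/= => /andP[ux x1].
  by apply: primitive_nondecreasing => //; exact: ltW.
by rewrite (cvg_lim _ h).
Qed.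

(** f(u+0) for s = 1, and f(u) = f(u-0) for s = -1, by left-continuity. *)
Definition side_value s u : R := if 0 < s then right_value f u else f u.

Definition side_ok s u := (s = 1 /\ 0 <= u < 1) \/ (s = -1 /\ 0 < u <= 1).

Lemma side_value_limit s u : side_ok s u -> side_limit s f u (side_value s u).
Proof.
move=> [[-> h]|[-> h]]; rewrite /side_value ?ltr01 ?oppr_gt0 ?ltr10.
  exact: right_value_limit.
by apply: side_limit_left; case: hf => _ _ + _; apply.
Qed.

Lemma side_ok_simmap k s u : (k < n)%N -> side_ok s u -> side_ok (orientation k * s) (S k u).
Proof.
move=> kn h; have /andP[ak0 _] := alpha01 (ltnW kn); have /andP[_ ak1] := alpha01 kn.
have a0 := a_gt0 kn.
case: h => [[-> /andP[u0 u1]]|[-> /andP[u0 u1]]];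
  rewrite /simmap /orientation /side_ok; case: (e k); rewrite ?mulr1 ?mulrNN ?mul1r ?mulr1.
- right; split=> //; have h : 0 < a k * (1 - u) by apply: mulr_gt0 => //; rewrite subr_gt0.
  have h' : 0 <= a k * u by rewrite mulr_ge0// ltW.
  by apply/andP; split; lra.
- left; split=> //; have h : 0 < a k * (1 - u) by apply: mulr_gt0 => //; rewrite subr_gt0.
  have h' : 0 <= a k * u by rewrite mulr_ge0// ltW.
  by apply/andP; split; lra.
- left; split=> //; have h : 0 <= a k * (1 - u) by apply: mulr_ge0; [exact: ltW|rewrite subr_ge0].
  have h' : 0 < a k * u by exact: mulr_gt0.
  by apply/andP; split; lra.
- right; split=> //; have h : 0 <= a k * (1 - u) by apply: mulr_ge0; [exact: ltW|rewrite subr_ge0].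
  have h' : 0 < a k * u by exact: mulr_gt0.
  by apply/andP; split; lra.
Qed.

(** The self-similarity in exact form. A reversing similarity exchanges the two sides, hence the
    factor [orientation k] on the sign. Masses of points and of open intervals are differences of
    side values, so they scale by [|d k|]. *)
Lemma side_value_simmap k s u : (k < n)%N -> side_ok s u ->
  side_value (orientation k * s) (S k u) = d k * side_value s u + beta k.
Proof.
move=> kn ok; have a0 := a_gt0 kn; have ak : alpha k < alpha k.+1 by rewrite -subr_gt0.
have os : orientation k * s = 1 \/ orientation k * s = -1.
  by case: ok => -[-> _]; case: (orientation1 k) => ->; rewrite ?mulr1 ?mul1r ?mulrNN ?mulr1; [left|right|right|left].
(* Length of the image of the part of [0,1] on the side [s] of [u]; there the equation of the k-th
   interval is available. *)
pose c := a k * (if 0 < s then 1 - u else u).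
have c0 : 0 < c.
  by case: ok => [] [s1 /andP[h1 h2]]; rewrite /c s1 ?ltr01 ?oppr_gt0 ?ltr10; apply: mulr_gt0 => //; rewrite subr_gt0.
pose g y := d k * f (simmap_inv alpha e k y) + beta k.
have lim1 := side_value_limit (side_ok_simmap kn ok).
have lim2 : side_limit (orientation k * s) g (S k u) (d k * side_value s u + beta k).
  rewrite simmapE; apply: (side_limit_affine a0 (orientation1 k) (side_value_limit ok)) => y.
  by rewrite -simmapE /g simmapK.
apply: (side_limit_ae os c0 lim1 lim2).
have [_ ae _ _] := hf; apply: leb_aeS ae => y hy yc.
have yk : alpha k < y < alpha k.+1.
  move: yc; rewrite -[y](@simmap_invK R alpha e k ak y); set x := simmap_inv _ _ _ _.
  rewrite simmapB (_ : _ * _ * _ = (orientation k * orientation k) * (a k * (s * (x - u)))); last by ring.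
  have -> : orientation k * orientation k = 1 by case: (orientation1 k) => ->; rewrite ?mulrNN mulr1.
  rewrite mul1r /c pmulr_rgt0// ltr_pM2l// => hx; apply: simmap_oitv => //.
  case: ok hx => [] [-> /andP[h1 h2]]; rewrite ?ltr01 ?oppr_gt0 ?ltr10 => /andP[? ?]; apply/andP; split; lra.
have /andP[ak0 _] := alpha01 (ltnW kn); have /andP[_ ak1] := alpha01 kn.
rewrite hy; first exact: simop_itv.
by move: yk => /andP[y1 y2]; rewrite in_itv/=; apply/andP; split; lra.
Qed.

(** The endpoints come in either order, since similarities may reverse them. *)
Definition oint (u v : R) : set R := `]Num.min u v, Num.max u v[%classic.

Lemma ointC u v : oint u v = oint v u. Proof. by rewrite /oint minC maxC. Qed.

Lemma measurable_oint u v : measurable (oint u v : set (measurableTypeR R)).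
Proof. exact: measurable_itv. Qed.

Lemma point_mass_simmap k u : (k < n)%N -> 0 < u < 1 ->
  fine (mu [set S k u]) = `|d k| * fine (mu [set u]).
Proof.
move=> kn /andP[u0 u1].
have okp : side_ok 1 u by left; rewrite (ltW u0).
have okm : side_ok (-1) u by right; rewrite u0 ltW.
have h1 := side_value_simmap kn okp; have h2 := side_value_simmap kn okm.
have /andP[ak0 _] := alpha01 (ltnW kn); have /andP[_ ak1] := alpha01 kn.
have /andP[s0 s1] : alpha k < S k u < alpha k.+1 by apply: simmap_oitv => //; rewrite u0.
have S01 : 0 <= S k u <= 1 by apply/andP; split; lra.
have U01 : 0 <= u <= 1 by rewrite !ltW.
have k1 : `|right_value f (S k u) - f (S k u)| = `|d k| * `|right_value f u - f u|.
  rewrite -normrM; case: (orientation1 k) h1 h2 => ->;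
    rewrite /side_value ?mulr1 ?mul1r ?mulrNN ?mulr1 ?ltr01 ?oppr_gt0 ?ltr10 => -> ->; last rewrite distrC;
    by congr `|_|; ring.
have p1 := right_value_ge S01; have p2 := right_value_ge U01.
rewrite -subr_ge0 in p1; rewrite -subr_ge0 in p2; rewrite (ger0_norm p1) (ger0_norm p2) in k1.
by rewrite !point_mass.
Qed.

Lemma oint_mass_simmap k u v : (k < n)%N -> 0 <= u <= 1 -> 0 <= v <= 1 ->
  fine (mu (oint (S k u) (S k v))) = `|d k| * fine (mu (oint u v)).
Proof.
move=> kn; wlog uv : u v / u < v => [H u01 v01|/andP[u0 u1] /andP[v0 v1]].
  have [uv|vu|->] := ltgtP u v; first exact: H.
    by rewrite ointC [in RHS]ointC; exact: H.
  by rewrite /oint !minxx !maxxx !set_itvoo0 ?lexx// !measure0 /= mulr0.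
have okp : side_ok 1 u by left; rewrite u0 (lt_le_trans uv).
have okm : side_ok (-1) v by right; rewrite v1 (le_lt_trans u0).
have h1 := side_value_simmap kn okp; have h2 := side_value_simmap kn okm.
have /andP[ak0 _] := alpha01 (ltnW kn); have /andP[_ ak1] := alpha01 kn.
have /andP[s0 s1] : alpha k <= S k u <= alpha k.+1 by apply: simmap_itv => //; rewrite u0.
have /andP[r0 r1] : alpha k <= S k v <= alpha k.+1 by apply: simmap_itv => //; rewrite v0.
have a0 := mulr_gt0 (a_gt0 kn) (eq_ind_r is_true uv (subr_gt0 u v)).
have E : fine (mu (oint u v)) = f v - right_value f u by rewrite /oint min_l ?max_r ?oitv_mass ?(ltW uv).
have E0 : 0 <= f v - right_value f u by rewrite -E fine_ge0.
rewrite E -(ger0_norm E0) -normrM -[LHS]ger0_norm ?fine_ge0//.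
have SB := simmapB k v u.
move: h1 h2 SB; case: (orientation1 k) => ->; rewrite /side_value ?mulr1 ?mul1r ?mulrNN ?mulr1 ?ltr01 ?oppr_gt0 ?ltr10 => h1 h2 SB.
  have lt : S k u < S k v by rewrite -subr_gt0 SB.
  rewrite /oint min_l ?max_r ?oitv_mass ?(ltW lt)//=; [|lra|lra].
  by rewrite h1 h2; congr `|_|; ring.
have lt : S k v < S k u by rewrite -subr_lt0 SB mulN1r mulNr oppr_lt0.
rewrite /oint min_r ?max_l ?oitv_mass ?(ltW lt)//=; [|lra|lra].
by rewrite h1 h2 distrC; congr `|_|; ring.
Qed.

Lemma subdivision_cases x : 0 < x < 1 -> exists k, (k < n)%N /\
  (alpha k < x < alpha k.+1 \/ (0 < k)%N /\ x = alpha k).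
Proof.
move=> /andP[x0 x1]; have [a0 an _] := sub.
have : exists k, (k < n)%N && (alpha k <= x < alpha k.+1).
  have : exists i, (i <= n)%N && (x < alpha i) by exists n; rewrite leqnn an.
  case/ex_minnP => -[|i]; first by rewrite a0 leq0n; lra.
  move=> /andP[i_n xi] min; exists i; rewrite i_n xi andbT/= leNgt; apply/negP => h.
  by have := min i; rewrite h (ltnW i_n) ltnn => /(_ isT).
move=> [k /and3P[kn kx xk]]; exists k; split=> //.
move: kx; rewrite le_eqVlt => /predU1P[kE|kx]; [right|by left; rewrite kx].
by split=> //; case: k kn xk kE => // _ _ kE; rewrite -kE a0 ltxx in x0.
Qed.

End SelfSimilarPrimitive.

Lemma uniform_lower_bound (R : realType) (I : finType) (v : I -> R) : (forall i, 0 < v i) ->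
  exists2 rho, 0 < rho & forall i, rho <= v i.
Proof.
move=> v0; exists (\big[Num.min/1]_i v i); last by move=> i; exact: bigmin_le.
by apply: (big_ind (fun x => 0 < x)) => // x y x0 y0; rewrite lt_min x0.
Qed.

Lemma centered_inside (R : realType) (p t u v : R) : t - u = p -> v - t = p ->
  0 <= u <= 1 -> 0 <= v <= 1 -> `|p| <= t <= 1 - `|p|.
Proof.
move=> e0 e1 /andP[u0 u1] /andP[v0 v1].
by have [hp|hp] := ltrP 0 p; rewrite ?(gtr0_norm hp) ?(ler0_norm hp); apply/andP; split; lra.
Qed.

(* x j k, for k < N, are the atoms of generation j, and ]lo J, lo J + a ^ J[ contains those of the
   generations j >= J. *)
Record geometric_atoms (R : realType) (N : nat) (a delta rho c : R)
    (mu : probability (measurableTypeR R) R) (x : nat -> nat -> R) (lo : nat -> R) : Prop := GeometricAtoms {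
  ga_ratio : 0 < a < 1;
  ga_mass : 0 < delta < 1;
  ga_pos : 0 < rho /\ 0 < c;
  ga_inside : forall j k, (k < N)%N -> rho * a ^+ j <= x j k <= 1 - rho * a ^+ j;
  ga_separated : forall j k j' k', (k < N)%N -> (k' < N)%N -> (j, k) != (j', k') ->
    rho * a ^+ j <= `|x j k - x j' k'|;
  ga_atom : forall j k, (k < N)%N -> c * delta ^+ j <= fine (mu [set x j k]);
  ga_tail_itv : forall J, 0 <= lo J /\ lo J + a ^+ J <= 1;
  ga_tail_mass : forall J, fine (mu `]lo J, (lo J + a ^+ J)[%classic) <= delta ^+ J;
  ga_support : forall J, mu.-negligible (`[0, 1]%classic `&`
    [set t | (forall j k, (j < J)%N -> (k < N)%N -> t <> x j k) /\ ~ (lo J < t < lo J + a ^+ J)]) }.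

(** * Iterates of the similarity with nonzero coefficient *)

Section SelfSimilarAtoms.
Context {R : realType}.
Implicit Types (x y s t u v : R).
Variables (n : nat) (alpha : nat -> R) (e : nat -> bool) (d beta : nat -> R) (m : nat).
Variables (f : R -> R) (mu : probability (measurableTypeR R) R).
Hypotheses (hn : (2 <= n)%N) (sub : subdivision n alpha).
Hypotheses (mn : (m < n)%N) (dm0 : d m != 0) (dm1 : `|d m| < 1).
Hypothesis dk0 : forall k, (k < n)%N -> k != m -> d k = 0.
Hypotheses (hf : normalized_fixed_point n alpha e d beta f) (hmu : has_primitive mu f).
Hypothesis jump : forall k, (0 < k < n)%N -> right_value f (alpha k) != f (alpha k).
Local Notation S := (simmap alpha e m).
Local Notation T j := (iter j S).
Local Notation A := (alpha m.+1 - alpha m).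
Local Notation sg := (orientation e m * A).

Let A0 : 0 < A. Proof. exact: (a_gt0 sub mn). Qed.

Lemma contraction_lt1 : A < 1.
Proof.
have [a0 an _] := sub; have /andP[m0 _] := alpha01 sub (ltnW mn); have /andP[_ m1] := alpha01 sub mn.
have [m00|mp] := posnP m.
  have : alpha m.+1 < alpha n by apply: (alpha_lt sub); rewrite ?m00.
  by rewrite an; lra.
have : alpha 0%N < alpha m by apply: (alpha_lt sub) => //; exact: ltnW.
by rewrite a0; lra.
Qed.

Let inner k : (0 < k < n)%N -> 0 < alpha k < 1.
Proof.
have [a0 an _] := sub; move=> /andP[k0 kn].
by rewrite -{1}a0 -an !(alpha_lt sub)// ltnW.
Qed.

Lemma iter_simmapB j x y : T j x - T j y = sg ^+ j * (x - y).
Proof.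
by elim: j => [|j IH]; rewrite ?expr0 ?mul1r// !iterS simmapB IH mulrA -exprS.
Qed.

Lemma norm_sg j : `|sg ^+ j| = A ^+ j.
Proof.
by rewrite normrX normrM (gtr0_norm A0); case: (@orientation1 R e m) => ->; rewrite ?normrN normr1 mul1r.
Qed.

Lemma iter_simmap_itv j x : 0 <= x <= 1 -> 0 <= T j x <= 1.
Proof.
move=> x01; elim: j => // j IH; rewrite iterS.
have /andP[m0 _] := alpha01 sub (ltnW mn); have /andP[_ m1] := alpha01 sub mn.
have /andP[h1 h2] := simmap_itv e sub mn IH; apply/andP; split.
  exact: le_trans m0 h1.
exact: le_trans h2 m1.
Qed.

Lemma iter_simmap_oitv j x : 0 < x < 1 -> 0 < T j x < 1.
Proof.
move=> x01; elim: j => // j IH; rewrite iterS.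
have /andP[m0 _] := alpha01 sub (ltnW mn); have /andP[_ m1] := alpha01 sub mn.
have /andP[h1 h2] := simmap_oitv e sub mn IH; apply/andP; split.
  exact: le_lt_trans m0 h1.
exact: lt_le_trans h2 m1.
Qed.

Lemma iter_point_mass j x : 0 < x < 1 -> fine (mu [set T j x]) = `|d m| ^+ j * fine (mu [set x]).
Proof.
move=> x01; elim: j => [|j IH]; first by rewrite expr0 mul1r.
rewrite iterS (point_mass_simmap sub hf hmu mn); first by rewrite IH mulrA -exprS.
exact: iter_simmap_oitv.
Qed.

Lemma iter_oint_mass j u v : 0 <= u <= 1 -> 0 <= v <= 1 ->
  fine (mu (oint (T j u) (T j v))) = `|d m| ^+ j * fine (mu (oint u v)).
Proof.
move=> u01 v01; elim: j => [|j IH]; first by rewrite expr0 mul1r.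
rewrite !iterS (oint_mass_simmap sub hf hmu mn) ?iter_simmap_itv//.
by rewrite IH mulrA -exprS.
Qed.

Lemma ointP u v x : oint u v x <-> (u < x < v \/ v < x < u).
Proof.
rewrite /oint/= in_itv/=; have [uv|vu] := leP u v.
  by split=> [|[//|/andP[? ?]]]; [left|lra].
by split=> [|[/andP[? ?]|//]]; [right|lra].
Qed.

Lemma iter_oint j u v x : oint u v x -> oint (T j u) (T j v) (T j x).
Proof.
have sj : 0 < sg ^+ j \/ sg ^+ j < 0.
  by apply/orP; rewrite orbC -neq_lt -normr_gt0 norm_sg exprn_gt0.
have h1 := iter_simmapB j x u; have h2 := iter_simmapB j v x.
move=> /ointP h; apply/ointP; rewrite -[T j u < _]subr_gt0 -[_ < T j v]subr_gt0
  -[T j v < _]subr_lt0 -[_ < T j u]subr_lt0 h1 h2.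
by case: h => /andP[xu xv]; case: sj => sj; [left|right|right|left]; rewrite ?(pmulr_rgt0 _ sj)
   ?(pmulr_rlt0 _ sj) ?(nmulr_rgt0 _ sj) ?(nmulr_rlt0 _ sj) ?subr_gt0 ?subr_lt0 ?xu ?xv.
Qed.

Lemma oint_iter j y : oint (T j 0) (T j 1) y -> exists2 t, 0 < t < 1 & y = T j t.
Proof.
have s0 : sg ^+ j != 0 by rewrite -normr_gt0 norm_sg exprn_gt0.
move=> /ointP h; have h1 := iter_simmapB j 1 0; rewrite subr0 mulr1 in h1.
exists ((y - T j 0) / sg ^+ j); last first.
  have := iter_simmapB j ((y - T j 0) / sg ^+ j) 0; rewrite subr0 [RHS]mulrC divfK// => h2.
  lra.
have [sj|sj] : 0 < sg ^+ j \/ sg ^+ j < 0 by apply/orP; rewrite orbC -neq_lt.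
  by rewrite divr_gt0 ?ltr_pdivrMr// -?h1; case: h => /andP[? ?]; lra.
by rewrite ltr_ndivlMr// mul0r ltr_ndivrMr// mul1r -h1; apply/andP; split; case: h => /andP[? ?]; lra.
Qed.

(** Inside the k-th interval with [d k = 0] the open interval carries mass 0 times that of ]0,1[,
    and iterating the m-th similarity only multiplies masses by [|d m|]. *)
Lemma null_gap j k : (k < n)%N -> k != m -> fine (mu (oint (T j (alpha k)) (T j (alpha k.+1)))) = 0.
Proof.
move=> kn km; rewrite iter_oint_mass; [|exact: (alpha01 sub (ltnW kn))|exact: (alpha01 sub kn)].
have := oint_mass_simmap sub hf hmu kn (u := 0) (v := 1).
rewrite !lexx !ler01 dk0// normr0 mul0r => /(_ isT isT).
suff -> : oint (simmap alpha e k 0) (simmap alpha e k 1) = oint (alpha k) (alpha k.+1).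
  by move=> ->; rewrite mulr0.
by rewrite /simmap !mulr0 !mulr1 subr0 add0r; case: (e k); rewrite ?subKr ?subrK// ointC.
Qed.

Lemma fine_null (E : set R) : measurable (E : set (measurableTypeR R)) -> fine (mu E) = 0 ->
  mu.-negligible E.
Proof.
move=> mE h; exists E; split=> //.
by rewrite -(fineK (fin_num_measure mu _ mE)) h.
Qed.

(** The J-th iterate of the subdivision cuts the J-th tail interval into the atoms of generation J,
    null gaps, and the next tail interval. At the start, 0 and 1 are not atoms: this is the
    normalization of [f] at the endpoints. *)
Lemma tail_negligible J : mu.-negligible (`[0, 1]%classic `&`
    [set t | (forall j k, (j < J)%N -> (k < n.-1)%N -> t <> T j (alpha k.+1)) /\
      ~ oint (T J 0) (T J 1) t]).
Proof.
elim: J => [|J IH].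
  have h0 : right_value f 0 = f 0.
    by rewrite /right_value ltr01; case: hf => _ _ _ h; exact: cvg_lim h.
  have h1 : right_value f 1 = f 1 by rewrite /right_value ltxx.
  have pt u : 0 <= u <= 1 -> right_value f u = f u -> mu.-negligible [set u].
    by move=> u01 h; apply: fine_null => //; rewrite (point_mass hmu)// h subrr.
  have p0 : mu.-negligible [set (0 : R)] by apply: pt; rewrite // lexx ler01.
  have p1 : mu.-negligible [set (1 : R)] by apply: pt; rewrite // lexx ler01.
  apply: negligibleS (negligibleU p0 p1) => t [/=]; rewrite in_itv/= => /andP[].
  rewrite le_eqVlt => /predU1P[<- _ _|t0]; first by left.
  rewrite le_eqVlt => /predU1P[-> _|t1 [_ no]]; first by right.
  by exfalso; apply: no; apply/ointP; left; rewrite t0.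
pose G k := if k == m then set0 else oint (T J (alpha k)) (T J (alpha k.+1)).
have gaps : mu.-negligible (\big[setU/set0]_(k <- iota 0 n | true) G k).
  rewrite big_seq_cond; apply: negligible_bigsetU => k; rewrite mem_iota/= add0n andbT => kn.
  rewrite /G; case: eqP => [_|/eqP km]; first exact: negligible_set0.
  by apply: fine_null; [exact: measurable_oint|exact: null_gap].
apply: negligibleS (negligibleU IH gaps) => t [t01 [noX noI]].
have [tI|tI] := pselect (oint (T J 0) (T J 1) t); last first.
  left; split=> //; split=> // j k jJ; apply: noX; exact: leqW.
right; have [s s01 tE] := oint_iter tI.
have [k [kn [ks|[k0 sk]]]] := subdivision_cases sub s01; last first.
  by exfalso; apply: (noX J k.-1 (leqnn _)); rewrite ?prednK// -?sk//; case: (k) k0 kn => // k' _ kn /=; rewrite -ltnS prednK ?(ltnW hn).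
have [km|km] := eqVneq k m.
  exfalso; apply: noI; rewrite tE {t tI tE noX t01}.
  have [|s' s01' sE] := @oint_iter 1 s.
    rewrite /= ; apply/ointP; rewrite /simmap mulr0 mulr1; move: ks; rewrite km => /andP[? ?].
    by case: (e m); [right|left]; apply/andP; split; lra.
  rewrite sE -iterD addnC; apply: iter_oint; apply/ointP; left; exact: s01'.
rewrite -bigcup_seq; exists k; first by rewrite /= mem_iota.
by rewrite /G (negbTE km) tE; apply: iter_oint; apply/ointP; left.
Qed.

(** For [i > 0] the left-hand side lies in the open m-th interval, which contains no subdivision
    point. *)
Lemma iter_simmap_neq i k k' : (0 < k < n)%N -> (0 < k' < n)%N -> (i, k) != (0%N, k') ->
  T i (alpha k) != alpha k'.
Proof.
move=> hk hk'; case: i => [|i] ne.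
  rewrite /=; have kk' : k != k' by apply: contra ne => /eqP ->.
  move: hk hk' => /andP[_ kn] /andP[_ kn']; have [kk|kk|kk] := ltngtP k k'.
  - by rewrite lt_eqF// (alpha_lt sub)// ltnW.
  - by rewrite gt_eqF// (alpha_lt sub)// ltnW.
  - by rewrite kk eqxx in kk'.
have /andP[h1 h2] := simmap_oitv e sub mn (iter_simmap_oitv i (inner hk)); move: hk' => /andP[_ kn'].
rewrite iterS; apply/eqP => E; rewrite E in h1 h2.
have [km|km] := leqP k' m; first by have := alpha_le sub km (ltnW mn); lra.
by have := alpha_le sub km (ltnW kn'); lra.
Qed.

(** The iterates of every point tend to the fixed point, so a uniform separation requires it to
    differ from the inner subdivision points. If it were one of them, it would be interior to [0,1],
    hence interior to the m-th interval, where no such point lies. *)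
Lemma simmap_fixed_point : exists2 xs, 0 <= xs <= 1 & S xs = xs /\ forall k, (0 < k < n)%N -> alpha k != xs.
Proof.
have /andP[m0 _] := alpha01 sub (ltnW mn); have /andP[_ m1] := alpha01 sub mn.
have A1 := contraction_lt1.
have [xs xs01 Sxs] : exists2 xs, 0 <= xs <= 1 & S xs = xs.
  rewrite /simmap; case: (e m).
    have h : 0 < 1 + A by rewrite addr_gt0.
    exists (alpha m.+1 / (1 + A)); last by field; rewrite gt_eqF.
    have Ap := A0; rewrite (divr_ge0 _ (ltW h)) ?ler_pdivrMr//; lra.
  have h : 0 < 1 - A by rewrite subr_gt0.
  exists (alpha m / (1 - A)); last by field; rewrite gt_eqF.
  by rewrite divr_ge0 ?(ltW h)//= ler_pdivrMr//; lra.
exists xs => //; split=> // k hk; apply/eqP => kE.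
have := inner hk; rewrite kE => xs01'; have := simmap_oitv e sub mn xs01'.
rewrite Sxs -kE => /andP[h1 h2]; move: hk => /andP[_ kn].
have [km|km] := leqP k m; first by have := alpha_le sub km (ltnW mn); lra.
by have := alpha_le sub km (ltnW kn); lra.
Qed.

(** [r2] keeps the subdivision points away from 0 and 1. From the rank [i0] on, iterates are within
    [r1 / 2] of the fixed point, which is at distance at least [r1] from the subdivision points; the
    finitely many remaining comparisons give [r3]. *)
Lemma separation_radius : exists2 rho, 0 < rho &
  (forall k, (0 < k < n)%N -> rho <= alpha k <= 1 - rho) /\
  (forall i k k', (0 < k < n)%N -> (0 < k' < n)%N -> (i, k) != (0%N, k') ->
    rho <= `|T i (alpha k) - alpha k'|).
Proof.
have [xs xs01 [Sxs axs]] := simmap_fixed_point.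
have Txs i : T i xs = xs by elim: i => // i IH; rewrite iterS IH.
have [r1 r10 hr1] : exists2 rho, 0 < rho & forall k : 'I_n, rho <= if (0 < k)%N then `|alpha k - xs| else 1.
  apply: uniform_lower_bound => k; case: ifP => // k0.
  by rewrite normr_gt0 subr_eq0 axs// k0 ltn_ord.
have [r2 r20 hr2] : exists2 rho, 0 < rho & forall k : 'I_n, rho <= if (0 < k)%N then Num.min (alpha k) (1 - alpha k) else 1.
  apply: uniform_lower_bound => k; case: ifP => // k0; have /andP[h1 h2] := inner (k := k) (eq_ind_r is_true (ltn_ord k) (congr1 (andb^~ (k < n)%N) k0)).
  by rewrite lt_min h1 subr_gt0.
have [i0 hi0] : exists i0, forall i, (i0 <= i)%N -> A ^+ i < r1 / 2.
  have h : `|A| < 1 by rewrite (gtr0_norm A0); exact: contraction_lt1.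
  have /cvgrPdist_lt /(_ _ (divr_gt0 r10 (ltr0Sn _ 1))) [N _ hN] := cvg_expr h.
  by exists N => i /hN /=; rewrite sub0r normrN gtr0_norm// exprn_gt0.
have [r3 r30 hr3] : exists2 rho, 0 < rho & forall p : 'I_i0.+1 * ('I_n * 'I_n),
    rho <= if T p.1 (alpha p.2.1) == alpha p.2.2 then 1 else `|T p.1 (alpha p.2.1) - alpha p.2.2|.
  by apply: uniform_lower_bound => p; case: eqP => // /eqP h; rewrite normr_gt0 subr_eq0.
exists (Num.min (r1 / 2) (Num.min r2 r3)); first by rewrite !lt_min r20 r30 divr_gt0.
split=> [k /andP[k0 kn]|i k k' hk hk' ne].
  have := hr2 (Ordinal kn); rewrite /= k0 le_min => /andP[h1 h2].
  have : Num.min (r1 / 2) (Num.min r2 r3) <= r2 by rewrite !ge_min lexx orbT.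
  move: (Num.min _ _) => r hr; apply/andP; split; lra.
rewrite !ge_min; move: (hk) => /andP[k0 kn]; move: (hk') => /andP[k0' kn'].
have [ii0|i0i] := leqP i i0.
  have := hr3 (Ordinal (ii0 : (i < i0.+1)%N), (Ordinal kn, Ordinal kn')).
  by rewrite /= (negbTE (iter_simmap_neq hk hk' ne)) => ->; rewrite !orbT.
apply/orP; left; have := hr1 (Ordinal kn'); rewrite /= k0' => h1.
have h2 : `|T i (alpha k) - xs| <= A ^+ i.
  rewrite -{1}(Txs i) iter_simmapB normrM norm_sg ler_piMr ?exprn_ge0 ?(ltW A0)//.
  have := inner hk; move: xs01 => /andP[? ?] /andP[? ?]; rewrite ler_norml; apply/andP; split; lra.
have h3 := hi0 i (ltnW i0i).
have : `|alpha k' - xs| <= `|T i (alpha k) - alpha k'| + `|T i (alpha k) - xs|.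
  by rewrite [`|T _ _ - alpha k'|]distrC (_ : alpha k' - xs = (alpha k' - T i (alpha k)) + (T i (alpha k) - xs)) ?ler_normD//; ring.
by lra.
Qed.

Theorem selfsimilar_atoms_aux : exists (x : nat -> nat -> R) (lo : nat -> R) (rho c : R),
  geometric_atoms n.-1 A `|d m| rho c mu x lo.
Proof.
have [rho rho0 [in01 sep]] := separation_radius.
have A1 := contraction_lt1.
have hk k : (k < n.-1)%N -> (0 < k.+1 < n)%N by rewrite /= -ltnS prednK// ltnW.
have [c c0 hc] : exists2 c, 0 < c & forall k : 'I_n.-1, c <= fine (mu [set alpha k.+1]).
  apply: uniform_lower_bound => k; have hk1 := hk _ (ltn_ord k); have /andP[h1 h2] := inner hk1.
  have h01 : 0 <= alpha k.+1 <= 1 by rewrite !ltW.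
  rewrite (point_mass hmu)//= subr_gt0 lt_neqAle eq_sym jump//=.
  exact: (right_value_ge hmu h01).
pose lo J := Num.min (T J 0) (T J 1).
have A0' J : 0 < A ^+ J := exprn_gt0 J A0.
have hiE J : lo J + A ^+ J = Num.max (T J 0) (T J 1).
  have := iter_simmapB J 1 0; rewrite subr0 mulr1 => E.
  have := norm_sg J; rewrite -E /lo; have [h|h] := leP (T J 0) (T J 1).
    by rewrite ger0_norm ?subr_ge0// => <-; rewrite addrC subrK.
  by rewrite ltr0_norm ?subr_lt0// opprB => <-; rewrite addrC subrK.
have T0 J : 0 <= T J 0 <= 1 by apply: iter_simmap_itv; rewrite lexx ler01.
have T1 J : 0 <= T J 1 <= 1 by apply: iter_simmap_itv; rewrite lexx ler01.
exists (fun j k => T j (alpha k.+1)), lo, rho, c; split=> //.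
- by rewrite A0.
- by rewrite normr_gt0 dm0.
- move=> j k /hk/in01 /andP[h1 h2].
  (* The interval of radius [rho] about the subdivision point lies in [0,1]; so does its image,
     which is centered at the atom with radius [A ^+ j * rho]. *)
  have s0 : 0 <= T j (alpha k.+1 - rho) <= 1 by apply: iter_simmap_itv; apply/andP; split; lra.
  have s1 : 0 <= T j (alpha k.+1 + rho) <= 1 by apply: iter_simmap_itv; apply/andP; split; lra.
  have e0 := iter_simmapB j (alpha k.+1) (alpha k.+1 - rho); rewrite subKr in e0.
  have e1 := iter_simmapB j (alpha k.+1 + rho) (alpha k.+1); rewrite addrAC subrr add0r in e1.
  have : A ^+ j * rho = `|sg ^+ j * rho| by rewrite normrM norm_sg (gtr0_norm rho0).
  by rewrite [rho * _]mulrC => ->; exact: centered_inside e0 e1 s0 s1.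
(* Pulling both atoms back by the j-th iterate reduces the claim to a subdivision point against an
   atom of generation [j' - j]. If [j > j'], the bound for the older generation is the stronger
   one. *)
- move=> j k j' k' kn kn' ne; wlog jj : j k j' k' kn kn' ne / (j <= j')%N => [H|].
    have [jj|jj] := leqP j j'; first exact: H.
    have := H j' k' j k kn' kn; rewrite eq_sym ne distrC => /(_ isT (ltnW jj)); apply: le_trans.
    by rewrite ler_pM2l// ler_wiXn2l ?(ltW A0) ?(ltW A1)// ltnW.
  have -> : T j' (alpha k'.+1) = T j (T (j' - j) (alpha k'.+1)) by rewrite -iterD subnKC.
  rewrite iter_simmapB normrM norm_sg mulrC ler_pM2l// distrC; apply: sep; [exact: hk|exact: hk|].
  apply: contra ne => /eqP[h1 ->]; rewrite xpair_eqE eqxx andbT eqn_leq jj/=.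
  by rewrite -subn_eq0 h1.
- move=> j k kn; rewrite iter_point_mass ?(inner (hk _ kn))// mulrC ler_wpM2l ?exprn_ge0//.
  exact: (hc (Ordinal kn)).
- move=> J; rewrite hiE /lo le_min ge_max; move: (T0 J) (T1 J) => /andP[-> ->] /andP[-> ->].
  by [].
- move=> J; rewrite hiE (_ : `]lo J, _[%classic = oint (T J 0) (T J 1))// iter_oint_mass ?lexx ?ler01//.
  rewrite ler_piMr ?exprn_ge0// -lee_fin fineK ?probability_le1//; first exact: measurable_oint.
  by apply: fin_num_measure; exact: measurable_oint.
- move=> J; apply: negligibleS (tail_negligible J) => t [t01 [h1 h2]]; split=> //; split=> //.
  by move=> h; apply: h2; rewrite hiE; move: h; rewrite /oint/= in_itv.
Qed.

End SelfSimilarAtoms.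

Theorem selfsimilar_atoms (R : realType) (n : nat) (alpha : nat -> R) (e : nat -> bool)
    (d beta : nat -> R) (m : nat) (mu : probability (measurableTypeR R) R) : (2 <= n)%N ->
  degenerate_selfsimilar n alpha e d beta m mu ->
  mu `[0, 1]%classic = 1%E /\ exists (x : nat -> nat -> R) (lo : nat -> R) (rho c : R),
    geometric_atoms n.-1 (alpha m.+1 - alpha m) `|d m| rho c mu x lo.
Proof.
move=> hn [sub [mn dm0 dm1 dk0] [f [hf jump hmu]]]; split; first exact: hmu.1.
exact: selfsimilar_atoms_aux hn sub mn dm0 dm1 dk0 hf hmu jump.
Qed.

(** * Bump functions *)

Section BumpFunctions.
Context {R : realType}.
Local Notation I01 := (`[0 : R, 1 : R]%classic : set (measurableTypeR R)).
Implicit Types (r : {poly R}) (s t x h : R).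

Definition truncate r s : R := if `|s| < 1 then r.[s] else 0.

Lemma truncate_clamp r s : r.[1] = 0 -> r.[-1] = 0 ->
  truncate r s = r.[Num.max (-1) (Num.min 1 s)].
Proof.
move=> r1 rm1; rewrite /truncate ltr_norml.
have [s1|s1] := ltP s 1; have [sm|sm] := ltP (-1) s => //=; last by lra.
by rewrite max_r ?r1//; lra.
Qed.

Lemma clamp_le s t : `|Num.max (-1) (Num.min 1 s) - Num.max (-1) (Num.min 1 t)| <= `|s - t|.
Proof.
wlog st : s t / t <= s.
  by move=> W; have [/W|/ltW/W] := leP t s; rewrite // distrC [X in _ <= X -> _]distrC.
rewrite [leRHS]ger0_norm ?subr_ge0// ler_norml; apply/andP.
by have [h1|h1] := leP 1 s; have [h2|h2] := leP 1 t; split; rewrite ?maxEle; do ?[case: ifP => ?]; lra.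
Qed.

(** As the polynomial vanishes at 1 and -1, truncation is evaluation at the clamped argument, and
    clamping does not increase distances. *)
Lemma truncate_lipschitz r : r.[1] = 0 -> r.[-1] = 0 ->
  exists2 K, 0 <= K & forall s t, `|truncate r s - truncate r t| <= K * `|s - t|.
Proof.
move=> r1 rm1; have [|K K0 hK] := @poly_lipschitz _ r (-1) 1; first by lra.
exists K => // s t; rewrite !truncate_clamp//.
have cl (u : R) : -1 <= Num.max (-1) (Num.min 1 u) <= 1.
  by rewrite le_max lexx/= ge_max ge_min lexx andbT; lra.
by apply: le_trans (hK _ _ (cl s) (cl t)) _; rewrite ler_wpM2l// clamp_le.
Qed.

Variable l : nat.
Hypothesis l_gt0 : (0 < l)%N.
(** It vanishes to order [l] at both ends: the derivatives of order below [l] extend continuously by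
    zero, and the l-th one may jump but stays bounded, which suffices for the Sobolev space of order
    [l]. *)
Definition bump_poly : {poly R} := (1 - 'X^2) ^+ l.

Lemma bump_poly_derivn i : (i <= l)%N ->
  exists r, bump_poly^`(i) = (1 - 'X^2) ^+ (l - i) * r.
Proof.
elim: i => [|i IH] il; first by exists 1; rewrite subn0 mulr1.
have [r hr] := IH (ltnW il); rewrite derivnS hr subnS.
have : (0 < l - i)%N by rewrite subn_gt0.
case: (l - i)%N => // k _ /=.
exists ((1 - 'X^2)^`() * r *+ k.+1 + (1 - 'X^2) * r^`()).
rewrite derivM deriv_exp; move: (1 - 'X^2) => q.
rewrite exprS /=; move: (q^`()) (r^`()) (q ^+ k) => q' r' s.
rewrite mulrDr; congr (_ + _); last by rewrite [q * _]mulrC -mulrA.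
by rewrite mulrnAl mulrnAr [q' * s]mulrC -mulrA.
Qed.

Lemma bump_poly_root i : (i < l)%N -> bump_poly^`(i).[1] = 0 /\ bump_poly^`(i).[-1] = 0.
Proof.
move=> il; have [r ->] := bump_poly_derivn (ltnW il).
have : (l - i != 0)%N by rewrite -lt0n subn_gt0.
have v1 : (1 - 'X^2 : {poly R}).[1] = 0 by rewrite !hornerE expr1n subrr.
have vm1 : (1 - 'X^2 : {poly R}).[-1] = 0 by rewrite !hornerE sqrrN expr1n subrr.
by move=> /negbTE li; rewrite !hornerM !horner_exp v1 vm1 expr0n li !mul0r.
Qed.

(** The i-th derivative of the bump with center [x] and half-width [h]; the factor [h ^- i] is the
    chain rule. *)
Definition bump x h i t := h ^- i * truncate bump_poly^`(i) ((t - x) / h).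

Lemma bump_center x h : bump x h 0 x = 1.
Proof.
by rewrite /bump /truncate subrr mul0r normr0 ltr01 expr0 invr1 mul1r derivn0 /bump_poly !hornerE/= ?expr0n/= ?subr0 ?expr1n.
Qed.

Lemma bump_outside x h i t : 0 < h -> h <= `|t - x| -> bump x h i t = 0.
Proof.
move=> h0 tx; rewrite /bump /truncate normrM normfV (gtr0_norm h0) ltr_pdivrMr// mul1r ltNge tx/=.
by rewrite mulr0.
Qed.

Definition inner_bump x h i : {poly R} := (h ^- i)%:P * (bump_poly^`(i) \Po (h^-1 *: ('X - x%:P))).

Lemma bump_inside x h i t : 0 < h -> `|t - x| < h -> bump x h i t = (inner_bump x h i).[t].
Proof.
move=> h0 tx; rewrite /bump /truncate normrM normfV (gtr0_norm h0) ltr_pdivrMr// mul1r tx.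
by rewrite /inner_bump hornerM hornerC horner_comp hornerZ hornerXsubC [h^-1 * _]mulrC.
Qed.

Lemma inner_bump_deriv x h i : (inner_bump x h i)^`() = inner_bump x h i.+1.
Proof.
rewrite /inner_bump derivM derivC mul0r add0r deriv_comp derivZ derivB derivX derivC subr0 derivnS.
by rewrite alg_polyC mulrCA -polyCM mulrC exprSr invfM.
Qed.

Lemma bump_bound : exists2 M, 0 <= M & forall i s, (i <= l)%N -> `|truncate bump_poly^`(i) s| <= M.
Proof.
have [M hM] : exists M : nat -> R, forall i, 0 <= M i /\ forall s, `|truncate bump_poly^`(i) s| <= M i.
  apply: (exists_choice (P := fun i M => 0 <= M /\ forall s, `|truncate bump_poly^`(i) s| <= M)) => i.
  have [|c c0 hc] := @poly_bounded _ bump_poly^`(i) (-1) 1; first by lra.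
  exists c; split=> // s; rewrite /truncate; case: ifP; last by rewrite normr0.
  by rewrite ltr_norml => /andP[? ?]; apply: hc; rewrite !ltW.
exists (\sum_(i < l.+1) M i); first by apply: sumr_ge0 => i _; exact: (hM i).1.
move=> i s il; rewrite (bigD1 (Ordinal (il : (i < l.+1)%N)))//=.
by apply: le_trans ((hM i).2 s) _; rewrite lerDl sumr_ge0// => j _; exact: (hM j).1.
Qed.

Lemma bump_ac x h i : 0 < h -> (i < l)%N -> real_ac_derivative (bump x h i) (bump x h i.+1).
Proof.
move=> h0 il; have [r1 rm1] := bump_poly_root il; split.
  have [K K0 hK] := truncate_lipschitz r1 rm1.
  apply: (lipschitz_ac (K := h ^- i * (K / h))) => s t _ _.
  have hi : 0 <= h ^- i by rewrite invr_ge0 exprn_ge0// ltW.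
  rewrite /bump -mulrBr normrM (ger0_norm hi) -mulrA ler_wpM2l//.
  apply: le_trans (hK _ _) _; rewrite -mulrA ler_wpM2l// -mulrBl normrM.
  rewrite opprB addrA subrK normfV (gtr0_norm h0) mulrC//.
exists ([set x - h] `|` [set x + h])%classic; split.
- exact: measurableU.
- by apply: null_setU => //; rewrite lebesgue_measure_set1.
move=> t /= ht; apply: contrapT => tn; apply: ht => _.
have [tx|tx] := ltP `|t - x| h.
  have d := is_derive_poly (inner_bump x h i) t.
  rewrite inner_bump_deriv -bump_inside// in d.
  apply: near_eq_is_derive d.
  near=> s; rewrite -bump_inside//.
  near: s; apply/nbhs_ballP; exists (h - `|t - x|); rewrite /= ?subr_gt0// => s.
  rewrite /ball/= => st; apply: le_lt_trans (ler_distD t _ _) _; rewrite distrC; lra.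
have tx' : h < `|t - x|.
  rewrite lt_neqAle tx andbT; apply/eqP => hE; apply: tn.
  have [h'|h'] := leP 0 (t - x); first by right; rewrite hE ger0_norm//; ring.
  by left; rewrite hE ltr0_norm//; ring.
rewrite bump_outside//; apply: near_eq_is_derive (is_derive_cst (0 : R) t 1).
near=> s; rewrite bump_outside//.
near: s; apply/nbhs_ballP; exists (`|t - x| - h); rewrite /= ?subr_gt0// => s.
rewrite /ball/= => st; have := ler_distD s t x; lra.
Unshelve. all: by end_near.
Qed.

Lemma bump_measurable x h i : 0 < h -> measurable_fun I01 (bump x h i).
Proof.
move=> h0; have -> : bump x h i = fun t => \1_(`]x - h, x + h[%classic) t * (inner_bump x h i).[t].
  apply/funext => t; have [tI|tI] := pselect (x - h < t < x + h).
    rewrite indicE mem_set /= ?in_itv// mul1r bump_inside//.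
    by move: tI => /andP[? ?]; rewrite ltr_norml; apply/andP; split; lra.
  rewrite indicE memNset /= ?in_itv// mul0r bump_outside// leNgt; apply/negP.
  by rewrite ltr_norml => /andP[? ?]; apply: tI; apply/andP; split; lra.
apply: measurable_funM; first exact: measurable_indic.
by apply: cont_measurable; exact: poly_within_continuous.
Qed.

Definition cbump x h i t : R[i] := ((bump x h i t)%:C)%C.

(** The l-th derivative has size h^(-l) on an interval of length 2h, so its squared L2 norm is of
    order h^(1-2l). The squared lower derivatives are at most of order h^(-2i), which is smaller
    since [h <= 1]. *)
Lemma cbump_chain : exists2 M, 0 <= M & forall x h, 0 < h -> h <= x <= 1 - h ->
  [/\ sobolev_chain l (cbump x h 0) (cbump x h),
      forall i, (i < l)%N -> cbump x h i 0 = 0 /\ cbump x h i 1 = 0,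
      forall i t, (i < l)%N -> sqmod (cbump x h i t) <= M ^+ 2 * h ^- (2 * l - 1) &
      L2sq (cbump x h l) <= 2 * M ^+ 2 * h ^- (2 * l - 1)].
Proof.
have [M M0 hM] := bump_bound; exists M => // x h h0 /andP[hx xh].
have h1 : h <= 1 by lra.
have hi k : 0 <= h ^- k by rewrite invr_ge0 exprn_ge0// ltW.
have bd i t : (i <= l)%N -> sqmod (cbump x h i t) <= M ^+ 2 * h ^- (2 * i).
  move=> il; rewrite sqmodR /bump exprMn mulrC -exprVn -exprM mulnC exprVn ler_wpM2r//.
  by rewrite -ler_sqrt ?sqr_ge0// !sqrtr_sqr (ger0_norm M0) hM.
have vanish i t : h <= `|t - x| -> cbump x h i t = 0 by move=> ht; rewrite /cbump bump_outside.
have mI : measurable I01 by exact: measurable_itv.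
have mb i : measurable_fun I01 (bump x h i)  by exact: bump_measurable.
have sqi : (leb R).-integrable I01 (EFin \o (fun t => sqmod (cbump x h l t))).
  apply: (rint_le mI (g := fun=> M ^+ 2 * h ^- (2 * l))).
  - rewrite (_ : (fun t => _) = fun t => bump x h l t * bump x h l t); first exact: measurable_funM.
    by apply/funext => t; rewrite sqmodR expr2.
  - by move=> t _; rewrite ger0_norm ?sqmod_ge0//; exact: bd.
  - exact: cst_rint.
split.
- split=> //; last by split; [exact: mb|exact: measurable_cst|exact: sqi].
  move=> i il; apply/ac_derivativeP; split; first exact: bump_ac.
  split; first by apply: (lipschitz_ac (K := 0)) => s t _ _; rewrite subrr normr0 mul0r.
  by apply: aeW => t _; exact: is_derive_cst.
- move=> i il; split; apply: vanish.
    by rewrite sub0r normrN; apply: le_trans hx (ler_norm _).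
  by apply: le_trans _ (ler_norm _); lra.
- move=> i t il; apply: le_trans (bd i t (ltnW il)) _; rewrite ler_wpM2l ?sqr_ge0//.
  rewrite lef_pV2 ?posrE ?exprn_gt0// ler_wiXn2l ?(ltW h0)//.
  by rewrite -ltnS subn1 prednK ?muln_gt0 ?(leq_ltn_trans _ il)// ltn_pmul2l.
- pose F t := sqmod (cbump x h l t).
  have F0 s t : s <= t -> (forall u, s <= u <= t -> h <= `|u - x|) ->
      \int[leb R]_(u in `[s, t]) F u = 0.
    move=> st hu; rewrite -[RHS](mul0r (t - s)) -(Rintegral_cst_itv 0 st).
    by apply: eq_Rintegral => u; rewrite inE/= in_itv/= => /hu hu'; rewrite /F vanish// sqmod0.
  have sub (s t : R) : 0 <= s -> t <= 1 -> (leb R).-integrable `[s, t] (EFin \o F).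
    by move=> s0 t1; apply: integrable_sub sqi => //; exact: itv_sub01.
  rewrite /L2sq (@Rintegral_cat R F 0 (x - h) 1); [|lra|lra|exact: sub].
  rewrite (@Rintegral_cat R F (x - h) (x + h) 1); [|lra|lra|apply: sub; lra].
  rewrite F0; [|lra|by move=> u /andP[? ?]; rewrite distrC; apply: le_trans _ (ler_norm _); lra].
  rewrite (F0 (x + h)); [|lra|by move=> u /andP[? ?]; apply: le_trans _ (ler_norm _); lra].
  rewrite add0r addr0.
  have -> : 2 * M ^+ 2 * h ^- (2 * l - 1) = M ^+ 2 * h ^- (2 * l) * (x + h - (x - h)).
    have E : (2 * l = (2 * l - 1).+1)%N by rewrite subn1 prednK// muln_gt0.
    have -> : h ^- (2 * l - 1) = h ^- (2 * l) * h.
      by rewrite {2}E [h ^+ _.+1]exprS invfM mulrAC mulVf ?mul1r// gt_eqF.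
    by ring.
  rewrite -Rintegral_cst_itv; last by lra.
  apply: le_Rintegral => //.
  + by apply: sub; lra.
  + by apply: cst_rint => //; apply: itv_sub01; lra.
  + by move=> u _; exact: bd.
Qed.

End BumpFunctions.

(** * Counting eigenvalues *)

Section AtomicIntegrals.
Context {R : realType}.
Local Notation I01 := (`[0 : R, 1 : R]%classic : set (measurableTypeR R)).
Variable mu : probability (measurableTypeR R) R.
Local Notation rint f := (mu.-integrable I01 (EFin \o f)).

Let mI : measurable I01. Proof. exact: measurable_itv. Qed.

Lemma integrable_bounded_prob (g : R -> R) (b : R) : measurable_fun I01 g ->
  (forall t, I01 t -> `|g t| <= b) -> rint g.
Proof.
move=> mg gb; apply: measurable_bounded_integrable => //.
  by rewrite ltey_eq fin_num_measure.
exists b; split; first exact: num_real.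
by move=> c bc t /gb h; apply: le_trans h _; exact: ltW.
Qed.

Lemma Rintegral_simple (I : Type) (s : seq I) (v : I -> R) (A : I -> set (measurableTypeR R)) :
  (forall i, measurable (A i)) -> (forall i, A i `<=` I01) ->
  rint (fun t => \sum_(i <- s) v i * \1_(A i) t) /\
  (\int[mu]_(t in I01) \sum_(i <- s) v i * \1_(A i) t)%R = \sum_(i <- s) v i * fine (mu (A i)).
Proof.
move=> mA AI.
have ind i : rint (\1_(A i) : R -> R).
  apply: (integrable_bounded_prob (b := 1)); first exact: measurable_indic.
  by move=> t _; rewrite indicE; case: (_ \in _); rewrite ?normr1 ?normr0.
have int i : (\int[mu]_(t in I01) \1_(A i) t)%R = fine (mu (A i)).
  by rewrite /Rintegral integral_indic// (setIidl (AI i)).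
elim: s => [|i s [IH1 IH2]].
  rewrite big_nil; have z t : \sum_(i <- [::]) v i * \1_(A i) t = 0 by rewrite big_nil.
  have -> : (fun t => \sum_(i <- [::]) v i * \1_(A i) t) = fun=> 0 by apply/funext.
  by split; [exact: rint0|rewrite Rintegral_cst// mul0r].
have -> : (fun t => \sum_(j <- i :: s) v j * \1_(A j) t) =
    fun t => v i * \1_(A i) t + \sum_(j <- s) v j * \1_(A j) t.
  by apply/funext => t; rewrite big_cons.
have iZ := rintZ mI (v i) (ind i).
split; first exact: (rintD mI iZ IH1).
by rewrite (RintegralD mI iZ IH1) IH2 (RintegralZl _ mI (ind i)) int big_cons.
Qed.

Variables (N : nat) (a delta rho c : R) (x : nat -> nat -> R) (lo : nat -> R).
Hypothesis N0 : (0 < N)%N.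
Hypothesis ga : geometric_atoms N a delta rho c mu x lo.

(* The atoms numbered generation by generation. *)
Definition atom i := x (i %/ N) (i %% N).

Lemma atom_inside i : rho * a ^+ (i %/ N) <= atom i <= 1 - rho * a ^+ (i %/ N).
Proof. by apply: (ga_inside ga); rewrite ltn_mod. Qed.

Lemma atom01 i : 0 <= atom i <= 1.
Proof.
have /andP[h1 h2] := atom_inside i; have /andP[a0 _] := ga_ratio ga; have [rho0 _] := ga_pos ga.
by have := mulr_gt0 rho0 (exprn_gt0 (i %/ N) a0); move: (rho * _) h1 h2 => r h1 h2 r0; apply/andP; split; lra.
Qed.

Lemma atom_separated i j : i != j -> rho * a ^+ (i %/ N) <= `|atom i - atom j|.
Proof.
move=> ij; apply: (ga_separated ga); rewrite ?ltn_mod//.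
by apply: contra ij => /eqP[h1 h2]; rewrite (divn_eq i N) (divn_eq j N) h1 h2.
Qed.

Lemma atom_inj i j : atom i = atom j -> i = j.
Proof.
move=> e; apply/eqP; apply: contraT => /atom_separated; rewrite e subrr normr0 leNgt.
have /andP[a0 _] := ga_ratio ga; have [rho0 _] := ga_pos ga.
by rewrite mulr_gt0 ?exprn_gt0.
Qed.

(** Almost everywhere, [g] is below a simple function: its values at the atoms of the first [J]
    generations, plus [b] on the tail interval. Single atoms have mass at most 1. *)
Lemma integral_atoms_le (g : R -> R) (b : R) J : {within `[0, 1], continuous g} ->
  (forall t, 0 <= t <= 1 -> 0 <= g t) -> 0 <= b ->
  (forall t, lo J < t < lo J + a ^+ J -> g t <= b) ->
  (\int[mu]_(t in I01) g t)%R <= \sum_(i < J * N) g (atom i) + delta ^+ J * b.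
Proof.
move=> cg g0 b0 gb.
have [lo0 hi1] := ga_tail_itv ga J.
pose I := `]lo J, (lo J + a ^+ J)[%classic : set (measurableTypeR R).
(* [None] stands for the tail interval, [Some i] for the i-th atom. *)
pose v (o : option 'I_(J * N)) := if o is Some i then g (atom i) else b.
pose A (o : option 'I_(J * N)) : set (measurableTypeR R) := if o is Some i then [set atom i] else I.
have mA o : measurable (A o) by case: o => [i|] /=; [exact: measurable_set1|exact: measurable_itv].
have AI o : A o `<=` I01.
  case: o => [i|] t /=; first by move=> ->; rewrite in_itv/= atom01.
  by rewrite /I/= !in_itv/= => /andP[? ?]; apply/andP; split; lra.
pose h (t : R) := \sum_o v o * \1_(A o) t.
have [si se] : rint h /\ (\int[mu]_(t in I01) h t)%R = \sum_o v o * fine (mu (A o)).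
  exact: (Rintegral_simple (index_enum _) v mA AI).
have v0 o : 0 <= v o by case: o => [i|//] /=; apply: g0; exact: atom01.
have h0 t : 0 <= h t by apply: sumr_ge0 => o _; rewrite mulr_ge0// indicE.
have gi : rint g by apply: cont_integrable => //; rewrite ltey_eq fin_num_measure.
have le : (\int[mu]_(t in I01) g t)%R <= (\int[mu]_(t in I01) h t)%R.
  rewrite /Rintegral fine_le//; [exact: integrable_fin_num|exact: integrable_fin_num|].
  apply: ae_ge0_le_integral => //.
  - by case/integrableP: gi.
  - by move=> t _; rewrite lee_fin.
  - by case/integrableP: si.
  - apply: negligibleS (ga_support ga J) => t /=; apply: contra_notP => no t01.
    rewrite lee_fin; have [[i tE]|noX] := pselect (exists i : 'I_(J * N), t = atom i).
      rewrite /h (bigD1 (Some i))//= tE indicE mem_set// mulr1 lerDl sumr_ge0// => o _.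
      by rewrite mulr_ge0// indicE.
    have [tI|noI] := pselect (lo J < t < lo J + a ^+ J).
      rewrite /h (bigD1 None)//= indicE mem_set ?mulr1; last by rewrite /I/= in_itv.
      by apply: le_trans (gb t tI) _; rewrite lerDl sumr_ge0// => o _; rewrite mulr_ge0// indicE.
    exfalso; apply: no; split=> //; split=> // j k jJ kN tE.
    have jk : (j * N + k < J * N)%N by rewrite (leq_trans _ (leq_mul jJ (leqnn N)))// mulSn addnC ltn_add2r.
    apply: noX; exists (Ordinal jk); rewrite tE /atom/= divnMDl// modnMDl divn_small// modn_small//.
    by rewrite addn0.
apply: le_trans le _; rewrite se.
rewrite (bigD1 None)//= addrC lerD//.
  rewrite (reindex_omap Some id) /=; last by case.
  rewrite [leLHS](eq_bigl xpredT); last by move=> i; rewrite eqxx.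
  apply: ler_sum => i _; rewrite ler_piMr//; first by apply: g0; exact: atom01.
  by rewrite -lee_fin fineK ?fin_num_measure// probability_le1.
by rewrite mulrC ler_wpM2r//; exact: (ga_tail_mass ga J).
Qed.

Lemma integral_atoms_ge (g : R -> R) J : {within `[0, 1], continuous g} ->
  (forall t, 0 <= t <= 1 -> 0 <= g t) ->
  \sum_(i < J * N) c * delta ^+ (i %/ N) * g (atom i) <= (\int[mu]_(t in I01) g t)%R.
Proof.
move=> cg g0.
pose A (i : 'I_(J * N)) : set (measurableTypeR R) := [set atom i].
have mA i : measurable (A i) by exact: measurable_set1.
have AI i : A i `<=` I01 by move=> t /= ->; rewrite in_itv/= atom01.
have [si se] := Rintegral_simple (index_enum _) (fun i : 'I_(J * N) => g (atom i)) mA AI.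
have gi : rint g by apply: cont_integrable => //; rewrite ltey_eq fin_num_measure.
apply: le_trans (_ : _ <= \sum_(i < J * N) g (atom i) * fine (mu (A i))) _.
  apply: ler_sum => i _; rewrite mulrC ler_wpM2l ?g0 ?atom01//.
  by apply: (ga_atom ga); rewrite ltn_mod.
rewrite -se; apply: (le_Rintegral mI) => // t; rewrite /= in_itv/= => t01.
have [[i tE]|no] := pselect (exists i : 'I_(J * N), t = atom i).
  rewrite (bigD1 i)//= big1 ?addr0.
    by rewrite indicE mem_set// mulr1 tE.
  move=> j ji; rewrite indicE memNset ?mulr0// /A/= tE => /atom_inj ij.
  by case/eqP: ji; apply/val_inj.
rewrite big1 ?g0// => i _; rewrite indicE memNset ?mulr0// => tE.
by apply: no; exists i.
Qed.

End AtomicIntegrals.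

(** * Multiplicities and orthonormal systems of eigenvectors *)

Section EigenvalueCount.
#[local] Opaque qform.
Context {R : realType}.
Local Notation I01 := (`[0 : R, 1 : R]%classic : set (measurableTypeR R)).
Variables (l : nat) (L : (R -> R[i]) -> (R -> R[i]) -> Prop).
Variable mu : probability (measurableTypeR R) R.
Local Notation FD := (form_domain l L).
Local Notation Q := (qform L).
Local Notation M := (sq_inner mu I01).
Local Notation q y := (re (Q y y)).
Hypotheses (hD : subspace FD) (hQ : semi_inner FD Q).
Hypothesis FD_cont : forall y, FD y -> ccont y.
Variable K0 : R.
Hypothesis FD_sup : forall y, FD y -> forall t, 0 <= t <= 1 -> sqmod (y t) <= K0 * q y.

Lemma mass_semi_inner : semi_inner FD M.
Proof.
have mI : measurable I01 by exact: measurable_itv.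
have sq y : FD y -> sq_integrable mu I01 y.
  move=> /FD_cont cy; apply: ccont_sq_integrable => //.
  by rewrite ltey_eq fin_num_measure.
have [h1 h2 h3] := sq_inner_semi mu mI.
by split; [move=> a x y z /sq Dx /sq Dy /sq Dz; exact: h1|move=> x y /sq Dx /sq Dy; exact: h2|
  move=> x /sq Dx; exact: h3].
Qed.

Let hM := mass_semi_inner.

Lemma eigenspaceP nu y : eigenspace_of l L mu nu y <->
  FD y /\ forall z, FD z -> M y z = nu%:C%C * Q y z.
Proof. by split=> -[h1 h2]; split=> // z /h2. Qed.

Lemma eigenspace_subspace nu : subspace (eigenspace_of l L mu nu).
Proof.
split.
  apply/eigenspaceP; split; first exact: (subspace0 hD).
  by move=> z Dz; rewrite (form0l hD hM Dz) (form0l hD hQ Dz) mulr0.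
move=> a x y /eigenspaceP[Dx ex] /eigenspaceP[Dy ey]; apply/eigenspaceP; split; first exact: hD.2.
move=> z Dz; rewrite (form_lin hM a Dx Dy Dz) (form_lin hQ a Dx Dy Dz) ex// ey//.
by rewrite mulrDr mulrCA.
Qed.

(** Dimension at least [k]; the true dimension is the supremum in [dim01]. *)
Definition has_dimension nu k := exists ys : 'I_k -> R -> R[i],
  (forall i, eigenspace_of l L mu nu (ys i)) /\ independent01 ys.

Lemma sum_fun k (c : 'I_k -> R[i]) (ys : 'I_k -> R -> R[i]) t :
  (\sum_i c i *: ys i) t = \sum_i c i * ys i t.
Proof. by elim/big_rec2 : _ => // i u v _ <-. Qed.

Lemma independent_qform_gt0 k (ys : 'I_k -> R -> R[i]) (c : 'I_k -> R[i]) :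
  (forall i, FD (ys i)) -> independent01 ys -> (exists i, c i != 0) -> 0 < q (\sum_i c i *: ys i).
Proof.
move=> Dys ind [i0 ci0]; have Dy := subspace_comb hD c Dys.
rewrite lt_neqAle (form_pos hQ Dy) andbT eq_sym; apply/eqP => q0.
case/eqP: ci0; apply: (ind c) => t; rewrite in_itv/= => t01.
rewrite -sum_fun; apply: sqmod_eq0; apply/eqP; rewrite eq_le sqmod_ge0 andbT.
by apply: le_trans (FD_sup Dy t01) _; rewrite q0 mulr0.
Qed.

(** Eigenvectors with distinct eigenvalues are orthogonal for [Q], so an orthonormal basis of one
    more eigenspace can be appended. *)
Lemma eigen_system_extend lam K e nus v k : eigen_system FD Q M K lam e nus ->
  lam < v -> (forall i, (i < K)%N -> nus i != v) -> has_dimension v k ->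
  exists e' nus', eigen_system FD Q M (K + k) lam e' nus' /\
    forall i, (i < K + k)%N -> (exists2 j, (j < K)%N & nus' i = nus j) \/ nus' i = v.
Proof.
move=> [oe De nl eige] lv ne [ys [Eys ind]].
have Dys i : FD (ys i) by have [] := Eys i.
have [f Ef of_] := orthonormalize hD hQ (eigenspace_subspace v) (fun y (h : eigenspace_of l L mu v y) => h.1)
  Eys (fun c => independent_qform_gt0 Dys ind (c := c)).
have Df j : (j < k)%N -> FD (f j) by move=> /Ef[].
have orth i j : (i < K)%N -> (j < k)%N -> Q (e i) (f j) = 0.
  move=> iK jk; have De' := De i iK; have Df' := Df j jk; have /eigenspaceP[_ ef] := Ef j jk.
  have h1 := eige i _ iK Df'; have h2 := ef _ De'.
  have h3 := form_sym hM De' Df'; rewrite h2 (form_sym hQ De' Df') h1 conjcM conjc_real in h3.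
  have : ((v - nus i)%:C)%C * (Q (e i) (f j))^*%C = 0.
    by rewrite rmorphB /= mulrBl h3 subrr.
  move=> /eqP; rewrite mulf_eq0 => /orP[/eqP h|/eqP h].
    have := congr1 (@complex.Re R) h; rewrite /= => /eqP; rewrite subr_eq0 => /eqP h'.
    by have := ne i iK; rewrite h' eqxx.
  by apply: sqmod_eq0; rewrite -sqmodJ h sqmod0.
pose e' i := if (i < K)%N then e i else f (i - K)%N.
pose nus' i := if (i < K)%N then nus i else v.
have sub i : (i < K + k)%N -> (K <= i)%N -> (i - K < k)%N by move=> h Ki; rewrite ltn_subLR.
exists e', nus'; split; last first.
  by move=> i iKk; rewrite /nus'; have [iK|Ki] := ltnP i K; [left; exists i|right].
split.
- move=> i j hi hj; rewrite /e'; have [iK|Ki] := ltnP i K; have [jK|Kj] := ltnP j K.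
  + exact: oe.
  + by rewrite (orth _ _ iK (sub j hj Kj)) ltn_eqF// (leq_trans iK).
  + rewrite (form_sym hQ (De j jK) (Df _ (sub i hi Ki))) (orth _ _ jK (sub i hi Ki)).
    by rewrite gtn_eqF ?(leq_trans jK)// conjc0.
  + by rewrite of_ ?sub// -(eqn_add2r K) !subnK.
- by move=> i hi; rewrite /e'; have [iK|Ki] := ltnP i K; [exact: De|apply: Df; exact: sub].
- by move=> i hi; rewrite /nus'; have [iK|Ki] := ltnP i K; [exact: nl|].
- move=> i z hi Dz; rewrite /e' /nus'; have [iK|Ki] := ltnP i K; first exact: eige.
  by have /eigenspaceP[_] := Ef _ (sub i hi Ki); apply.
Qed.

Lemma eigen_system_of_dimensions lam (s : seq R) (k : R -> nat) : uniq s ->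
  (forall v, v \in s -> lam < v /\ has_dimension v (k v)) ->
  exists e nus, eigen_system FD Q M (\sum_(v <- s) k v) lam e nus /\
    forall i, (i < \sum_(v <- s) k v)%N -> nus i \in s.
Proof.
elim: s => [_ _|v s IH /= /andP[vs us] hs].
  by rewrite big_nil; exists (fun=> 0), (fun=> 0); split=> //; split.
have [|e [nus [es nuss]]] := IH us; first by move=> w ws; apply: hs; rewrite inE ws orbT.
have [lv dv] := hs v (mem_head _ _).
have [|e' [nus' [es' h]]] := eigen_system_extend es lv _ dv.
  by move=> i /nuss; apply: contraTneq => ->.
rewrite big_cons addnC; exists e', nus'; split=> // i /h[[j jK ->]|->]; last exact: mem_head.
by rewrite inE nuss ?orbT.
Qed.

Lemma dim01_attained (E : (R -> R[i]) -> Prop) n0 :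
  (forall k, (exists ys : 'I_k -> R -> R[i], (forall i, E (ys i)) /\ independent01 ys) -> (k <= n0)%N) ->
  exists2 k, (exists ys : 'I_k -> R -> R[i], (forall i, E (ys i)) /\ independent01 ys) &
    dim01 E = (k%:R)%:E.
Proof.
set S := fun k : nat => exists ys : 'I_k -> R -> R[i], (forall i, E (ys i)) /\ independent01 ys.
move=> hS; have S0 : exists k, `[< S k >].
  exists 0%N; apply/asboolP; exists (fun _ _ => 0); split=> [|c _]; by case.
have bS k : `[< S k >] -> (k <= n0)%N by move=> /asboolP; exact: hS.
case: (ex_maxnP S0 bS) => k /asboolP Sk kmax; exists k => //.
apply/eqP; rewrite eq_le; apply/andP; split.
  apply: ge_ereal_sup => _ [j Sj <-]; rewrite lee_fin ler_nat.
  by apply: kmax; apply/asboolP.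
by apply: ereal_sup_ubound; exists k.
Qed.

(** The infinite sum is the supremum of its finite partial sums, and each of these is the size of an
    orthonormal system joining bases of finitely many eigenspaces. The bound [n0] also makes every
    dimension finite and attained. *)
Lemma eigenvalue_count_le lam n0 :
  (forall K e nus, eigen_system FD Q M K lam e nus -> (K <= n0)%N) ->
  (eigenvalue_count l L mu lam <= n0%:R%:E)%E.
Proof.
move=> hn0; apply: ge_ereal_sup => _ [X [finX Xlam] <-].
have dimb v : lam < v -> forall k, has_dimension v k -> (k <= n0)%N.
  move=> lv k dk; have [|e [nus [es _]]] := @eigen_system_of_dimensions lam [:: v] (fun=> k) isT.
    by move=> w; rewrite inE => /eqP ->.
  by have := hn0 _ _ _ es; rewrite big_seq1.
have [k hk] : exists k : R -> nat, forall v, lam < v ->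
    has_dimension v (k v) /\ dim01 (eigenspace_of l L mu v) = (k v)%:R%:E.
  apply: (exists_choice (P := fun v k => lam < v -> has_dimension v k /\
    dim01 (eigenspace_of l L mu v) = k%:R%:E)) => v.
  have [lv|] := ltP lam v; last by exists 0%N.
  by have [k hk1 hk2] := dim01_attained (dimb v lv); exists k.
rewrite fsbig_finite//=; set s := finmap.enum_fset _.
have us : uniq s by exact: finmap.fset_uniq.
have sX v : v \in s -> lam < v by rewrite in_fset_set// inE => /Xlam.
rewrite big_seq (eq_bigr (fun v => (k v)%:R%:E)); last by move=> v vs; have [] := hk v (sX v vs).
rewrite -big_seq sumEFin lee_fin -natr_sum ler_nat.
have [|e [nus [es _]]] := @eigen_system_of_dimensions lam s k us; last exact: hn0 es.
by move=> v vs; have [h _] := hk v (sX v vs); split=> //; exact: sX.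
Qed.

(** A combination vanishing on [0,1] has zero [M]-pairing with each eigenvector. The eigenvalues
    being positive, its [Q]-pairing is zero too, and that pairing reads off the coefficient. *)
Lemma eigen_system_independent lam K e nus k (f : 'I_k -> nat) : 0 <= lam ->
  eigen_system FD Q M K lam e nus -> injective f -> (forall i, (f i < K)%N) ->
  independent01 (fun i => e (f i)).
Proof.
move=> lam0 [oe De nl eige] finj fK c hc i.
have Dy : FD (\sum_i c i *: e (f i)) by apply: (subspace_comb hD c) => j; exact: De.
have h0 : M (e (f i)) (\sum_i c i *: e (f i)) = 0.
  transitivity (cintegral mu I01 (fun=> 0)); last by apply: cintegral0; exact: measurable_itv.
  by apply: eq_cintegral => t t01; rewrite sum_fun hc// conjc0 mulr0.
have := eige (f i) _ (fK i) Dy; rewrite h0 => /esym/eqP.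
rewrite mulf_eq0 => /orP[/eqP h|/eqP h].
  have := congr1 (@complex.Re R) h; rewrite /= => h'.
  by have := nl _ (fK i); rewrite h' ltNge lam0.
have Def j : FD (e (f j)) by exact: De.
move: h; rewrite (form_combr hD hQ c (u := fun j => e (f j)))//.
rewrite (bigD1 i)//= oe// eqxx mulr1 big1 ?addr0 => [h|j ji].
  by apply: sqmod_eq0; rewrite -sqmodJ h sqmod0.
by rewrite oe// (inj_eq finj) eq_sym (negbTE ji) mulr0.
Qed.

Lemma eigenvalue_count_ge lam K e nus : 0 <= lam -> eigen_system FD Q M K lam e nus ->
  (K%:R%:E <= eigenvalue_count l L mu lam)%E.
Proof.
move=> lam0 es; have [oe De nl eige] := es.
pose s := undup [seq nus i | i <- iota 0 K].
have us : uniq s by exact: undup_uniq.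
have slam v : v \in s -> lam < v.
  by rewrite mem_undup => /mapP[j]; rewrite mem_iota/= => jK ->; exact: nl.
apply: esum_ge; exists [set` s].
  by split; [exact: finite_seq|move=> v /= /slam].
rewrite fsbig_finite; last exact: finite_seq.
rewrite (perm_big s); last first.
  apply: uniq_perm => //; first exact: finmap.fset_uniq.
  move=> v; rewrite in_fset_set; last exact: finite_seq.
  by apply/idP/idP => [/set_mem|vs]; last exact: mem_set.
pose k v := count (fun i => nus i == v) (iota 0 K).
apply: (@le_trans _ _ (\sum_(v <- s) (k v)%:R%:E)%E).
  rewrite sumEFin lee_fin -natr_sum ler_nat /k.
  under eq_bigr => v _ do rewrite -sum1_count big_mkcond.
  rewrite exchange_big /= -[leqLHS](size_iota 0) -sum1_size big_seq [leqRHS]big_seq.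
  apply: leq_sum => i iK; rewrite -big_mkcond /=.
  have si : nus i \in s by rewrite mem_undup map_f.
  by rewrite (big_rem _ si)/= eqxx.
apply: lee_sum => v _; apply: ereal_sup_ubound; exists (k v) => //.
pose t := [seq i <- iota 0 K | nus i == v].
have st : size t = k v by rewrite size_filter.
have ht i : (i < k v)%N -> (nth 0%N t i < K)%N /\ nus (nth 0%N t i) = v.
  by rewrite -st => /(mem_nth 0%N); rewrite mem_filter mem_iota => /andP[/eqP ? /andP[_ ?]].
exists (fun i => e (nth 0%N t i)); split.
  move=> i; have [h1 h2] := ht i (ltn_ord i); apply/eigenspaceP; split; first exact: De.
  by move=> z Dz; rewrite eige// h2.
apply: (eigen_system_independent lam0 es); last by move=> i; exact: (ht i (ltn_ord i)).1.
move=> i j /eqP; rewrite nth_uniq ?st ?filter_uniq ?iota_uniq// => /eqP ij.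
exact: val_inj.
Qed.

End EigenvalueCount.

(** * Two-sided bounds at the geometric levels *)

Section CountBounds.
#[local] Opaque qform.
Context {R : realType}.
Local Notation I01 := (`[0 : R, 1 : R]%classic : set (measurableTypeR R)).
Variables (l : nat) (P : nat -> R -> R).
Hypothesis hl : (0 < l)%N.
Hypothesis hP : forall i, (i < l)%N -> (leb R).-integrable `[0, 1] (EFin \o P i).
Variables (r : nat) (B : 'M[R[i]]_((l + l) + (l + l), r)).
Local Notation L := (diff_operator P B).
Hypothesis hsa : self_adjoint L.
Hypothesis hpos : positive_definite L.
Hypothesis hdom : form_domain_between l L.
Variable mu : probability (measurableTypeR R) R.
Variables (N : nat) (a delta rho c : R) (x : nat -> nat -> R) (lo : nat -> R).
Hypothesis N0 : (0 < N)%N.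
Hypothesis ga : geometric_atoms N a delta rho c mu x lo.
Local Notation FD := (form_domain l L).
Local Notation Q := (qform L).
Local Notation M := (sq_inner mu I01).
Local Notation q y := (re (Q y y)).
Local Notation m y := (re (M y y)).
Local Notation X i := (atom N x i).

Let hD : subspace FD. Proof. exact: (form_domain_subspace hl hsa hpos). Qed.
Let hQ : semi_inner FD Q. Proof. exact: qform_semi_inner hsa hpos. Qed.
Let FD_cont y : FD y -> ccont y. Proof. by move=> Dy; exact: (form_domain_cont hl Dy). Qed.
Let hM : semi_inner FD M. Proof. exact: mass_semi_inner FD_cont. Qed.

Lemma mass_sqmod_cont (y : R -> R[i]) : ccont y -> {within `[0, 1], continuous (fun t : R => sqmod (y t))}.
Proof. by move=> [y1 y2]; rewrite /sqmod; apply: contD; apply: contM. Qed.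

Lemma mass_le y (b : R) J : FD y -> 0 <= b ->
  (forall t, lo J < t < lo J + a ^+ J -> sqmod (y t) <= b) ->
  m y <= \sum_(i < J * N) sqmod (y (X i)) + delta ^+ J * b.
Proof.
move=> /FD_cont cy b0 yb; rewrite sq_innerxx.
by apply: (integral_atoms_le N0 ga (mass_sqmod_cont cy)) => // t _; exact: sqmod_ge0.
Qed.

Lemma mass_ge y J : FD y -> \sum_(i < J * N) c * delta ^+ (i %/ N) * sqmod (y (X i)) <= m y.
Proof.
move=> /FD_cont cy; rewrite sq_innerxx.
by apply: (integral_atoms_ge N0 ga J (mass_sqmod_cont cy)) => // t _; exact: sqmod_ge0.
Qed.

Lemma tail01 J t : lo J < t < lo J + a ^+ J -> 0 <= t <= 1.
Proof. by have [h1 h2] := ga_tail_itv ga J; move=> /andP[? ?]; apply/andP; split; lra. Qed.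

(** The functionals are the evaluations at the atoms of the first [J] generations. The rest has mass
    at most [delta ^+ J], and the sup bound converts it into a small multiple of [q]. *)
Lemma mass_relatively_compact : relatively_compact FD Q M.
Proof.
have [K K0 hK] := form_domain_sup_bound hl hP hsa hpos.
move=> eps e0; have K1 : 0 < K + 1 by rewrite ltr_wpDl.
have /andP[d0 d1] := ga_mass ga.
have [J hJ] : exists J, delta ^+ J < eps / (K + 1).
  have h : `|delta| < 1 by rewrite gtr0_norm.
  have /cvgrPdist_lt /(_ _ (divr_gt0 e0 K1)) [J _ hJ] := cvg_expr h.
  by exists J; have := hJ J (leqnn J); rewrite /= sub0r normrN gtr0_norm// exprn_gt0.
exists (J * N)%N, (fun i y => y (X i)), K; split.
- by [].
- by move=> i y Dy; apply: hK => //; exact: (atom01 N0 ga).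
- move=> y Dy; have q0 := form_pos hQ Dy.
  apply: le_trans (mass_le (J := J) Dy (mulr_ge0 K0 q0) _) _.
    by move=> t /tail01 t01; exact: hK.
  rewrite lerD2l mulrA ler_wpM2r//.
  move: hJ; rewrite ltr_pdivlMr// => hJ; apply: le_trans (ltW hJ).
  by rewrite ler_wpM2l ?lerDl// exprn_ge0// ltW.
Qed.

(** With more than [J * N + l] eigenvectors, some nonzero combination would vanish at all the nodes.
    Its mass would then be at most [lam * q], against [eigen_system_comb]. *)
Lemma eigen_system_size : exists2 C, 0 < C & forall J lam K e nus,
  C * (delta * a ^+ (2 * l - 1)) ^+ J <= lam -> eigen_system FD Q M K lam e nus ->
  (K <= J * N + l)%N.
Proof.
have [C C0 hC] := form_domain_evaluation_estimate hl hP hsa hpos.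
have /andP[a0 _] := ga_ratio ga; have /andP[d0 _] := ga_mass ga.
exists (C + 1); first by rewrite ltr_wpDl.
move=> J lam K e nus hlam es; rewrite leqNgt; apply/negP => hK.
have [h1 h2] := ga_tail_itv ga J.
have [tau [wt [tau01 hw]]] := hC _ _ h1 (exprn_gt0 J a0) h2.
pose node (j : 'I_(J * N + l)) := match fintype.split j with inl i => X i | inr s => tau s end.
have [cf cf0 hcf] := homogeneous_solution (fun (i : 'I_K) j => e i (node j)) hK.
have [oe De nl eige] := es; have Dei (i : 'I_K) : FD (e i) by apply: De.
set y := \sum_i cf i *: e i.
have Dy : FD y := subspace_comb hD cf Dei.
have yn j : y (node j) = 0 by rewrite /y (@sum_fun R K cf (fun i : 'I_K => e i)) hcf.
have yX (i : 'I_(J * N)) : y (X i) = 0.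
  by have := yn (lshift l i); rewrite /node (unsplitK (inl i)).
have yt s : y (tau s) = 0.
  by have := yn (rshift (J * N) s); rewrite /node (unsplitK (inr s)).
have q0 := form_pos hQ Dy.
have b0 : 0 <= C * (a ^+ J) ^+ (2 * l - 1) * q y by rewrite !mulr_ge0// !exprn_ge0// ltW.
have ub := mass_le (J := J) Dy b0.
have : m y <= lam * q y.
  apply: le_trans (ub _) _.
    move=> t /andP[t1 t2]; have := hw y Dy t; rewrite (ltW t1) (ltW t2) big1 ?subr0; first by apply.
    by move=> s _; rewrite yt mulr0.
  rewrite big1 ?add0r => [|i _]; last by rewrite yX sqmod0.
  rewrite mulrA ler_wpM2r//; apply: le_trans hlam.
  rewrite exprMn mulrCA -!exprM [(J * _)%N]mulnC ler_wpM2r ?lerDl//.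
  by rewrite mulr_ge0// exprn_ge0// ltW.
by rewrite leNgt (eigen_system_comb hD hQ hM es cf0).
Qed.

Lemma eigen_system_large : exists2 C, 0 < C & forall J lam, 0 < lam ->
  lam < C * (delta * a ^+ (2 * l - 1)) ^+ J -> exists e nus, eigen_system FD Q M (J * N) lam e nus.
Proof.
have [Ct Ct0 hCt] := form_domain_test_function hl hP hsa hpos hdom.
have [Mb Mb0 hMb] := cbump_chain hl (R := R).
have /andP[a0 a1] := ga_ratio ga; have /andP[d0 d1] := ga_mass ga; have [rho0 c0] := ga_pos ga.
set s := (2 * l - 1)%N; set p := delta * a ^+ s.
have p0 : 0 < p by rewrite mulr_gt0// exprn_gt0.
have as1 : a ^+ s <= 1 by rewrite exprn_ile1// ltW.
have p1 : p < 1 by apply: le_lt_trans d1; rewrite ger_pMr.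
(* Total weight: [p] is 1/q, so an atom of generation j gets the weight q^j. *)
pose W J := \sum_(i < J * N) p ^- (i %/ N).
pose C1 := Ct * (2 * Mb ^+ 2 * rho ^- s).
have C10 : 0 <= C1 by rewrite !mulr_ge0// ?sqr_ge0// invr_ge0 exprn_ge0// ltW.
(* The half-width equals the separation radius of the atom, so the bump vanishes at every other atom
   and coefficients of a combination are its values at the atoms. *)
have bump i : exists u, [/\ FD u, u (X i) = 1, forall j, j != i -> u (X j) = 0 &
    q u <= C1 * a ^- (s * (i %/ N))].
  pose h := rho * a ^+ (i %/ N).
  have h0 : 0 < h by rewrite mulr_gt0// exprn_gt0.
  have [ch ch01 chb chl] := hMb _ _ h0 (atom_inside N0 ga i).
  have hs : 0 <= h ^- s by rewrite invr_ge0 exprn_ge0// ltW.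
  pose b := Num.sqrt (2 * Mb ^+ 2 * h ^- s).
  have b2 : b ^+ 2 = 2 * Mb ^+ 2 * h ^- s by rewrite sqr_sqrtr// !mulr_ge0// sqr_ge0.
  have [||Du qu] := hCt _ _ b ch ch01 (sqrtr_ge0 _).
  - move=> k t kl _; rewrite b2; apply: le_trans (chb k t kl) _.
    by rewrite -mulrA ler_peMl ?mulr_ge0 ?sqr_ge0// ler1n.
  - by rewrite b2.
  exists (cbump l (X i) h 0); split=> //.
  - by rewrite /cbump bump_center.
  - by move=> j ji; rewrite /cbump bump_outside// distrC; apply: (atom_separated N0 ga); rewrite eq_sym.
  - apply: le_trans qu _; rewrite b2 /C1 /h exprMn invfM -exprM mulnC !mulrA //.
have [u hu] := exists_choice bump.
(* The geometric sum is dominated by its last term, so no power of [J] is lost. *)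
have hW J : W J * (1 - p) <= N%:R * p ^- J.
  elim: J => [|J IH]; first by rewrite /W mul0n big_ord0 mul0r mulr_ge0// invr_ge0 exprn_ge0// ltW.
  have -> : W J.+1 = W J + N%:R * p ^- J.
    rewrite /W mulSn addnC big_split_ord /=; congr (_ + _).
    transitivity (\sum_(i < N) p ^- J); last by rewrite sumr_const card_ord mulr_natl.
    by apply: eq_bigr => i _; rewrite divnMDl// divn_small// addn0.
  rewrite exprS invfM mulrDl; apply: le_trans (lerD IH (lexx _)) _.
  have hNp : 0 <= N%:R * p ^- J by rewrite mulr_ge0// invr_ge0 exprn_ge0// ltW.
  rewrite [p^-1 * _]mulrC mulrA; move: (N%:R * p ^- J) hNp => k k0.
  by rewrite ler_pdivlMr// -subr_ge0 (_ : _ - _ = k * (1 - p) ^+ 2); [rewrite mulr_ge0// sqr_ge0|ring].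
(* [C1 / c] compares bump energies, divided by the weights, with masses; [N] and [1 - p] come from
   the bound on [W J]; the added 1 keeps the denominator positive. *)
exists (c * (1 - p) / ((C1 + 1) * N%:R)).
  by rewrite divr_gt0 ?mulr_gt0 ?subr_gt0 ?ltr0n// ltr_wpDl.
move=> J lam lam0 hlam.
have Du (i : 'I_(J * N)) : FD (u i) by have [] := hu i.
apply: (eigen_system_exists hD hQ hM (form_domain_complete hl hP hsa hpos hdom)
  mass_relatively_compact (u := fun i : 'I_(J * N) => u i)) => // cf [i0 cf0].
set y := \sum_i cf i *: u i.
have Dy : FD y := subspace_comb hD cf Du.
have yX (i : 'I_(J * N)) : y (X i) = cf i.
  rewrite /y sum_fun (bigD1 i)//= big1 ?addr0 => [|j ji].
    by have [_ -> _ _] := hu i; rewrite mulr1.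
  by have [_ _ uj _] := hu j; rewrite uj ?mulr0// eq_sym.
apply: lt_le_trans (mass_ge J Dy).
under eq_bigr do rewrite yX.
have w0 (i : 'I_(J * N)) : 0 < p ^- (i %/ N) by rewrite invr_gt0 exprn_gt0.
have W0 : 0 < W J by rewrite /W (bigD1 i0)//= ltr_wpDr// sumr_ge0// => i _; exact: ltW.
pose Sm := \sum_(i < J * N) c * delta ^+ (i %/ N) * sqmod (cf i).
(* Dividing the bump energy a^(-j(2l-1)) by the weight leaves delta^j, the order of the mass of the
   atom; this is why the weights are q^j. *)
have qy : q y <= W J * (C1 / c * Sm).
  apply: le_trans (qform_wsum hD hQ (index_enum 'I_(J * N)) w0 (F := fun i => cf i *: u i) _) _.
    by move=> i; exact: subspaceZ.
  apply: ler_wpM2l; first exact: ltW.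
  rewrite /Sm mulr_sumr; apply: ler_sum => i _; rewrite (qformZ hD hQ)//.
  have [_ _ _ qu] := hu i.
  rewrite invrK (_ : C1 / c * _ = sqmod (cf i) * (C1 * a ^- (s * (i %/ N))) * p ^+ (i %/ N)).
    by rewrite ler_wpM2r ?exprn_ge0 ?(ltW p0)// ler_wpM2l// sqmod_ge0.
  rewrite /p exprMn -exprM; have ha : a ^+ (s * (i %/ N)) != 0 by rewrite gt_eqF// exprn_gt0.
  by move: (a ^+ _) ha => A A0; field; rewrite A0 gt_eqF.
have Sm0 : 0 < Sm.
  rewrite /Sm (bigD1 i0)//= ltr_wpDr//.
    by apply: sumr_ge0 => i _; rewrite !mulr_ge0 ?sqmod_ge0 ?exprn_ge0// ltW.
  rewrite !mulr_gt0 ?exprn_gt0// lt_neqAle sqmod_ge0 andbT eq_sym.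
  by apply: contra cf0 => /eqP /sqmod_eq0 ->.
apply: le_lt_trans (ler_wpM2l (ltW lam0) qy) _.
rewrite (_ : lam * _ = (lam * W J * C1 / c) * Sm); last by ring.
rewrite gtr_pMl// ltr_pdivrMr// mul1r.
apply: le_lt_trans (_ : _ <= lam * W J * (C1 + 1)) _.
  by rewrite ler_wpM2l ?lerDl ?ler01//; rewrite mulr_ge0// ltW.
have Nr : 0 < N%:R :> R by rewrite ltr0n.
have C11 : 0 < C1 + 1 by rewrite ltr_wpDl.
have p1' : 0 < 1 - p by rewrite subr_gt0.
have pJ : 0 < p ^+ J by rewrite exprn_gt0.
have WJ : W J * (1 - p) * p ^+ J <= N%:R.
  by have := hW J; rewrite ler_pdivlMr.
move: hlam; rewrite mulrAC ltr_pdivlMr ?mulr_gt0// => hlam.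
have := ltr_pM2r W0; move=> /(_ (lam * ((C1 + 1) * N%:R)) (c * (1 - p) * p ^+ J)).
rewrite hlam => h; have {}h : lam * ((C1 + 1) * N%:R) * W J < c * N%:R.
  apply: lt_le_trans h _.
  by rewrite (_ : _ * W J = c * (W J * (1 - p) * p ^+ J)); [rewrite ler_pM2l|ring].
by rewrite -(ltr_pM2r Nr); apply: le_lt_trans h; rewrite le_eqVlt; apply/orP; left; apply/eqP; ring.
Qed.

Theorem eigenvalue_count_bounds : exists C1 C2, [/\ 0 < C1, 0 < C2,
  forall J lam, C1 * (delta * a ^+ (2 * l - 1)) ^+ J <= lam ->
    (eigenvalue_count l L mu lam <= (J * N + l)%:R%:E)%E &
  forall J lam, 0 < lam -> lam < C2 * (delta * a ^+ (2 * l - 1)) ^+ J ->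
    ((J * N)%:R%:E <= eigenvalue_count l L mu lam)%E].
Proof.
have [C1 C10 h1] := eigen_system_size; have [C2 C20 h2] := eigen_system_large.
have [K0 _ hK0] := form_domain_sup_bound hl hP hsa hpos.
exists C1, C2; split=> // J lam.
  move=> hlam; apply: (eigenvalue_count_le hD hQ FD_cont hK0) => K e nus.
  exact: h1.
move=> lam0 /(h2 J lam lam0)[e [nus es]].
by apply: (eigenvalue_count_ge hD hQ (ltW lam0) es).
Qed.

End CountBounds.

(** With Lam = ln(1/lam) / ln(1/p), each bound is applied at the integer [J] nearest to its
    threshold. This gives [f lam] = N Lam up to an error at most N kap, and Lam tends to
    infinity. *)
Lemma geometric_counting_limit (R : realType) (f : R -> \bar R) (N l : nat) (p C1 C2 : R) :
  (0 < N)%N -> 0 < p < 1 -> 0 < C1 -> 0 < C2 ->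
  (forall J lam, C1 * p ^+ J <= lam -> (f lam <= (J * N + l)%:R%:E)%E) ->
  (forall J lam, 0 < lam -> lam < C2 * p ^+ J -> ((J * N)%:R%:E <= f lam)%E) ->
  (f lam * (N%:R * (ln lam^-1 / ln p^-1))^-1%:E)%E @[lam --> (0 : R)^'+] --> 1%E.
Proof.
move=> N0 /andP[p0 p1] C10 C20 ub lb.
have Nr : 0 < N%:R :> R by rewrite ltr0n.
have th0 : 0 < ln p^-1 by rewrite ln_gt0// invf_gt1.
set th := ln p^-1 in th0 *.
have pJ J : ln (p ^+ J) = - (J%:R * th).
  by rewrite lnXn// /th lnV ?posrE// mulrN opprK mulr_natl.
pose A := `|ln C1 / th|; pose B := `|ln C2 / th|.
have A0 : 0 <= A by exact: normr_ge0.
have B0 : 0 <= B by exact: normr_ge0.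
pose Lam (lam : R) := ln lam^-1 / th.
pose kap := A + B + 2 + l%:R.
have kap0 : 0 < kap by rewrite /kap; have := ler0n R l; lra.
have lnL lam : 0 < lam -> ln lam = - (Lam lam * th).
  by move=> l0; rewrite /Lam divfK ?gt_eqF// lnV ?posrE// opprK.
have bounds lam : 0 < lam -> B + 1 < Lam lam ->
    ((N%:R * (Lam lam - kap))%:E <= f lam)%E /\ (f lam <= (N%:R * (Lam lam + kap))%:E)%E.
  move=> l0 hL; split.
    (* [B] compensates the constant [C2] on the logarithmic scale, and the extra 1 makes the
       inequality on [lam] strict. *)
    pose J := Num.truncn (Lam lam - B - 1).
    have /andP[J1 J2] : J%:R <= Lam lam - B - 1 < J.+1%:R by apply: truncn_itv; lra.
    apply: le_trans (lb J lam l0 _).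
      rewrite lee_fin natrM mulrC ler_wpM2r ?(ltW Nr)//.
      by move: J2; rewrite -natr1 /kap; have := ler0n R l; lra.
    rewrite -ltr_ln ?posrE ?mulr_gt0 ?exprn_gt0// lnM ?posrE ?exprn_gt0// pJ (lnL _ l0).
    have : - B <= ln C2 / th by rewrite /B; have := ler_norm (- (ln C2 / th)); rewrite normrN; lra.
    rewrite ler_pdivlMr// => h; have : J%:R * th <= (Lam lam - B - 1) * th by rewrite ler_pM2r.
    by rewrite !mulrBl mul1r mulNr in h *; lra.
  (* Rounding is upward here, so that [C1 * p ^+ J] falls below [lam]. *)
  pose J := (Num.truncn (Lam lam + A)).+1.
  have /andP[J1 J2] : (J.-1)%:R <= Lam lam + A < J%:R by apply: truncn_itv; lra.
  apply: le_trans (ub J lam _) _.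
    rewrite -ler_ln ?posrE ?mulr_gt0 ?exprn_gt0// lnM ?posrE ?exprn_gt0// pJ (lnL _ l0).
    have : ln C1 / th <= A by exact: ler_norm.
    rewrite ler_pdivrMr// => h; have : (Lam lam + A) * th <= J%:R * th by rewrite ler_pM2r// ltW.
    by rewrite mulrDl; lra.
  rewrite lee_fin natrD natrM.
  (* All errors are written as multiples of [N], so that dividing by [N%:R * Lam lam] leaves
     [kap / Lam lam]. *)
  have lN : l%:R <= N%:R * l%:R :> R by rewrite ler_peMl// ler1n.
  have JE : J%:R = (J.-1)%:R + 1 :> R by rewrite /J -natr1.
  have h : J%:R * N%:R <= N%:R * (Lam lam + A + 1).
    by rewrite mulrC ler_pM2l// JE lerD2r.
  rewrite (_ : N%:R * (Lam lam + kap) = N%:R * (Lam lam + A + 1) + N%:R * l%:R + N%:R * (B + 1)); last first.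
    by rewrite /kap; ring.
  have : 0 <= N%:R * (B + 1) by rewrite mulr_ge0// addr_ge0.
  by lra.
have small y : \forall lam \near (0 : R)^'+, 0 < lam /\ y < Lam lam.
  near=> lam; have l0 : 0 < lam by near: lam; exact: nbhs_right_gt.
  split=> //; have hl : lam < expR (- (y * th)).
    by near: lam; apply: nbhs_right_lt; exact: expR_gt0.
  move: hl; rewrite -[X in X < _](@lnK _ lam) ?posrE// ltr_expR lnL// ltrN2.
  by rewrite ltr_pM2r.
pose g lam := fine (f lam) / (N%:R * Lam lam).
have key lam : 0 < lam -> B + 1 < Lam lam ->
    (f lam * (N%:R * Lam lam)^-1%:E)%E = (g lam)%:E /\ `|1 - g lam| <= kap / Lam lam.
  move=> l0 hL; have [h1 h2] := bounds lam l0 hL.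
  have L0 : 0 < Lam lam by lra.
  have ff : f lam \is a fin_num by rewrite fin_numE; move: h1 h2; case: (f lam).
  rewrite -(fineK ff) !lee_fin in h1 h2; rewrite -{1}(fineK ff); split=> //.
  rewrite /g (_ : 1 - _ = (N%:R * Lam lam - fine (f lam)) / (N%:R * Lam lam)); last first.
    by field; rewrite !gt_eqF.
  have NL0 : 0 < N%:R * Lam lam by exact: mulr_gt0.
  rewrite normrM normfV (gtr0_norm NL0) ler_pdivrMr//.
  rewrite (_ : kap / _ * _ = N%:R * kap); last by field; rewrite gt_eqF.
  rewrite mulrBr in h1; rewrite mulrDr in h2; rewrite ler_norml.
  move: (N%:R * Lam lam) (N%:R * kap) (fine (f lam)) h1 h2 => u v w h1 h2.
  by apply/andP; split; lra.
have gl : g lam @[lam --> (0 : R)^'+] --> (1 : R).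
  apply/cvgrPdist_lt => eps e0; near=> lam.
  have [l0 hL] : 0 < lam /\ Num.max (B + 1) (kap / eps) < Lam lam by near: lam; exact: small.
  move: hL; rewrite gt_max => /andP[hL1 hL2].
  have [_ h] := key lam l0 hL1; apply: le_lt_trans h _.
  have L0 : 0 < Lam lam by lra.
  by rewrite ltr_pdivrMr// mulrC -ltr_pdivrMr.
apply/fine_cvgP; split.
  near=> lam; have [l0 hL] : 0 < lam /\ B + 1 < Lam lam by near: lam; exact: small.
  by have [-> _] := key lam l0 hL.
apply: cvg_trans gl; apply: near_eq_cvg; near=> lam.
have [l0 hL] : 0 < lam /\ B + 1 < Lam lam by near: lam; exact: small.
by have [k1 _] := key lam l0 hL; rewrite /= k1.
Unshelve. all: by end_near.
Qed.

Theorem theorem3p1 (R : realType)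
    (l : nat) (hl : (1 <= l)%N)
    (P : nat -> R -> R)
    (hP : forall i, (i < l)%N -> (leb R).-integrable `[0, 1] (EFin \o P i))
    (r : nat) (B : 'M[R[i]%C]_((l + l) + (l + l), r))
    (hsa : self_adjoint (diff_operator P B))
    (hpos : positive_definite (diff_operator P B))
    (hdom : form_domain_between l (diff_operator P B))
    (n : nat) (hn : (2 <= n)%N)
    (alpha : nat -> R) (e : nat -> bool) (d beta : nat -> R) (m : nat)
    (mu : probability (measurableTypeR R) R)
    (hmu : degenerate_selfsimilar n alpha e d beta m mu) :
  let q := (`|d m| * (alpha m.+1 - alpha m) ^+ (2 * l - 1))^-1 in
  1 < q /\
  (eigenvalue_count l (diff_operator P B) mu lambda
     * ((n%:R - 1) * (ln (lambda^-1) / ln q))^-1%:E)%E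
    @[lambda --> (0 : R)^'+] --> 1%E.
Proof.
have [_ [x [lo [rho [c ga]]]]] := selfsimilar_atoms hn hmu.
have /andP[a0 a1] := ga_ratio ga; have /andP[d0 d1] := ga_mass ga.
have n1 : (0 < n.-1)%N by case: (n) hn => [|[]].
have p01 : 0 < `|d m| * (alpha m.+1 - alpha m) ^+ (2 * l - 1) < 1.
  rewrite mulr_gt0 ?exprn_gt0//=; apply: le_lt_trans d1.
  by rewrite ger_pMr// exprn_ile1// ltW.
have /andP[p0 p1] := p01; split; first by rewrite invf_gt1.
have [C1 [C2 [C10 C20 ub lb]]] := eigenvalue_count_bounds hl hP hsa hpos hdom n1 ga.
have -> : n%:R - 1 = n.-1%:R :> R by rewrite -[in LHS](prednK (ltnW hn)) -natr1 addrK.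
exact: geometric_counting_limit n1 p01 C10 C20 ub lb.
Qed.
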